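(* Let $K$ be a number field of degree $n=[K:\mathbb Q]$ with ring of integers $\mathscr O$, let $\theta$ be a field automorphism of $K$ with $\theta^2=\mathrm{id}$, let $\mathrm{tr}_{K,\theta}(x,y):=\mathrm{Trace}_{K/\mathbb Q}(x\theta(y))$, and let $m$ be the positive integer with $\mathrm{Trace}_{K/\mathbb Q}(\mathscr O)=m\mathbb Z$. The following are equivalent: (a) $(\mathscr O,\mathrm{tr}_{K,\theta})$ is similar to an even primitive root lattice; (b) $(\mathscr O,\mathrm{tr}_{K,\theta}/m)$ is an even primitive root lattice; (c) $n$ is even and $(\mathscr O,\mathrm{tr}_{K,\theta}/m)$ is isometric to $\mathbb A_2^{n/2}$; (d) $K$ is a $2^a3^b$th cyclotomic field for some positive integers $a,b$, and $\theta$ is complex conjugation. If these hold, then $n=2^a3^{b-1}$ and $m=n/2$. Moreover, in (d), if $\zeta_{2^a},\zeta_{3^b}\in K$ are primitive $2^a$th and $3^b$th roots of unity and $x_{i,j}:=\zeta_{2^a}^i\zeta_{3^b}^j$, then the indecomposable components of the root lattice $(\mathscr O,\mathrm{tr}_{K,\theta}/m)$ are exactly the sublattices $\mathbb Zx_{i,j}+\mathbb Zx_{i,j+3^{b-1}}$ for $0\le i\le 2^{a-1}-1$, $0\le j\le 3^{b-1}-1$, and for all such $i,j$ the values of $\mathrm{tr}_{K,\theta}/m$ at $(x_{i,j},x_{i,j})$, $(x_{i,j+3^{b-1}},x_{i,j+3^{b-1}})$, $(x_{i,j},x_{i,j+3^{b-1}})$ are $2$, $2$, $-1$ respectively.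
   Context: A lattice is a pair $(L,b)$, $L$ a free $\mathbb Z$-module of finite rank, $b$ a nondegenerate symmetric $\mathbb Z$-valued bilinear form. It is even if $b(x,x)$ is even for all $x$, primitive if $\gcd\{b(x,y):x,y\in L\}=1$. Lattices $(L_1,b_1),(L_2,b_2)$ are similar if there are nonzero integers $m_1,m_2$ with $(L_1,m_1b_1)$ isometric to $(L_2,m_2b_2)$. A root lattice is a nonzero lattice isometric to an orthogonal direct sum of lattices $\mathbb Z^1$, $\mathbb A_\ell$ ($\ell\ge1$), $\mathbb D_\ell$ ($\ell\ge4$), $\mathbb E_6,\mathbb E_7,\mathbb E_8$ (standard definitions; e.g. $\mathbb A_\ell=\{x\in\mathbb Z^{\ell+1}:\sum x_j=0\}$ with the dot product); equivalently a positive-definite lattice generated by vectors $x$ with $b(x,x)\in\{1,2\}$. $\mathbb A_2^{s}$ is the orthogonal sum of $s$ copies of $\mathbb A_2$. Indecomposable components are the summands of the unique decomposition of a root lattice into indecomposable orthogonal summands. *)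

(* Defs.v *)
From HB Require Import structures.
From mathcomp Require Import all_boot all_order all_algebra all_field.
From mathcomp Require Import boolp classical_sets functions ring.

Set Implicit Arguments.
Unset Strict Implicit.
Unset Printing Implicit Defensive.

Import Order.TTheory GRing.Theory Num.Theory.
Local Open Scope ring_scope.

Section Zsub.
Variables (V : zmodType) (S : zmodClosed V).

Record zsub := Zsub { zsub_val : V; _ : zsub_val \in S }.

HB.instance Definition _ := [isSub for zsub_val].
HB.instance Definition _ := [Choice of zsub by <:].
HB.instance Definition _ := [SubChoice_isSubZmodule of zsub by <:].

End Zsub.

(* A Z-module with a rational-valued form. Rational values make (O, tr / m)
   writable before it is known to be integral; integrality is part of
   [is_lattice]. *)
Record zform := ZForm {
  zcar :> zmodType;
  lform : zcar -> zcar -> rat }.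
Arguments lform {z}.

Definition free_of_finite_rank (L : zmodType) : Prop :=
  exists (r : nat) (e : 'I_r -> L),
    bijective (fun c : {ffun 'I_r -> int} => \sum_i e i *~ c i).

Definition is_lattice (L : zform) : Prop :=
  [/\ free_of_finite_rank L,
      forall x y : L, lform x y \is a Num.int,
      forall x y : L, lform x y = lform y x,
      forall x y z : L, lform (x + y) z = lform x z + lform y z
    & forall x : L, (forall y, lform x y = 0) -> x = 0].

Definition even_lattice (L : zform) : Prop :=
  forall x : L, exists k : int, lform x x = (2 * k)%:~R.

(* gcd = 1, i.e. 1 is the only nonnegative common divisor of all the values
   (0 is one exactly when the form vanishes). *)
Definition primitive_lattice (L : zform) : Prop :=
  forall d : nat,
    (forall x y : L, exists k : int, lform x y = (d%:Z * k)%:~R) -> d = 1%N.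

Definition isometric_lattices (L M : zform) : Prop :=
  exists f : {additive L -> M},
    bijective f /\ forall x y, lform (f x) (f y) = lform x y.

Definition scale_lattice (c : rat) (L : zform) : zform :=
  @ZForm L (fun x y => c * lform x y).

Definition similar_lattices (L M : zform) : Prop :=
  exists m1 m2 : int,
    [/\ m1 != 0, m2 != 0
      & isometric_lattices (scale_lattice m1%:~R L) (scale_lattice m2%:~R M)].

Definition osum (L M : zform) : zform :=
  @ZForm (L * M)%type (fun x y => lform x.1 y.1 + lform x.2 y.2).

Definition zero_lattice : zform := @ZForm 'rV[int]_0 (fun _ _ => 0).

Definition orthogonal_sum (s : seq zform) : zform := foldr osum zero_lattice s.

Definition dot (R : pzRingType) N (x y : 'rV[R]_N) : R :=
  \sum_j x 0 j * y 0 j.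

Definition A_pred (l : nat) : {pred 'rV[int]_l.+1} :=
  fun x => \sum_j x 0 j == 0.

Definition D_pred (l : nat) : {pred 'rV[int]_l} :=
  fun x => (2 %| \sum_j x 0 j)%Z.

(* E8 = {x in Z^8 or x in (Z + 1/2)^8 : sum of coordinates even}; E7 and E6 are
   the orthogonal complements in E8 of the root e_6 - e_7, resp. of the copy of
   A_2 spanned by e_5 - e_6 and e_6 - e_7 (coordinates numbered from 0). *)
Definition E8_pred : {pred 'rV[rat]_8} :=
  fun x => ([forall j, x 0 j \is a Num.int] ||
            [forall j, x 0 j - 2^-1 \is a Num.int]) &&
           ((\sum_j x 0 j) / 2 \is a Num.int).

Definition E7_pred : {pred 'rV[rat]_8} :=
  fun x => (x \in E8_pred) && (x 0 (inord 6) == x 0 (inord 7)).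

Definition E6_pred : {pred 'rV[rat]_8} :=
  fun x => (x \in E7_pred) && (x 0 (inord 5) == x 0 (inord 6)).

Fact A_pred_closed l : zmod_closed (@A_pred l).
Proof.
split=> [|x y]; rewrite !unfold_in.
  by rewrite big1 // => j _; rewrite mxE.
move=> /eqP hx /eqP hy; apply/eqP.
under eq_bigr do rewrite !mxE.
by rewrite sumrB hx hy subrr.
Qed.
HB.instance Definition _ l := GRing.isZmodClosed.Build _ (@A_pred l)
  (@A_pred_closed l).

Fact D_pred_closed l : zmod_closed (@D_pred l).
Proof.
split=> [|x y]; rewrite /in_mem /= /D_pred.
  by rewrite big1 // => j _; rewrite mxE.
move=> hx hy.
under eq_bigr do rewrite !mxE.
by rewrite sumrB rpredB.
Qed.
HB.instance Definition _ l := GRing.isZmodClosed.Build _ (@D_pred l)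
  (@D_pred_closed l).

Fact E8_pred_closed : zmod_closed E8_pred.
Proof.
split=> [|x y]; rewrite /in_mem /= /E8_pred.
  apply/andP; split; last by rewrite big1 ?mul0r // => j _; rewrite mxE.
  by apply/orP; left; apply/forallP=> j; rewrite mxE.
move=> /andP[hx sx] /andP[hy sy]; apply/andP; split; last first.
  under eq_bigr do rewrite !mxE.
  by rewrite sumrB mulrBl rpredB.
have half1 : 2^-1 + 2^-1 \is a @Num.int rat by [].
case/orP: hx => /forallP hx; case/orP: hy => /forallP hy; apply/orP.
- by left; apply/forallP=> j; rewrite !mxE rpredB.
- right; apply/forallP=> j; rewrite !mxE.
  have -> : x 0 j - y 0 j - 2^-1 = x 0 j - (y 0 j - 2^-1) - (2^-1 + 2^-1).
    by ring.
  by apply: rpredB half1; apply: rpredB; [exact: hx | exact: hy].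
- right; apply/forallP=> j; rewrite !mxE.
  by rewrite addrAC rpredB.
- left; apply/forallP=> j; rewrite !mxE.
  have -> : x 0 j - y 0 j = (x 0 j - 2^-1) - (y 0 j - 2^-1).
    by rewrite opprB addrA subrK.
  by rewrite rpredB.
Qed.
HB.instance Definition _ := GRing.isZmodClosed.Build _ E8_pred E8_pred_closed.

Fact E7_pred_closed : zmod_closed E7_pred.
Proof.
split=> [|x y]; rewrite -!topredE /= /E7_pred.
  by rewrite rpred0 !mxE eqxx.
move=> /andP[hx /eqP ex] /andP[hy /eqP ey].
by rewrite rpredB //= !mxE ex ey.
Qed.
HB.instance Definition _ := GRing.isZmodClosed.Build _ E7_pred E7_pred_closed.

Fact E6_pred_closed : zmod_closed E6_pred.
Proof.
split=> [|x y]; rewrite -!topredE /= /E6_pred.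
  by rewrite rpred0 !mxE eqxx.
move=> /andP[hx /eqP ex] /andP[hy /eqP ey].
by rewrite rpredB //= !mxE ex ey.
Qed.
HB.instance Definition _ := GRing.isZmodClosed.Build _ E6_pred E6_pred_closed.

Definition Z1_lattice : zform := @ZForm int (fun x y => (x * y)%:~R).

Definition A_lattice (l : nat) : zform :=
  @ZForm (zsub (@A_pred l)) (fun x y => (dot (val x) (val y))%:~R).

Definition D_lattice (l : nat) : zform :=
  @ZForm (zsub (@D_pred l)) (fun x y => (dot (val x) (val y))%:~R).

Definition E6_lattice : zform :=
  @ZForm (zsub E6_pred) (fun x y => dot (val x) (val y)).

Definition E7_lattice : zform :=
  @ZForm (zsub E7_pred) (fun x y => dot (val x) (val y)).

Definition E8_lattice : zform :=
  @ZForm (zsub E8_pred) (fun x y => dot (val x) (val y)).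

Inductive root_type := RZ | RA of nat | RD of nat | RE6 | RE7 | RE8.

Definition valid_root_type (t : root_type) : bool :=
  match t with
  | RA l => (1 <= l)%N
  | RD l => (4 <= l)%N
  | _ => true
  end.

Definition lattice_of_type (t : root_type) : zform :=
  match t with
  | RZ => Z1_lattice
  | RA l => A_lattice l
  | RD l => D_lattice l
  | RE6 => E6_lattice
  | RE7 => E7_lattice
  | RE8 => E8_lattice
  end.

Definition root_lattice (L : zform) : Prop :=
  [/\ is_lattice L, exists x : L, x != 0
    & exists s : seq root_type,
        all valid_root_type s /\
        isometric_lattices L (orthogonal_sum (map lattice_of_type s))].

Definition even_primitive_root_lattice (L : zform) : Prop :=
  [/\ even_lattice L, primitive_lattice L & root_lattice L].

Definition A2_power (s : nat) : zform := orthogonal_sum (nseq s (A_lattice 2)).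

Local Open Scope classical_set_scope.

Definition is_subgroup (L : zmodType) (S : set L) : Prop :=
  S 0 /\ forall x y, S x -> S y -> S (x - y).

(* The bijectivity of the summation map says that the sum of the S i is direct
   and equal to T. *)
Definition orthogonal_decomposition (L : zform) (T : set L) (I : finType)
    (S : I -> set L) : Prop :=
  [/\ forall i, is_subgroup (S i),
      forall i j, i != j -> forall x y, S i x -> S j y -> lform x y = 0
    & set_bij [set y : {ffun I -> L} | forall i, S i (y i)] T
        (fun y => \sum_i y i)].

Definition indecomposable (L : zform) (T : set L) : Prop :=
  (exists2 x, T x & x != 0) /\
  forall A B : set L,
    orthogonal_decomposition T (fun c : bool => if c then A else B) ->
    A = [set 0] \/ B = [set 0].

Definition indecomposable_components (L : zform) (D : set (set L)) : Prop :=
  exists (k : nat) (S : 'I_k -> set L),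
    [/\ orthogonal_decomposition [set: L] S,
        forall i, indecomposable (S i)
      & D = range S].

Section NumberField.
Variable K : fieldExtType rat.

Definition ring_of_integers : {pred K} :=
  fun x => `[< integralOver (intr : int -> K) x >].

Fact ring_of_integers_closed : zmod_closed ring_of_integers.
Proof.
split=> [|x y]; rewrite /in_mem /= /ring_of_integers.
  by apply/asboolP; exact: integral0.
by move=> /asboolP hx /asboolP hy; apply/asboolP; exact: integral_sub.
Qed.
HB.instance Definition _ :=
  GRing.isZmodClosed.Build _ ring_of_integers ring_of_integers_closed.

Definition Trace (x : K) : rat :=
  \tr (passmx.mxof (vbasis {:K}) (vbasis {:K}) (amull x)).

Definition tr_form (theta : K -> K) (x y : K) : rat := Trace (x * theta y).

Definition trace_lattice (theta : K -> K) : zform :=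
  @ZForm (zsub ring_of_integers) (fun x y => tr_form theta (val x) (val y)).

Definition is_cyclotomic_field (N : nat) : Prop :=
  exists2 z : K, N.-primitive_root z & <<1; z>>%VS = {:K}%VS.

(* For all complex embeddings phi; they all take values in the algebraic
   numbers algC, and at least one exists. *)
Definition is_complex_conjugation (theta : K -> K) : Prop :=
  forall (phi : {rmorphism K -> algC}) (x : K), phi (theta x) = (phi x)^*.

Definition cyclotomic_with_conjugation (theta : K -> K) (a b : nat) : Prop :=
  [/\ (0 < a)%N, (0 < b)%N, is_cyclotomic_field (2 ^ a * 3 ^ b)
    & is_complex_conjugation theta].

(* Z u + Z v; only meaningful for u and v integral *)
Definition Zspan2 (u v : K) : set (zsub ring_of_integers) :=
  [set y | exists k l : int, val y = u *~ k + v *~ l].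

End NumberField.

(* Main.v *)
(* Let T(x) = Trace (x theta(x)).  If a rescaling of the trace form is an even
   positive definite root lattice, every nonzero integral x has T(x) >= n, with
   equality iff x theta(x) = 1: for Gram matrices B of a basis f and B' of x f,
   T(x) = tr (B' B^-1) and det B' = N(x)^2 det B >= det B, so the AM-GM and
   Hadamard inequalities apply.  Comparing with x = 1 gives n = 2m, and the
   roots are exactly the integers x with x theta(x) = 1.  They form a finite,
   hence cyclic, group <z> which generates O, so K = Q(z) and theta z = 1/z.
   A primitive p-th root of unity has trace -n/(p-1), and this lies in mZ only
   for p = 2, 3.  The order of z is even since -1 is a root, and divisible by 3
   since otherwise all the roots, hence all of O, would have traces in 2mZ.
   Conversely, the x_(i,j) have the Gram matrix of orthogonal copies of A_2, and
   O = Z[z2, z3]: the denominators of O over this ring involve only 2 and 3, and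
   the ring is p-saturated in O for p = 2, 3 because pi = 1 - z_p satisfies
   pi | p | pi^(p^c), and z^Q = z mod pi for arbitrarily large powers Q of p.
   A vector of norm 2 of an even positive definite lattice lies in a single
   summand of any orthogonal decomposition, which determines the components. *)
Require Import Defs.
From HB Require Import structures.
From mathcomp Require Import all_boot all_order all_algebra all_field.
From mathcomp Require Import cyclic boolp classical_sets functions.
From mathcomp Require Import zify ring lra.

Set Implicit Arguments.
Unset Strict Implicit.
Unset Printing Implicit Defensive.

Import Order.TTheory GRing.Theory Num.Theory.
Local Open Scope ring_scope.
Local Open Scope classical_set_scope.

(** * Traces of roots of unity *)

(** Conjugates and Galois groups are avoided: multiplication by a root of unity has a power of a
    cyclotomic polynomial as characteristic polynomial, so its trace depends only on its order.
    Freeness of O over Z is read off the lattice hypothesis in one direction and off the explicit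
    basis in the other; the bound N(x)^2 >= 1 behind AM-GM rests on it.

    The equality n = 2m is a pair of opposite estimates. Evenness makes 2 the least nonzero norm,
    and 1 has norm n / m, so n >= 2m; a root has T(x) = 2m, which AM-GM bounds below by n. Evenness
    also excludes norm 1, so the vectors of norm 2 alone generate O.

    In the converse direction the trace form only bounds the index of Z[z2, z3] in O: the Gram
    determinant of A_2 is 3, so 3 s O lies in the ring, with s = 2^(a-1) 3^(b-1) the number of
    copies of A_2. This is why saturation at 2 and at 3 is enough. *)

Section Trace.
Variable K : fieldExtType rat.
Local Notation n := (\dim {:K}).
Definition mulmat (x : K) : 'M[rat]_n :=
  passmx.mxof (vbasis {:K}) (vbasis {:K}) (amull x).

Lemma mulmat1 : mulmat 1 = 1%:M.
Proof. by rewrite /mulmat amull1 passmx.mxof1 // (basis_free (vbasisP _)). Qed.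

Lemma mulmatM x y : mulmat (x * y) = mulmat x *m mulmat y.
Proof.
by rewrite /mulmat [x * y]mulrC amullM (passmx.mxof_comp _ _ (vbasisP _)).
Qed.

Lemma mulmatB x y : mulmat (x - y) = mulmat x - mulmat y.
Proof. by apply/matrixP => i j; rewrite !mxE /= !lfunE /= mulrBl linearB. Qed.

Lemma mulmat_unit x : x != 0 -> mulmat x \in unitmx.
Proof.
move=> x0; have /mulmx1_unit[] // : mulmat x *m mulmat x^-1 = 1%:M.
by rewrite -mulmatM divff // mulmat1.
Qed.

Lemma Trace_linear : linear (@Trace K : K -> rat^o).
Proof.
move=> c x y; transitivity (c * \tr (mulmat x) + \tr (mulmat y)); last by [].
rewrite /Trace -mxtraceZ -mxtraceD; congr mxtrace.
by apply/matrixP => i j; rewrite !mxE /= !lfunE /= mulrDl -scalerAl linearP.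
Qed.

HB.instance Definition _ :=
  GRing.isSemilinear.Build rat K rat^o _ (@Trace K)
    (GRing.semilinear_linear Trace_linear).

Lemma Trace1 : Trace (1 : K) = n%:R.
Proof. by rewrite /Trace -/(mulmat 1) mulmat1 mxtrace1. Qed.

Lemma dimK_gt0 : (0 < n)%N.
Proof. by rewrite adim_gt0. Qed.

(** The two change-of-basis matrices are inverse to each other and cancel by cyclicity of the trace;
    this frees [Trace] from the basis fixed in its definition. *)
Lemma Trace_basis (e : n.-tuple K) (M : 'M[rat]_n) x :
    basis_of {:K} e -> (forall i : 'I_n, x * e`_i = \sum_j M i j *: e`_j) ->
  Trace x = \tr M.
Proof.
move=> eb eM; pose b := vbasis {:K}; have bb : basis_of {:K} b := vbasisP _.
have id1 (c d : n.-tuple K) : basis_of {:K} c -> basis_of {:K} d ->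
    passmx.mxof c d \1 *m passmx.mxof d c \1 = 1%:M.
  move=> cb db; rewrite -(passmx.mxof_comp _ _ db) ?comp_lfun1l.
  by rewrite passmx.mxof1 // (basis_free cb).
have -> : M = passmx.mxof e e (amull x).
  apply/matrixP=> i j; rewrite !mxE /= passmx.vecof_delta lfunE /= eM.
  by rewrite coord_sum_free // (basis_free eb).
rewrite /Trace -/b.
rewrite -{1}[amull x]comp_lfun1l -{1}[amull x]comp_lfun1r.
rewrite (passmx.mxof_comp _ _ eb) (passmx.mxof_comp _ _ eb).
by rewrite mxtrace_mulC mulmxA id1 // mul1mx.
Qed.

(** The image of a basis under [f] is again a basis, and multiplication by [f x] has there the
    matrix that [x] has in the original one. *)
Lemma Trace_rmorph (f : {rmorphism K -> K}) x : Trace (f x) = Trace x.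
Proof.
have fZ : scalable f by exact: fmorph_numZ.
pose b := vbasis {:K}; have bb : basis_of {:K} b := vbasisP _.
have fb : basis_of {:K} [tuple of map f b].
  rewrite basisEfree; apply/and3P; split; last by rewrite size_tuple.
    apply/freeP => k; under eq_bigr => i _ do
      rewrite (nth_map 0) ?size_tuple // -fZ.
    rewrite -rmorph_sum => /eqP; rewrite fmorph_eq0 => /eqP.
    by move/freeP: (basis_free bb); apply.
  exact: subvf.
rewrite (@Trace_basis [tuple of map f b] (mulmat x)) // => i.
rewrite (nth_map 0) ?size_tuple // -rmorphM.
rewrite [x * b`_i](coord_basis bb) ?memvf // rmorph_sum /=.
apply: eq_bigr => j _; rewrite (nth_map 0) ?size_tuple // !mxE /=.
by rewrite passmx.vecof_delta lfunE /= fZ.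
Qed.

(** On an eigenvector the powers of [u] act as the powers of [l]. If [u ^+ e] differs from 1, then
    [u ^+ e - 1] is invertible in the field and cannot kill the eigenvector, so [l ^+ e] differs
    from 1 as well: the orders agree. *)
Lemma root_charpoly_prim d (u : K) (l : algC) :
    d.-primitive_root u -> root (map_poly ratr (char_poly (mulmat u))) l ->
  d.-primitive_root l.
Proof.
move=> ud; pose A : 'M[algC]_n := map_mx ratr (mulmat u).
rewrite map_char_poly -/A -eigenvalue_root_char => /eigenvalueP[v vA v0].
have vAe e : v *m map_mx ratr (mulmat (u ^+ e)) = l ^+ e *: v.
  elim: e => [|e IH]; first by rewrite mulmat1 map_mx1 mulmx1 expr0 scale1r.
  by rewrite exprSr mulmatM map_mxM mulmxA IH -scalemxAl vA scalerA exprSr.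
have le1 e : (l ^+ e == 1) = (u ^+ e == 1).
  apply/idP/idP => [/eqP le|/eqP ue]; last first.
    have := vAe e; rewrite ue mulmat1 map_mx1 mulmx1 => /eqP.
    rewrite -subr_eq0 -{1}[v]scale1r -scalerBl scaler_eq0 (negPf v0) orbF.
    by rewrite subr_eq0 eq_sym.
  apply: contraNT v0; rewrite -subr_eq0 => /mulmat_unit ux.
  have : v *m map_mx ratr (mulmat (u ^+ e - 1)) = 0.
    rewrite mulmatB map_mxB mulmxBr vAe mulmat1 map_mx1 mulmx1.
    by rewrite le scale1r subrr.
  rewrite -(map_unitmx (@ratr algC)) in ux.
  by move=> v1; rewrite -(mulmxK ux v) v1 mul0mx.
have d0 := prim_order_gt0 ud.
have [e le ed] : {e | e.-primitive_root l & (e %| d)%N}.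
  by apply: prim_order_exists => //; apply/eqP; rewrite le1 (prim_expr_order ud).
suff -> : d = e by [].
apply/eqP; rewrite eqn_dvd ed andbT (prim_order_dvd ud) -le1.
by rewrite (prim_expr_order le).
Qed.

End Trace.

(** All the roots have the same minimal polynomial over the rationals, the cyclotomic one. It
    divides [q], and the quotient has no new roots. *)
Lemma prim_roots_poly d (q : {poly rat}) : q \is monic ->
    (forall l : algC, root (map_poly ratr q) l -> d.-primitive_root l) ->
  exists k, q = map_poly intr 'Phi_d ^+ k.
Proof.
pose p : {poly rat} := map_poly intr 'Phi_d; rewrite -/p.
have [k] := ubnP (size q); elim: k q => // k IH q; rewrite ltnS => qk qm ql.
have [q1|q1] := leqP (size q) 1.
  exists 0; move: qm; rewrite (size1_polyC q1) monicE lead_coefC => /eqP ->.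
  by rewrite expr0.
have /closed_rootP[l lq] : size (map_poly ratr q : {poly algC}) != 1%N.
  by rewrite size_map_poly neq_ltn q1 orbT.
have ld := ql l lq.
have [f [fl fm] fdv] := minCpolyP l.
have fp : f = p.
  apply: (map_poly_inj (@ratr algC)).
  rewrite -fl (minCpoly_cyclotomic ld) -(Cintr_Cyclotomic ld) -map_poly_comp.
  by apply: eq_map_poly => b; rewrite /= rmorph_int.
move: lq; rewrite fdv fp => /dvdpP[r qrp]; rewrite fp in fm.
have rm : r \is monic by rewrite qrp monicMr in qm.
have p1 : (1 < size p)%N.
  have : root (map_poly ratr p) l by rewrite fdv fp dvdpp.
  by move/(root_size_gt1 _); rewrite size_map_poly map_poly_eq0; apply;
     rewrite monic_neq0.
have [|||k' rk] := IH r.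
- apply: leq_trans qk; rewrite qrp size_Mmonic ?monic_neq0 //.
  have : (0 < size r)%N by rewrite size_poly_gt0 monic_neq0.
  case: (size p) p1 => [|[|s]] // _ r0.
  by rewrite !addnS /= ltnS leq_addr.
- exact: rm.
- by move=> z rz; apply: ql; rewrite qrp rmorphM rootM rz.
by exists k'.+1; rewrite exprSr qrp rk.
Qed.

(** Both characteristic polynomials are powers of one cyclotomic polynomial and have degree n, so
    they coincide, and the trace is minus the subleading coefficient. *)
Lemma Trace_prim_root (K : fieldExtType rat) d (u v : K) :
  d.-primitive_root u -> d.-primitive_root v -> Trace u = Trace v.
Proof.
move=> ud vd; have n0 := dimK_gt0 K.
apply: oppr_inj; rewrite /Trace -!(char_poly_trace _ n0).
have [k uk] := prim_roots_poly (char_poly_monic _)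
  (fun l => root_charpoly_prim (l := l) ud).
have [k' vk] := prim_roots_poly (char_poly_monic _)
  (fun l => root_charpoly_prim (l := l) vd).
rewrite uk vk; set p := map_poly _ _.
have s : size (p ^+ k) = size (p ^+ k') by rewrite -uk -vk !size_char_poly.
have p0 : p != 0.
  rewrite -size_poly_eq0 size_map_inj_poly ?size_Cyclotomic //; exact: intr_inj.
have sp : (0 < (size p).-1)%N.
  rewrite lt0n; apply/eqP => sp0.
  have := size_exp p k; rewrite sp0 mul0n -uk size_char_poly /= => ne.
  by rewrite ne in n0.
suff -> : k = k' by [].
apply/eqP; rewrite -(eqn_pmul2l sp) -!size_exp s //.
Qed.

Section RootsOfUnity.
Variable K : fieldExtType rat.
Local Notation n := (\dim {:K}).

Lemma Trace_sum (I : Type) (r : seq I) (P : pred I) (F : I -> K) :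
  Trace (\sum_(i <- r | P i) F i) = \sum_(i <- r | P i) Trace (F i).
Proof. exact: (raddf_sum (@Trace K : K -> rat^o)). Qed.

Lemma Trace0 : Trace (0 : K) = 0.
Proof. exact: (raddf0 (@Trace K : K -> rat^o)). Qed.

Lemma TraceN (x : K) : Trace (- x) = - Trace x.
Proof. exact: (raddfN (@Trace K : K -> rat^o)). Qed.

Lemma TraceD (x y : K) : Trace (x + y) = Trace x + Trace y.
Proof. exact: (raddfD (@Trace K : K -> rat^o)). Qed.

Lemma TraceZ c (x : K) : Trace (c *: x) = c * Trace x.
Proof.
rewrite /Trace -mxtraceZ; congr mxtrace; apply/matrixP => i j.
by rewrite !mxE /= !lfunE /= -scalerAl linearZ.
Qed.

Lemma TraceMz (x : K) k : Trace (x *~ k) = k%:~R * Trace x.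
Proof. by rewrite -scaler_int TraceZ. Qed.

Lemma natr_ext_eq0 k : (k%:R == 0 :> K) = (k == 0)%N.
Proof. by rewrite -(rmorph_nat (in_alg K)) fmorph_eq0 pnatr_eq0. Qed.

Lemma prim_root_half (R : idomainType) d (u : R) :
  d.*2.-primitive_root u -> u ^+ d = -1.
Proof.
move=> ud; have d0 := prim_order_gt0 ud; rewrite double_gt0 in d0.
have /eqP : (u ^+ d - 1) * (u ^+ d + 1) = 0.
  by rewrite -subr_sqr -exprM muln2 (prim_expr_order ud) expr1n subrr.
rewrite mulf_eq0 subr_eq0 -(prim_order_dvd ud) addr_eq0 => /orP[|/eqP //].
by move=> /dvdn_leq; rewrite d0 -addnn => /(_ isT); rewrite -{3}[d]addn0 leq_add2l leqNgt d0.
Qed.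

Lemma prim_root_sum0 (R : idomainType) p (u : R) : (1 < p)%N ->
  p.-primitive_root u -> \sum_(i < p) u ^+ i = 0.
Proof.
move=> p1 up; have /eqP : (u - 1) * (\sum_(i < p) u ^+ i) = 0.
  by rewrite -subrX1 (prim_expr_order up) subrr.
rewrite mulf_eq0 subr_eq0 -[u]expr1 -(prim_order_dvd up) dvdn1.
by rewrite (gtn_eqF p1) /= expr1 => /eqP.
Qed.

(** The p-th roots of unity sum to 0; 1 contributes n, and the others are all primitive, hence share
    one trace. *)
Lemma Trace_prime_root p (u : K) : prime p -> p.-primitive_root u ->
  Trace u * p.-1%:R = - n%:R.
Proof.
move=> pp up; have p1 := prime_gt1 pp.
have := congr1 (@Trace K) (prim_root_sum0 p1 up).
rewrite Trace0 Trace_sum -(prednK (prime_gt0 pp)) big_ord_recl expr0 Trace1.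
rewrite (eq_bigr (fun=> Trace u)).
  rewrite sumr_const card_ord => /eqP.
  by rewrite addrC addr_eq0 mulr_natr => /eqP.
move=> i _; apply: (@Trace_prim_root _ p) => //.
rewrite (prim_root_exp_coprime _ up) coprime_sym prime_coprime // gtnNdvd //.
by rewrite lift0; have := ltn_ord i; rewrite -ltnS prednK ?prime_gt0.
Qed.

(** For d = 4k, [- u] is the power of [u] of exponent 2k + 1, prime to 4k. It is a primitive root of
    the same order, so its trace equals both that of [u] and the opposite. *)
Lemma Trace_root4 d (u : K) : (4 %| d)%N -> d.-primitive_root u -> Trace u = 0.
Proof.
move=> /dvdnP[k ->] ud.
have k0 : (0 < k)%N by have := prim_order_gt0 ud; rewrite muln_gt0 andbT.
have uN : u ^+ (k.*2).+1 = - u.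
  rewrite exprS (prim_root_half (d := k.*2)) ?mulrN1 //.
  by rewrite -!muln2 -mulnA.
have : Trace (- u) = Trace u.
  apply: (@Trace_prim_root _ (k * 4)) => //.
  rewrite -uN (prim_root_exp_coprime _ ud) (_ : (k * 4 = k.*2 * 2)%N).
    rewrite coprimeMr coprimen2 /= odd_double andbT.
    by rewrite coprimeSn.
  by rewrite -muln2 -mulnA.
rewrite TraceN => /eqP; rewrite eqNr => /eqP //.
Qed.

(** For d = 9k and the cube root of unity [w], the products [u * w ^+ i] are powers of [u] with
    exponents 1 + 3ki prime to 9k. They have the same trace, and they sum to 0. *)
Lemma Trace_root9 d (u : K) : (9 %| d)%N -> d.-primitive_root u -> Trace u = 0.
Proof.
move=> /dvdnP[k ->] ud.
have k0 : (0 < k)%N by have := prim_order_gt0 ud; rewrite muln_gt0 andbT.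
pose w := u ^+ (k * 3).
have w3 : 3.-primitive_root w.
  have := dvdn_prim_root ud (_ : (3 %| k * 9)%N).
  rewrite (_ : (k * 9 = k * 3 * 3)%N) ?mulnK ?dvdn_mull //; last by rewrite -mulnA.
  exact.
have c i : (i < 3)%N -> Trace (u * w ^+ i) = Trace u.
  move=> i3; apply: (@Trace_prim_root _ (k * 9)) => //.
  rewrite /w -exprM -exprS (prim_root_exp_coprime _ ud).
  rewrite (_ : (k * 9 = k * 3 * 3)%N); last by rewrite -mulnA.
  rewrite coprimeMr; apply/andP.
  have c3 a : coprime (k * 3 * i).+1 a || ~~ (a %| k * 3)%N.
    case: (boolP (a %| k * 3)%N) => ak; rewrite ?orbT // orbF.
    by rewrite coprime_sym; apply: coprime_dvdl (dvdn_mulr i ak) _;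
       rewrite coprime_sym coprimeSn.
  split; last by have := c3 3; rewrite dvdn_mull // orbF.
  by have := c3 (k * 3)%N; rewrite dvdnn orbF.
have := prim_root_sum0 (isT : 1 < 3)%N w3.
rewrite !big_ord_recl big_ord0 addr0 => /(congr1 (fun x => Trace (u * x))).
rewrite !mulrDr !TraceD !c // mulr0.
by rewrite Trace0 => ?; lra.
Qed.

Lemma rmorph_eq_generator (R : unitRingType) (f g : {rmorphism K -> R}) z :
  <<1; z>>%VS = {:K}%VS -> f z = g z -> f =1 g.
Proof.
move=> Kz fgz x; have : x \in <<1; z>>%VS by rewrite Kz memvf.
move=> /Fadjoin1_polyP[p ->]; rewrite !horner_coef !rmorph_sum /=.
apply: eq_bigr => i _; rewrite !rmorphM !rmorphXn fgz; congr (_ * _).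
by rewrite coef_map /= !rmorphZ_num !rmorph1.
Qed.

End RootsOfUnity.

(** * Algebraic integers *)

Section Integers.
Variable K : fieldExtType rat.
Local Notation O := (@ring_of_integers K).

Lemma mem_OP (x : K) : reflect (integralOver (intr : int -> K) x) (x \in O).
Proof. exact: asboolP. Qed.

Lemma O_mul x y : x \in O -> y \in O -> x * y \in O.
Proof. by move=> /mem_OP xO /mem_OP yO; apply/mem_OP; exact: integral_mul. Qed.

Lemma O1 : 1 \in O.
Proof. by apply/mem_OP; exact: integral1. Qed.

Lemma O_exp x k : x \in O -> x ^+ k \in O.
Proof.
by move=> xO; elim: k => [|k IH]; rewrite ?expr0 ?O1 // exprS O_mul.
Qed.

Lemma O_unity_root x k : (0 < k)%N -> x ^+ k = 1 -> x \in O.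
Proof.
move=> k0 xk; apply/mem_OP; exists ('X^k - 1); first exact: monicXnsubC.
by rewrite rmorphB rmorph1 /= map_polyXn rootE
  !(hornerD, hornerN, hornerXn, hornerC) xk subrr.
Qed.

Lemma O_rmorph (f : {rmorphism K -> K}) x : x \in O -> f x \in O.
Proof.
move=> /mem_OP xO; apply/mem_OP.
have [p pm pr] := integral_rmorph f xO; exists p => //.
by congr (root _ _): pr; apply: eq_map_poly => k /=; rewrite rmorph_int.
Qed.

(** Let [D] be a common denominator of the minimal polynomial of [y], of degree [d]. Multiplying its
    coefficient of index i by [D ^+ (d - i)] gives a monic integral polynomial that vanishes at
    [y *+ D]. *)
Lemma O_fraction (y : K) : exists2 N : nat, (0 < N)%N & y *+ N \in O.
Proof.
have /polyOver1P[p pE] := minPolyOver 1 y.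
have yp : (map_poly (in_alg K) p).[y] = 0 by rewrite -pE minPolyxx.
have pm : p \is monic.
  by have := monic_minPoly 1 y; rewrite pE map_monic.
pose d := (size p).-1.
pose D := (\prod_(i < d) `|denq p`_i|)%N.
have D0 : (0 < D)%N by apply: prodn_gt0 => i; rewrite absz_gt0 denq_neq0.
have ex (i : nat) : exists k : int, (i <= d)%N -> D%:R ^+ (d - i) * p`_i = k%:~R.
  have [id|] := ltnP i d; last first.
    rewrite leq_eqVlt => /orP[/eqP <-|di]; last by exists 0; rewrite leqNgt di.
    exists 1 => _; rewrite subnn expr0 mul1r.
    by have := monicP pm; rewrite lead_coefE.
  have [q Dq] : exists q, D = (q * `|denq p`_i|)%N.
    by apply/dvdnP; rewrite /D (bigD1 (Ordinal id)) //= dvdn_mulr.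
  exists (D%:Z ^+ (d - i).-1 * q%:Z * numq p`_i) => _.
  have e : (d - i = (d - i).-1.+1)%N by rewrite prednK // subn_gt0.
  rewrite {1}e.
  rewrite exprSr !intrM -!mulrA; congr (_ * _).
    by apply/esym; elim: (d - i).-1%N => // a IH; rewrite !exprS intrM IH.
  have dn : (`|denq p`_i|%N)%:R = (denq p`_i)%:~R :> rat.
    by rewrite -[in RHS]absz_denq.
  rewrite {1}Dq natrM -mulrA; congr (_ * _); rewrite dn -{2}[p`_i]divq_num_den.
  by rewrite mulrCA divff ?mulr1 // intr_eq0 denq_neq0.
pose k i := projT1 (cid (ex i)).
have kE i : (i <= d)%N -> D%:R ^+ (d - i) * p`_i = (k i)%:~R.
  by rewrite /k; case: cid.
have sp : size p = d.+1.
  by rewrite /d prednK // size_poly_gt0 monic_neq0.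
have kd : k d = 1.
  apply: (@intr_inj rat); rewrite -kE // subnn expr0 mul1r.
  by have := monicP pm; rewrite lead_coefE.
exists D => //; apply/mem_OP; exists (\poly_(i < d.+1) k i).
  by rewrite monicE lead_coef_poly ?kd ?oner_eq0.
rewrite rootE (@horner_coef_wide _ d.+1); last first.
  exact: leq_trans (size_poly _ _) (size_poly _ _).
transitivity ((in_alg K (D%:R ^+ d)) * (map_poly (in_alg K) p).[y] == 0); last first.
  by rewrite yp mulr0 eqxx.
congr (_ == 0); rewrite horner_coef size_map_poly sp mulr_sumr.
apply: eq_bigr => i _; rewrite !coef_map /= coef_poly ltn_ord.
have id : (i <= d)%N by rewrite -ltnS.
rewrite -[y *+ D]mulr_natl exprMn !mulrA; congr (_ * _).
transitivity (in_alg K (D%:R ^+ (d - i) * p`_i * D%:R ^+ i)).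
  by rewrite kE // rmorphM rmorph_int rmorphXn rmorph_nat.
by rewrite mulrAC -exprD subnK // rmorphM.
Qed.

End Integers.

(** * Positive definite matrices *)

Section RealMatrices.
Variable F : realFieldType.

Definition posdef n (S : 'M[F]_n) :=
  S^T = S /\ forall v : 'rV_n, v != 0 -> 0 < (v *m S *m v^T) 0 0.

Lemma posdef_diag n (S : 'M[F]_n) i : posdef S -> 0 < S i i.
Proof.
case=> _ /(_ (delta_mx 0 i)); rewrite -rowE trmx_delta -colE !mxE; apply.
by apply/eqP => /matrixP/(_ 0 i)/eqP; rewrite !mxE !eqxx oner_eq0.
Qed.

Lemma posdef_congr n (S P : 'M[F]_n) :
  P \in unitmx -> posdef S -> posdef (P *m S *m P^T).
Proof.
move=> uP [Ss Sp]; split; first by rewrite !trmx_mul trmxK Ss mulmxA.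
move=> v v0; rewrite !mulmxA -mulmxA -trmx_mul; apply: Sp.
by apply: contra_neq v0 => vP; rewrite -(mulmxK uP v) vP mul0mx.
Qed.

(* Gaussian elimination; the pivots decrease the remaining diagonal entries,
   which yields Hadamard's inequality. *)
Lemma posdef_LDL n (S : 'M[F]_n.+1) : posdef S ->
  exists (U : 'M[F]_n.+1) (d : 'rV[F]_n.+1),
    [/\ \det U = 1, U *m S *m U^T = diag_mx d, row 0 U = delta_mx 0 0,
        forall i, 0 < d 0 i & forall i, d 0 i <= S i i].
Proof.
elim: n S => [|n IH] S Spd.
  exists 1%:M, (\row_i S i i); split.
  - by rewrite det1.
  - rewrite mul1mx trmx1 mulmx1; apply/matrixP => i j.
    by rewrite !mxE !ord1.
  - by apply/rowP => i; rewrite !mxE ord1 !eqxx.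
  - by move=> i; rewrite mxE posdef_diag.
  - by move=> i; rewrite mxE.
have s0 : 0 < S 0 0 by exact: posdef_diag.
pose S1 : 'M[F]_(1 + n.+1) := S.
pose r : 'rV[F]_n.+1 := ursubmx S1.
pose s := S 0 0.
(* The Schur complement of the pivot; it is positive definite as a diagonal block of a matrix
   congruent to [S]. *)
pose S' := drsubmx S1 - s^-1 *: (r^T *m r).
pose U1 : 'M[F]_(1 + n.+1) := block_mx 1%:M 0 (- s^-1 *: r^T) 1%:M.
have dS : dlsubmx S1 = r^T.
  by rewrite /r trmx_ursub /S1; case: Spd => -> _.
have uS : ulsubmx S1 = s%:M.
  by apply/matrixP => i j; rewrite !mxE !ord1 /=; congr (S _ _); apply/val_inj.
have U1S : U1 *m S1 *m U1^T = block_mx s%:M 0 0 S'.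
  rewrite -[S1]submxK uS dS -/r /U1 tr_block_mx !mulmx_block.
  rewrite !(mul1mx, mul0mx, mulmx0, mulmx1, add0r, addr0, trmx0, trmx1).
  rewrite !linearZ /= trmxK -!scalemxAl !mul_mx_scalar !mul_scalar_mx !scalerA.
  rewrite mulNr mulVf ?lt0r_neq0 // !scaleN1r !addNr mul0mx scaler0 add0r.
  by rewrite /S' scaleNr addrC.
have S'pd : posdef S'.
  have [] : posdef (U1 *m S1 *m U1^T).
    apply: posdef_congr => //.
    by rewrite unitmxE det_lblock !det1 mulr1 unitr1.
  rewrite U1S => Ts Tp; split.
    by move: Ts; rewrite tr_block_mx => /eq_block_mx[].
  move=> v v0; have := Tp (row_mx 0 v : 'rV_(1 + n.+1)).
  rewrite mul_row_block tr_row_mx mul_row_col.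
  rewrite !(mul0mx, mulmx0, add0r, trmx0); apply.
  by apply: contra_neq v0; rewrite -row_mx0 => /eq_row_mx[].
have [U' [d' [dU' US' r0 d0 dS']]] := IH S' S'pd.
pose W : 'M_(1 + n.+1) := block_mx 1%:M 0 0 U'.
have dU1 : \det U1 = 1 by rewrite det_lblock !det1 mulr1.
have dW : \det W = 1 by rewrite det_lblock dU' det1 mulr1.
have WS' : W *m block_mx s%:M 0 0 S' *m W^T = diag_mx (row_mx s%:M d').
  rewrite /W tr_block_mx !mulmx_block.
  rewrite !(mul1mx, mul0mx, mulmx0, mulmx1, add0r, addr0, trmx0, trmx1).
  by rewrite US' diag_mx_row; congr block_mx; apply/matrixP => i j;
     rewrite !mxE !ord1.
have WU1 : W *m U1 = block_mx 1%:M 0 (U' *m (- s^-1 *: r^T)) U'.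
  rewrite /W /U1 mulmx_block.
  by rewrite !(mul1mx, mul0mx, mulmx0, mulmx1, add0r, addr0).
exists (W *m U1).
pose D : 'rV[F]_n.+2 := row_mx s%:M d' : 'rV_(1 + n.+1).
have Dl (k : 'I_1) : D 0 (lshift n.+1 k) = s.
  by apply: etrans (row_mxEl _ _ 0 k) _; rewrite mxE !ord1 eqxx.
have Dr (k : 'I_n.+1) : D 0 (rshift 1 k) = d' 0 k by exact: (row_mxEr _ _ 0 k).
exists D.
have rS (i : 'I_n.+1) : S' i i <= S (rshift 1 i) (rshift 1 i).
  rewrite !mxE big_ord1 !mxE lerBlDr lerDl mulr_ge0 ?invr_ge0 ?(ltW s0) //.
  by rewrite -expr2 sqr_ge0.
split.
- by rewrite det_mulmx dU1 dW mulr1.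
- rewrite -[S]/S1 (@trmx_mul _ _ (1 + n.+1)) !mulmxA -(mulmxA W U1 S1).
  rewrite -(mulmxA W _ U1^T) U1S; exact: WS'.
- rewrite [W *m U1]WU1.
  apply/rowP => j; rewrite mxE; case: (@split_ordP 1 n.+1 j) => k ->.
    rewrite (_ : 0 = lshift n.+1 0 :> 'I_(1 + n.+1)); last exact: val_inj.
    transitivity ((1%:M : 'M[F]_1) 0 k); first exact: (block_mxEul _ _ _ _ 0 k).
    by rewrite !mxE !ord1 !eqxx.
  rewrite (_ : 0 = lshift n.+1 0 :> 'I_(1 + n.+1)); last exact: val_inj.
  transitivity ((0 : 'M[F]_(1, n.+1)) 0 k); last by rewrite !mxE.
  exact: (block_mxEur _ _ _ _ 0 k).
- move=> i; case: (@split_ordP 1 n.+1 i) => k ->.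
    by rewrite Dl.
  by rewrite Dr.
- move=> i; case: (@split_ordP 1 n.+1 i) => k ->.
    have k0 : (lshift n.+1 k : 'I_n.+2) = 0 by apply: val_inj; rewrite /= ord1.
    by rewrite Dl k0.
  by rewrite Dr (le_trans (dS' k)).
Qed.

Lemma posdef_det_gt0 n (S : 'M[F]_n.+1) : posdef S -> 0 < \det S.
Proof.
move=> /posdef_LDL[U [d [dU US _ d0 _]]].
have := congr1 determinant US; rewrite !det_mulmx det_tr dU mul1r mulr1 => ->.
by rewrite det_diag prodr_gt0.
Qed.

Lemma hadamard n (S : 'M[F]_n.+1) : posdef S -> \det S <= \prod_i S i i.
Proof.
move=> /posdef_LDL[U [d [dU US _ d0 dS]]].
have := congr1 determinant US; rewrite !det_mulmx det_tr dU mul1r mulr1 => ->.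
by rewrite det_diag ler_prod // => i _; rewrite ltW ?d0 //= dS.
Qed.

(* In a basis diagonalizing B, the diagonal of B' has product at least det B' by
   Hadamard, so AM-GM bounds the trace; in the equality case all ratios of
   diagonal entries are 1.  Only the first entry is compared, because the first
   vector is the one that the change of basis preserves. *)
Lemma trace_ge_of_det n (B B' : 'M[F]_n.+1) :
    posdef B -> posdef B' -> \det B <= \det B' ->
  n.+1%:R <= \tr (B' *m invmx B) /\
  (\tr (B' *m invmx B) = n.+1%:R -> B' 0 0 = B 0 0).
Proof.
move=> pB pB' dBB.
have uB : B \in unitmx by rewrite unitmxE unitfE gt_eqF ?posdef_det_gt0.
have [U [d [dU UB rU d0 _]]] := posdef_LDL pB.
have uU : U \in unitmx by rewrite unitmxE dU unitr1.
have uU' : U^T \in unitmx by rewrite unitmx_tr.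
pose C := U *m B' *m U^T; have pC : posdef C by exact: posdef_congr.
pose q i := C i i / d 0 i.
have q0 i : 0 < q i by rewrite divr_gt0 ?posdef_diag.
(* The inverse of [B] is [U^T D^-1 U], with D the diagonal matrix of [d]; cyclicity turns the trace
   into that of [C D^-1], whose diagonal is [q]. *)
have trq : \tr (B' *m invmx B) = \sum_i q i.
  have uD : diag_mx d \in unitmx.
    by rewrite -UB !unitmx_mul uU uB.
  have iD : diag_mx d *m diag_mx (\row_i (d 0 i)^-1) = 1%:M.
    rewrite mulmx_diag; apply/matrixP => i j; rewrite !mxE.
    by rewrite mulfV // gt_eqF.
  have -> : invmx B = U^T *m diag_mx (\row_i (d 0 i)^-1) *m U.
    have e : B = invmx U *m diag_mx d *m invmx U^T.
      by rewrite -UB !mulmxA mulVmx // mul1mx mulmxK.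
    apply: (can_inj (mulKmx uB)); rewrite mulmxV //.
    rewrite e !mulmxA mulmxKV // -(mulmxA _ (diag_mx d)) iD mulmx1.
    by rewrite mulVmx.
  rewrite !mulmxA mxtrace_mulC !mulmxA -/C /mxtrace; apply: eq_bigr => i _.
  by rewrite mul_mx_diag mxE [X in _ * X]mxE.
have detq : 1 <= \prod_i q i.
  rewrite prodf_div ler_pdivlMr ?prodr_gt0 // mul1r.
  have -> : \prod_i d 0 i = \det B.
    rewrite -det_diag -UB !det_mulmx det_tr dU mul1r mulr1 //.
  apply: le_trans (hadamard pC); rewrite /C !det_mulmx det_tr dU.
  by rewrite mul1r mulr1.
have [AG eAG] := @leif_AGM F _ predT q (fun i _ => ltW (q0 i)).
rewrite cardT size_enum_ord in AG eAG.
set mu := (\sum_(i in predT) q i) / n.+1%:R in AG eAG.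
have muE : mu = \tr (B' *m invmx B) / n.+1%:R.
  by rewrite trq; congr (_ / _); apply: eq_bigl.
have pE : \prod_(i in predT) q i = \prod_i q i by apply: eq_bigl.
have n0 : 0 < n.+1%:R :> F by rewrite ltr0n.
have mu0 : 0 <= mu by rewrite muE divr_ge0 ?(ltW n0) // trq sumr_ge0 // => i _; rewrite ltW.
have mu1 : 1 <= mu.
  rewrite -(@ler_pXn2r _ n.+1) ?nnegrE // expr1n; apply: le_trans AG.
  by rewrite pE.
split; first by rewrite muE ler_pdivlMr // mul1r in mu1.
move=> trn; have mu_1 : mu = 1 by rewrite muE trn divff ?gt_eqF.
have : \prod_(i in predT) q i == mu ^+ n.+1.
  by rewrite eq_le AG mu_1 expr1n pE detq.
rewrite eAG => /forall_inP qq.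
have q00 : q 0 = 1.
  have : \sum_i q i = n.+1%:R by rewrite -trq.
  rewrite (eq_bigr (fun=> q 0)); last first.
    by move=> i _; apply/eqP; move/forall_inP: (qq i isT); apply.
  rewrite sumr_const card_ord => qn.
  by apply: (mulIf (lt0r_neq0 n0)); rewrite mulr_natr qn mul1r.
have e00 (X : 'M[F]_n.+1) : (U *m X *m U^T) 0 0 = X 0 0.
  have -> : (U *m X *m U^T) 0 0 = (row 0 U *m X *m (row 0 U)^T) 0 0.
    rewrite -row_mul mxE [RHS]mxE; apply: eq_bigr => i _.
    congr (_ * _); first by rewrite [RHS]mxE.
    by rewrite [LHS]mxE [RHS]mxE [RHS]mxE.
  by rewrite rU -rowE trmx_delta -colE !mxE.
have : C 0 0 = d 0 0.
  by rewrite -[RHS]mul1r -q00 divfK ?lt0r_neq0.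
rewrite e00 => ->; have := congr1 (fun X : 'M_n.+1 => X 0 0) UB.
by rewrite e00 => ->; rewrite !mxE eqxx.
Qed.

End RealMatrices.

(** * Root lattices *)

Section Subgroups.
Variables (V : zmodType) (S : set V).
Hypothesis sgS : is_subgroup S.

Lemma subgroup0 : S 0. Proof. by case: sgS. Qed.

Lemma subgroupN x : S x -> S (- x).
Proof. by move=> Sx; rewrite -[- x]add0r; apply: sgS.2 => //; exact: sgS.1. Qed.

Lemma subgroupD x y : S x -> S y -> S (x + y).
Proof. by move=> Sx Sy; rewrite -[y]opprK; apply: sgS.2 => //; exact: subgroupN. Qed.

Lemma subgroupMz x k : S x -> S (x *~ k).
Proof.
move=> Sx; have Sn n : S (x *+ n).
  elim: n => [|n IH]; first by rewrite mulr0n; exact: subgroup0.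
  by rewrite mulrS; exact: subgroupD.
by case: k => n; rewrite ?NegzE ?mulrNz -pmulrn //; exact: subgroupN.
Qed.

Lemma subgroup_sum (I : Type) (r : seq I) (P : pred I) (F : I -> V) :
  (forall i, P i -> S (F i)) -> S (\sum_(i <- r | P i) F i).
Proof. by move=> SF; apply: big_ind => //; [exact: subgroup0|exact: subgroupD]. Qed.

(** Modulo the differences [e i - e i0], a combination with even coefficient sum is a multiple of
    [2 e i0], which is [(e i0 + e i1) + (e i0 - e i1)]. This handles all integral vectors of types D
    and E. *)
Lemma subgroup_even_comb (I : finType) (P : pred I) (e : I -> V) (c : I -> int)
    (k : int) (i0 i1 : I) :
    P i0 -> P i1 -> i0 != i1 ->
    (forall i j, P i -> P j -> i != j -> S (e i + e j) /\ S (e i - e j)) ->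
    \sum_(i | P i) c i = 2 * k ->
  S (\sum_(i | P i) e i *~ c i).
Proof.
move=> P0 P1 n01 Se ck.
have -> : \sum_(i | P i) e i *~ c i =
    \sum_(i | P i) (e i - e i0) *~ c i + (e i0 *+ 2) *~ k.
  have -> : (e i0 *+ 2) *~ k = e i0 *~ \sum_(i | P i) c i.
    by rewrite ck mulrzA pmulrn.
  by rewrite mulrz_sumr -big_split /=; apply: eq_bigr => i _;
     rewrite -mulrzDl subrK.
apply: subgroupD.
  apply: subgroup_sum => i Pi; apply: subgroupMz.
  have [->|ni] := eqVneq i i0; first by rewrite subrr; exact: subgroup0.
  by have [] := Se i i0 Pi P0 ni.
apply: subgroupMz; rewrite mulr2n.
rewrite (_ : _ + _ = (e i0 + e i1) + (e i0 - e i1)); last first.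
  by rewrite addrACA subrr addr0.
by apply: subgroupD; have [] := Se _ _ P0 P1 n01.
Qed.

End Subgroups.

Section Dot.
Variables (R : comNzRingType) (N : nat).
Implicit Types x y z : 'rV[R]_N.

Lemma dotC x y : dot x y = dot y x.
Proof. by apply: eq_bigr => j _; rewrite mulrC. Qed.

Lemma dotDl x y z : dot (x + y) z = dot x z + dot y z.
Proof. by rewrite -big_split; apply: eq_bigr => j _; rewrite mxE mulrDl. Qed.

Lemma dot0l x : dot 0 x = 0.
Proof. by rewrite /dot big1 // => j _; rewrite mxE mul0r. Qed.

Lemma dot_delta_pair (i j : 'I_N) (c : R) : i != j -> c * c = 1 ->
  dot (delta_mx 0 i + c *: delta_mx 0 j) (delta_mx 0 i + c *: delta_mx 0 j) = 2.
Proof.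
move=> ij cc; rewrite /dot (bigD1 i) //= (bigD1 j) 1?eq_sym //= big1.
  rewrite !mxE !eqxx (negPf ij) eq_sym (negPf ij) /= !mulr0 !mulr1 !addr0 add0r.
  by rewrite mulr1 cc.
move=> k /andP[ki kj]; rewrite !mxE (negPf ki) (negPf kj) /=.
by rewrite mulr0 addr0 mulr0.
Qed.

End Dot.

Lemma dot_ge0 (R : realDomainType) N (x : 'rV[R]_N) : 0 <= dot x x.
Proof. by apply: sumr_ge0 => j _; rewrite -expr2 sqr_ge0. Qed.

Lemma dot_gt0 (R : realDomainType) N (x : 'rV[R]_N) : x != 0 -> 0 < dot x x.
Proof.
move=> x0; rewrite lt0r dot_ge0 andbT; apply: contra_neq x0.
move/eqP; rewrite psumr_eq0; last by move=> j _; rewrite -expr2 sqr_ge0.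
move=> /allP xj; apply/rowP => j; apply/eqP; rewrite mxE.
by have := xj j (mem_index_enum j); rewrite -expr2 sqrf_eq0.
Qed.

(** A [zform] carries no additivity, so the value at 0 is a separate clause; it makes the norm of a
    summand agree with its norm in an orthogonal sum. *)
Definition posdef_form (L : zform) :=
  lform (0 : L) 0 = 0 /\ forall x : L, x != 0 -> 0 < lform x x.

(** Generation by the vectors of norm 1 and 2, phrased as an induction principle over subgroups.
    This is the only feature of root lattices, besides positivity, that the classification of fields
    needs. *)
Definition short_generated (L : zform) := forall S : set L, is_subgroup S ->
  (forall x, lform x x = 1 \/ lform x x = 2 -> S x) -> forall x, S x.

Section Isometries.

Lemma isometric_sym L M : isometric_lattices L M -> isometric_lattices M L.
Proof.
move=> [f [[g fK gK] fI]].
have gB : zmod_morphism g.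
  by move=> x y; apply: (can_inj fK); rewrite raddfB !gK.
pose ga : {additive M -> L} := HB.pack g (GRing.isZmodMorphism.Build _ _ g gB).
exists ga; split; first by exists f.
by move=> x y; rewrite -fI /= !gK.
Qed.

Lemma isometric_trans L M N :
  isometric_lattices L M -> isometric_lattices M N -> isometric_lattices L N.
Proof.
move=> [f [fb fI]] [g [gb gI]]; exists (g \o f : {additive L -> N}); split.
  exact: bij_comp.
by move=> x y /=; rewrite gI fI.
Qed.

Lemma posdef_form_isometric L M :
  isometric_lattices L M -> posdef_form M -> posdef_form L.
Proof.
move=> [f [fb fI]] [M0 Mp]; split; first by rewrite -fI raddf0.
move=> x x0; rewrite -fI Mp //; apply: contra_neq x0.
by rewrite -(raddf0 f); apply: (bij_inj fb).
Qed.

Lemma short_generated_isometric L M :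
  isometric_lattices L M -> short_generated M -> short_generated L.
Proof.
move=> [f [[g fK gK] fI]] Mg S sgS Sx x.
pose T : set M := [set y | exists2 z, S z & f z = y].
have [] : T (f x).
  apply: Mg => [|y yn].
    split; first by exists 0; [exact: subgroup0 | rewrite raddf0].
    move=> _ _ [a Sa <-] [b Sb <-]; exists (a - b); last by rewrite raddfB.
    exact: sgS.2.
  by exists (g y); rewrite ?gK //; apply: Sx; rewrite -fI gK.
by move=> z Sz /(can_inj fK) <-.
Qed.

Lemma is_lattice_isometric L M :
  isometric_lattices L M -> is_lattice M -> is_lattice L.
Proof.
move=> iLM; have [g [gb gI]] := isometric_sym iLM.
have [f [fb fI]] := iLM.
move=> [[r [e eb]] Mi Ms Ma Mn]; split.
- exists r, (g \o e); apply: (eq_bij (bij_comp gb eb)) => c /=.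
  by rewrite raddf_sum; apply: eq_bigr => i _; rewrite raddfMz.
- by move=> x y; rewrite -fI.
- by move=> x y; rewrite -fI Ms fI.
- by move=> x y z; rewrite -!fI raddfD Ma.
- move=> x xn; apply: (bij_inj fb); rewrite raddf0; apply: Mn => y.
  by have [h hK kK] := fb; rewrite -(kK y) fI.
Qed.

Lemma even_primitive_root_isometric L M : isometric_lattices L M ->
  even_primitive_root_lattice M -> even_primitive_root_lattice L.
Proof.
move=> iLM [Me Mp [Ml [z z0] [s [vs sI]]]].
have [f [fb fI]] := iLM; have [h hK kK] := fb; split.
- by move=> x; rewrite -fI.
- by move=> d dL; apply: Mp => x y; rewrite -(kK x) -(kK y) fI.
split; first exact: is_lattice_isometric Ml.
  by exists (h z); apply: contra_neq z0 => hz; rewrite -(kK z) hz raddf0.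
by exists s; split=> //; exact: isometric_trans sI.
Qed.

End Isometries.

Section RootLattices.

Lemma posdef_form_osum L M :
  posdef_form L -> posdef_form M -> posdef_form (osum L M).
Proof.
move=> [L0 Lp] [M0 Mp]; split=> [|[x y] xy /=]; first by rewrite /= L0 M0 addr0.
have [x0|x0] := eqVneq x 0.
  have y0 : y != 0 by apply: contra_neq xy => ->; rewrite x0.
  by rewrite x0 L0 add0r Mp.
have [->|y0] := eqVneq y 0; first by rewrite M0 addr0 Lp.
by rewrite addr_gt0 ?Lp ?Mp.
Qed.

Lemma short_generated_osum L M : posdef_form L -> posdef_form M ->
  short_generated L -> short_generated M -> short_generated (osum L M).
Proof.
move=> [L0 _] [M0 _] Lg Mg S sgS Sx [x y].
have -> : (x, y) = (x, 0) + (0, y) :> osum L M.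
  by congr (_, _); rewrite /= ?addr0 ?add0r.
apply: (subgroupD sgS).
  apply: (Lg [set a | S (a, 0)]) => [|a an].
    split; first exact: (subgroup0 sgS).
    by move=> a b Sa Sb; have := sgS.2 _ _ Sa Sb; congr S; congr pair;
       rewrite /= subr0.
  by apply: Sx; rewrite /= M0 addr0.
apply: (Mg [set a | S (0, a)]) => [|a an].
  split; first exact: (subgroup0 sgS).
  by move=> a b Sa Sb; have := sgS.2 _ _ Sa Sb; congr S; congr pair;
     rewrite /= subr0.
by apply: Sx; rewrite /= L0 add0r.
Qed.

(** The map [i] is the inclusion of the integers for types A and D and the identity for type E,
    whose coordinates are rational. *)
Lemma posdef_form_zsub (R : realDomainType) (i : R -> rat) N
    (P : zmodClosed 'rV[R]_N) :
    i 0 = 0 -> (forall x, 0 < x -> 0 < i x) ->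
  posdef_form (@ZForm (zsub P) (fun x y => i (dot (val x) (val y)))).
Proof.
move=> i0 ip; split=> [|x x0] /=; first by rewrite dot0l.
apply/ip/dot_gt0; apply: contra_neq x0 => vx; apply: val_inj.
by rewrite [LHS]vx raddf0.
Qed.

Lemma short_generated_zsub (V : zmodType) (P : zmodClosed V)
    (q : V -> V -> rat) :
    (forall S : set V, is_subgroup S ->
      (forall v, v \in P -> q v v = 1 \/ q v v = 2 -> S v) ->
      forall v, v \in P -> S v) ->
  short_generated (@ZForm (zsub P) (fun x y => q (val x) (val y))).
Proof.
move=> gP S sgS Sx x.
pose T : set V := [set v | exists2 y, S y & val y = v].
have [] : T (val x).
  apply: gP; last exact: valP.
    split; first by exists 0; [exact: (subgroup0 sgS) | rewrite raddf0].
    move=> _ _ [a Sa <-] [b Sb <-]; exists (a - b); last by rewrite raddfB.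
    exact: sgS.2.
  by move=> v vP vn; exists (Zsub vP) => //; apply: Sx.
by move=> y Sy /val_inj <-.
Qed.

Lemma short_generated_Z1 : short_generated Z1_lattice.
Proof.
move=> S sgS Sx x; rewrite -[x]intz; apply: (subgroupMz sgS).
by apply: Sx; left.
Qed.

Lemma posdef_form_Z1 : posdef_form Z1_lattice.
Proof.
split=> [|x x0] /=; first by rewrite mul0r.
by rewrite ltr0z -expr2 lt0r sqr_ge0 sqrf_eq0 x0.
Qed.

Lemma sum_delta (R : pzSemiRingType) N (i : 'I_N) :
  \sum_j (delta_mx 0 i : 'rV[R]_N) 0 j = 1.
Proof.
rewrite (bigD1 i) //= big1 ?mxE ?eqxx ?addr0 // => j ji.
by rewrite mxE (negPf ji).
Qed.

(** A vector with coordinate sum 0 is unchanged when the sum of its coordinates times the first unit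
    vector is subtracted, so it is a combination of the roots [e_j - e_0]. *)
Lemma short_generated_A l : short_generated (A_lattice l).
Proof.
apply: (@short_generated_zsub _ _ (fun x y => (dot x y)%:~R)) => S sgS Sr v vA.
have -> : v = \sum_j (delta_mx 0 j - delta_mx 0 0) *~ v 0 j.
  under eq_bigr => j _ do rewrite mulrzBl.
  rewrite sumrB -mulrz_sumr; move: vA => /eqP ->; rewrite mulr0z subr0.
  rewrite {1}[v]row_sum_delta; apply: eq_bigr => j _.
  by rewrite -scaler_int intz.
apply: (subgroup_sum sgS) => j _; apply: (subgroupMz sgS).
have [->|j0] := eqVneq j 0; first by rewrite subrr; exact: (subgroup0 sgS).
apply: Sr.
  rewrite /in_mem /= /A_pred; under eq_bigr => k _ do rewrite mxE [X in _ + X]mxE.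
  by rewrite sumrB !sum_delta subrr.
right; rewrite -scaleN1r dot_delta_pair //.
Qed.

Lemma short_generated_D l : (1 < l)%N -> short_generated (D_lattice l).
Proof.
move=> l1.
apply: (@short_generated_zsub _ _ (fun x y => (dot x y)%:~R)) => S sgS Sr v.
rewrite /in_mem /= /D_pred => /dvdzP[k vk].
rewrite [v]row_sum_delta.
under eq_bigr => j _ do rewrite -[v 0 j]intz scaler_int.
apply: (@subgroup_even_comb _ _ sgS _ predT _ _ k
  (Ordinal (ltnW l1)) (Ordinal l1)) => // [i j _ _ ij|]; last by rewrite vk mulrC.
split; apply: Sr.
- rewrite /in_mem /= /D_pred; under eq_bigr => a _ do rewrite mxE.
  by rewrite big_split /= !sum_delta.
- by right; rewrite -[delta_mx 0 j]scale1r dot_delta_pair ?mulr1.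
- rewrite /in_mem /= /D_pred; under eq_bigr => a _ do rewrite mxE [X in _ + X]mxE.
  by rewrite sumrB !sum_delta subrr.
- by right; rewrite -scaleN1r dot_delta_pair.
Qed.

(** Eight coordinates of square 1/4 give norm 2. These are the half-integral roots used to reduce to
    integral vectors. *)
Lemma half_vector_E6 (h : 'rV[rat]_8) :
    (forall j, h 0 j = 2^-1 \/ h 0 j = - 2^-1) -> (\sum_j h 0 j) / 2 \is a Num.int ->
    h 0 (inord 5) = h 0 (inord 6) -> h 0 (inord 6) = h 0 (inord 7) ->
  h \in E6_pred /\ dot h h = 2.
Proof.
move=> hj hs h56 h67; split.
  rewrite /in_mem /= /E6_pred /in_mem /= /E7_pred /in_mem /= /E8_pred.
  rewrite hs h56 h67 !eqxx !andbT; apply/orP; right; apply/forallP => j.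
  by case: (hj j) => ->.
rewrite /dot (eq_bigr (fun=> 4^-1)); first by rewrite sumr_const card_ord.
by move=> j _; case: (hj j) => ->.
Qed.

(** The vector with all coordinates 1/2 is a root of E6, hence of each of the three lattices.
    Subtracting it makes a half-integral vector integral, so only integral vectors with even
    coordinate sum are left to generate. *)
Lemma E8_integral (S : set 'rV[rat]_8) (P : zmodClosed 'rV[rat]_8) :
    is_subgroup S -> {subset P <= E8_pred} -> {subset E6_pred <= P} ->
    (forall v, v \in P -> dot v v = 1 \/ dot v v = 2 -> S v) ->
    (forall (c : 'I_8 -> int) k, \row_j (c j)%:~R \in P ->
        \sum_j c j = 2 * k -> S (\row_j (c j)%:~R)) ->
  forall v, v \in P -> S v.
Proof.
move=> sgS P8 P6 Sr Si v vP.
have intS w : w \in P -> (forall j, w 0 j \is a Num.int) -> S w.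
  move=> wP wi; have [c wc] : exists c : 'I_8 -> int, forall j, w 0 j = (c j)%:~R.
    exists (fun j => projT1 (cid (elimT intrP (wi j)))) => j.
    by case: cid.
  have wE : w = \row_j (c j)%:~R by apply/rowP => j; rewrite mxE wc.
  have := P8 _ wP; rewrite /in_mem /= /E8_pred => /andP[_ /intrP[k wk]].
  rewrite wE; apply: (Si c k); first by rewrite -wE.
  apply: (@intr_inj rat); rewrite raddf_sum intrM -wk mulrCA divff // mulr1.
  by apply: eq_bigr => j _; rewrite wc.
have := P8 _ vP; rewrite /in_mem /= /E8_pred => /andP[/orP[] /forallP vj _].
  exact: intS.
pose h : 'rV[rat]_8 := const_mx 2^-1.
have [h6 hh] : h \in E6_pred /\ dot h h = 2.
  apply: half_vector_E6; rewrite ?mxE //; first by move=> j; rewrite mxE; left.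
  by rewrite (eq_bigr (fun=> 2^-1)) ?sumr_const ?card_ord // => j _; rewrite mxE.
rewrite -[v](subrK h); apply: (subgroupD sgS); last first.
  by apply: Sr; [exact: P6 | right].
apply: intS; first exact: (rpredB vP (P6 _ h6)).
by move=> j; rewrite !mxE vj.
Qed.

Lemma split_ord8 (V : zmodType) m (F : 'I_8 -> V) : (m < 8)%N ->
  \sum_(j < 8 | (j < m.+1)%N) F j = \sum_(j < 8 | (j < m)%N) F j + F (inord m).
Proof.
move=> m8; rewrite (bigD1 (inord m)) /= ?inordK // addrC; congr (_ + _).
apply: eq_bigl => j; rewrite ltnS leq_eqVlt -(inj_eq val_inj) /= inordK //.
by case: ltngtP.
Qed.

Lemma delta_pair_E8 (i j : 'I_8) (c : int) :
  i != j -> c * c = 1 ->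
  dot (delta_mx 0 i + delta_mx 0 j *~ c) (delta_mx 0 i + delta_mx 0 j *~ c) = 2 :> rat.
Proof.
move=> ij cc; rewrite -scaler_int dot_delta_pair //.
by rewrite -intrM cc.
Qed.

Lemma row_delta_int (c : 'I_8 -> int) :
  \row_j (c j)%:~R = \sum_j delta_mx 0 j *~ c j :> 'rV[rat]_8.
Proof.
rewrite [LHS]row_sum_delta; apply: eq_bigr => j _.
by rewrite mxE scaler_int.
Qed.

Lemma pair_mem_E8 (i j : 'I_8) (c : int) : c = 1 \/ c = -1 ->
  (delta_mx 0 i + delta_mx 0 j *~ c : 'rV[rat]_8) \in E8_pred.
Proof.
move=> cc; rewrite /in_mem /= /E8_pred; apply/andP; split.
  apply/orP; left; apply/forallP => k; rewrite -scaler_int !mxE.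
  by rewrite rpredD ?rpredM ?rpred_nat // rpred_int.
under eq_bigr => k _ do rewrite -scaler_int !mxE.
rewrite big_split /= -mulr_sumr.
have dk (l : 'I_8) : \sum_(k < 8) ((0 == 0 :> 'I_1) && (k == l))%:R = 1 :> rat.
  by have := sum_delta rat l; under eq_bigr => k _ do rewrite mxE.
by rewrite !dk; case: cc => ->.
Qed.

Lemma short_generated_E8 : short_generated E8_lattice.
Proof.
apply: (@short_generated_zsub _ E8_pred (@dot rat 8)) => S sgS Sr.
apply: (@E8_integral S E8_pred) => //.
  by move=> v; rewrite /in_mem /= /E6_pred => /andP[]; rewrite {1}/in_mem /= /E7_pred => /andP[].
move=> c k _ ck; rewrite row_delta_int.
apply: (@subgroup_even_comb _ _ sgS _ predT _ _ k (inord 0) (inord 1)) => //.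
  by rewrite -(inj_eq val_inj) /= !inordK.
move=> i j _ _ ij; split; rewrite -[delta_mx 0 j]mulr1z -?mulrNz; apply: Sr;
  by [apply: pair_mem_E8; auto | right; apply: delta_pair_E8].
Qed.

(** The last two coordinates are equal, so a multiple of the root [e_6 + e_7] can be split off; the
    remaining six coordinates have even sum and are generated by roots of type D. *)
Lemma short_generated_E7 : short_generated E7_lattice.
Proof.
apply: (@short_generated_zsub _ E7_pred (@dot rat 8)) => S sgS Sr.
have P8 : {subset E7_pred <= E8_pred}.
  by move=> v; rewrite {1}/in_mem /= /E7_pred => /andP[].
apply: (@E8_integral S E7_pred) => //.
  by move=> v; rewrite {1}/in_mem /= /E6_pred => /andP[].
move=> c k cP ck.
have c67 : c (inord 6) = c (inord 7).
  move: cP; rewrite /in_mem /= /E7_pred => /andP[_]; rewrite !mxE => /eqP.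
  exact: intr_inj.
have S7 (i j : 'I_8) d : i != j -> d = 1 \/ d = -1 ->
    (i < 6)%N && (j < 6)%N || (i == inord 6) && (j == inord 7) && (d == 1) ->
    S (delta_mx 0 i + delta_mx 0 j *~ d).
  move=> ij dd ijP; apply: Sr; last first.
    by right; apply: delta_pair_E8 => //; case: dd => ->.
  rewrite {1}/in_mem /= /E7_pred pair_mem_E8 //= -scaler_int !mxE.
  case/orP: ijP => [/andP[i6 j6]|/andP[/andP[/eqP -> /eqP ->] /eqP ->]].
    have z (b : nat) (e : 'I_8) : (e < 6)%N -> (5 < b)%N -> (b == e :> nat) = false.
      by move=> e6 b5; rewrite gtn_eqF // (leq_trans e6).
    by rewrite -!(inj_eq val_inj) /= !inordK // !z // !mulr0.
  by rewrite -!(inj_eq val_inj) /= !inordK.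
have sp (V : zmodType) (F : 'I_8 -> V) :
    \sum_j F j = \sum_(j < 8 | (j < 6)%N) F j + F (inord 6) + F (inord 7).
  by rewrite -!split_ord8 //; apply: eq_bigl => j; rewrite ltn_ord.
rewrite row_delta_int sp -addrA; apply: (subgroupD sgS).
  apply: (@subgroup_even_comb _ _ sgS _ _ _ _ (k - c (inord 6)) (inord 0) (inord 1)).
  - by rewrite inordK.
  - by rewrite inordK.
  - by rewrite -(inj_eq val_inj) /= !inordK.
  - move=> i j i6 j6 ij; split; rewrite -[delta_mx 0 j]mulr1z -?mulrNz; apply: S7;
      by rewrite ?i6 ?j6 //; auto.
  - by move: ck; rewrite sp -c67 => ck; rewrite mulrBr -ck; ring.
rewrite c67 -mulrzDl; apply: (subgroupMz sgS).
rewrite -[delta_mx 0 (inord 7)]mulr1z; apply: S7; rewrite ?eqxx ?orbT //; auto.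
by rewrite -(inj_eq val_inj) /= !inordK.
Qed.

(** The last three coordinates share a value [a], but [e_5 + e_6 + e_7] has odd coordinate sum.
    Adding [e_4] repairs this: [e_4 + e_5 + e_6 + e_7] is the sum of the two half-integral roots [h]
    and [h']. Subtracting it [a] times leaves five coordinates with even sum. *)
Lemma short_generated_E6 : short_generated E6_lattice.
Proof.
apply: (@short_generated_zsub _ E6_pred (@dot rat 8)) => S sgS Sr.
have P8 : {subset E6_pred <= E8_pred}.
  move=> v; rewrite {1}/in_mem /= /E6_pred => /andP[].
  by rewrite {1}/in_mem /= /E7_pred => /andP[].
apply: (@E8_integral S E6_pred) => // c k cP ck.
have [c56 c67] : c (inord 5) = c (inord 6) /\ c (inord 6) = c (inord 7).
  move: cP; rewrite /in_mem /= /E6_pred {1}/in_mem /= /E7_pred.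
  by rewrite !mxE !eqr_int => /andP[/andP[_ /eqP ->] /eqP ->].
have S6 (i j : 'I_8) d : i != j -> d = 1 \/ d = -1 -> (i < 5)%N -> (j < 5)%N ->
    S (delta_mx 0 i + delta_mx 0 j *~ d).
  move=> ij dd i5 j5; apply: Sr; last first.
    by right; apply: delta_pair_E8 => //; case: dd => ->.
  rewrite {1}/in_mem /= /E6_pred {1}/in_mem /= /E7_pred pair_mem_E8 //=.
  have z (b : nat) (e : 'I_8) : (e < 5)%N -> (4 < b)%N -> (b == e :> nat) = false.
    by move=> e5 b4; rewrite gtn_eqF // (leq_trans e5).
  by rewrite -scaler_int !mxE -!(inj_eq val_inj) /= !inordK // !z // !mulr0.
have sp (V : zmodType) (F : 'I_8 -> V) : \sum_j F j =
    \sum_(j < 8 | (j < 5)%N) F j + F (inord 5) + F (inord 6) + F (inord 7).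
  by rewrite -!split_ord8 //; apply: eq_bigl => j; rewrite ltn_ord.
pose h : 'rV[rat]_8 := const_mx 2^-1.
pose h' : 'rV[rat]_8 := \row_j (if (j < 4)%N then - 2^-1 else 2^-1).
have sum8 (F : 'I_8 -> rat) : \sum_j F j = F (inord 0) + F (inord 1) + F (inord 2)
    + F (inord 3) + F (inord 4) + F (inord 5) + F (inord 6) + F (inord 7).
  rewrite sp !split_ord8 // big_pred0 ?add0r // => j; exact: ltn0.
have Sh : S (h + h').
  apply: (subgroupD sgS); apply: Sr.
  - by apply: (half_vector_E6 _ _ _ _).1; rewrite ?sum8 ?mxE //;
       move=> j; rewrite mxE; left.
  - by right; apply: (half_vector_E6 _ _ _ _).2; rewrite ?sum8 ?mxE //;
       move=> j; rewrite mxE; left.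
  - apply: (half_vector_E6 _ _ _ _).1; rewrite ?sum8 ?mxE ?inordK //.
    by move=> j; rewrite mxE; case: ifP; [right|left].
  - right; apply: (half_vector_E6 _ _ _ _).2; rewrite ?sum8 ?mxE ?inordK //.
    by move=> j; rewrite mxE; case: ifP; [right|left].
pose a := c (inord 5).
pose c' (j : 'I_8) := if (j < 4)%N then c j else c j - a.
rewrite (_ : \row_j _ = \sum_(j < 8 | (j < 5)%N) delta_mx 0 j *~ c' j + (h + h') *~ a).
  apply: (subgroupD sgS); last exact: (subgroupMz sgS).
  apply: (@subgroup_even_comb _ _ sgS _ _ _ _ (k - a - a) (inord 0) (inord 1)).
  - by rewrite inordK.
  - by rewrite inordK.
  - by rewrite -(inj_eq val_inj) /= !inordK.
  - by move=> i j i6 j6 ij; split; rewrite -[delta_mx 0 j]mulr1z -?mulrNz; apply: S6;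
      rewrite ?i6 ?j6 //; auto.
  - have c4 : c' (inord 4) = c (inord 4) - a by rewrite /c' inordK.
    have c03 : \sum_(j < 8 | (j < 4)%N) c' j = \sum_(j < 8 | (j < 4)%N) c j.
      by apply: eq_bigr => j j4; rewrite /c' j4.
    move: ck; rewrite sp -c67 -c56 !(@split_ord8 _ 4) // c03 c4 -/a => ck.
    by rewrite !mulrBr -ck; ring.
have -> : \sum_(j < 8 | (j < 5)%N) (delta_mx 0 j : 'rV[rat]_8) *~ c' j =
    \sum_j delta_mx 0 j *~ (if (j < 5)%N then c' j else 0).
  rewrite [LHS]big_mkcond; apply: eq_bigr => j _.
  by case: ifP => // _; rewrite mulr0z.
rewrite -row_delta_int; apply/rowP => j; rewrite mxE [RHS]mxE -scaler_int !mxE /c'.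
have [j4|j4] := ltnP j 4.
  by rewrite (ltn_trans j4) // subrr mulr0 addr0.
have -> : 2^-1 + 2^-1 = 1 :> rat by [].
rewrite mulr1; case: ltnP => j5; first by rewrite intrB subrK.
rewrite add0r /a; congr (_%:~R).
have [->|[->|->]] : j = inord 5 \/ j = inord 6 \/ j = inord 7.
- case: j j4 j5 => -[|[|[|[|[|[|[|[|j]]]]]]]] // j8 _ _.
  + by left; apply: val_inj; rewrite /= inordK.
  + by right; left; apply: val_inj; rewrite /= inordK.
  + by right; right; apply: val_inj; rewrite /= inordK.
- by [].
- by [].
- by rewrite c56 c67.
Qed.

Lemma zero_lattice_eq0 (x : zero_lattice) : x = 0.
Proof. by apply/rowP => -[]. Qed.

Lemma orthogonal_sum_root (s : seq root_type) : all valid_root_type s ->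
  let L := orthogonal_sum (map lattice_of_type s) in
  posdef_form L /\ short_generated L.
Proof.
elim: s => [_|t s IH /= /andP[vt /IH[sp sg]]] /=.
  split; first by split=> // x; rewrite (zero_lattice_eq0 x) eqxx.
  by move=> S sgS _ x; rewrite (zero_lattice_eq0 x); exact: (subgroup0 sgS).
suff [tp tg] : posdef_form (lattice_of_type t) /\ short_generated (lattice_of_type t).
  by split; [exact: posdef_form_osum | exact: short_generated_osum].
case: t vt => [|l|l|||] /= vt; split.
- exact: posdef_form_Z1.
- exact: short_generated_Z1.
- by apply: (@posdef_form_zsub int intr) => // x; rewrite ltr0z.
- exact: short_generated_A.
- by apply: (@posdef_form_zsub int intr) => // x; rewrite ltr0z.
- by apply: short_generated_D; apply: leq_trans vt.
- exact: (@posdef_form_zsub rat id).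
- exact: short_generated_E6.
- exact: (@posdef_form_zsub rat id).
- exact: short_generated_E7.
- exact: (@posdef_form_zsub rat id).
- exact: short_generated_E8.
Qed.

Lemma root_lattice_posdef L : root_lattice L -> posdef_form L.
Proof.
move=> [_ _ [s [vs sI]]]; apply: posdef_form_isometric sI _.
by have [] := orthogonal_sum_root vs.
Qed.

Lemma root_lattice_short_generated L : root_lattice L -> short_generated L.
Proof.
move=> [_ _ [s [vs sI]]]; apply: short_generated_isometric sI _.
by have [] := orthogonal_sum_root vs.
Qed.

End RootLattices.

(** * Orthogonal sums of copies of A_2 *)

Section A2.

(** [A2_fst] and [A2_snd] are the coordinates on the simple roots (1,-1,0) and (0,1,-1), that is,
    the partial sums of the entries. *)
Definition A2_fst (x : A_lattice 2) : int := val x 0 ord0.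
Definition A2_snd (x : A_lattice 2) : int := val x 0 ord0 + val x 0 (inord 1).

Fact A2_elt_subproof (k l : int) :
  (\row_j nth 0 [:: k; l - k; - l] j : 'rV[int]_3) \in @A_pred 2.
Proof.
by rewrite /in_mem /= /A_pred !big_ord_recl big_ord0 !mxE /=; apply/eqP; ring.
Qed.

Definition A2_elt k l : A_lattice 2 := Zsub (A2_elt_subproof k l).

Lemma A2_fst_elt k l : A2_fst (A2_elt k l) = k.
Proof. by rewrite /A2_fst /= mxE. Qed.

Lemma A2_snd_elt k l : A2_snd (A2_elt k l) = l.
Proof. by rewrite /A2_snd /= !mxE /= inordK // addrC subrK. Qed.

Lemma A2_sum0 (x : A_lattice 2) :
  val x 0 ord0 + val x 0 (inord 1) + val x 0 (inord 2) = 0.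
Proof.
have /eqP := valP x; rewrite !big_ord_recl big_ord0 addr0 addrA => <-.
by congr (_ + _ + _); congr (val x _ _); apply: val_inj; rewrite /= inordK.
Qed.

Lemma A2_fst_sndK x : A2_elt (A2_fst x) (A2_snd x) = x.
Proof.
apply: val_inj; apply/rowP => j; rewrite mxE /= /A2_fst /A2_snd.
case: j => -[|[|[|j]]] // j3 /=.
- by congr (val x _ _); apply: val_inj.
- rewrite addrC addKr; congr (val x _ _).
  by apply: val_inj; rewrite /= inordK.
- apply/eqP; rewrite eq_sym -addr_eq0 addrC; apply/eqP.
  rewrite -(A2_sum0 x); congr (_ + val x _ _).
  by apply: val_inj; rewrite /= inordK.
Qed.

Lemma A2_fstB x y : A2_fst (x - y) = A2_fst x - A2_fst y.
Proof. by rewrite /A2_fst raddfB /= !mxE. Qed.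

Lemma A2_sndB x y : A2_snd (x - y) = A2_snd x - A2_snd y.
Proof. by rewrite /A2_snd raddfB /= !mxE opprD addrACA. Qed.

Lemma A2_form x y : lform x y =
  (2 * A2_fst x * A2_fst y + 2 * A2_snd x * A2_snd y
   - A2_fst x * A2_snd y - A2_snd x * A2_fst y)%:~R.
Proof.
rewrite -{1}[x]A2_fst_sndK -{1}[y]A2_fst_sndK.
move: (A2_fst x) (A2_snd x) (A2_fst y) (A2_snd y) => k l k' l'.
congr (_%:~R); rewrite /=.
by rewrite /dot !big_ord_recl big_ord0 !mxE /=; ring.
Qed.

Lemma A2_is_lattice : is_lattice (A_lattice 2).
Proof.
split.
- exists 2%N, (fun i : 'I_2 => if i == ord0 then A2_elt 1 0 else A2_elt 0 1).
  have sE (c : {ffun 'I_2 -> int}) :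
      \sum_i (if i == ord0 then A2_elt 1 0 else A2_elt 0 1) *~ c i
      = A2_elt (c ord0) (c (inord 1)).
    rewrite !big_ord_recl big_ord0 addr0 /=.
    rewrite (_ : lift ord0 ord0 = inord 1); last by apply: val_inj; rewrite /= inordK.
    apply: val_inj; rewrite raddfD !raddfMz /=; apply/rowP => j.
    rewrite mxE -!scaler_int !mxE !intz.
    by case: j => -[|[|[|j]]] // j3 /=; ring.
  exists (fun x => [ffun i : 'I_2 => if i == ord0 then A2_fst x
                                     else A2_snd x]) => [c|x].
    rewrite sE; apply/ffunP => i; rewrite ffunE /=.
    case: eqP => [->|/eqP]; first by rewrite A2_fst_elt.
    rewrite A2_snd_elt; case: i => -[|[|i]] // i2 /= _.
    by congr (c _); apply: val_inj; rewrite /= inordK.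
  rewrite sE !ffunE /= -[RHS]A2_fst_sndK; congr (A2_elt _ _).
  by rewrite ifN // -(inj_eq val_inj) /= inordK.
- by move=> x y; rewrite rpred_int.
- by move=> x y /=; rewrite dotC.
- by move=> x y z /=; rewrite dotDl intrD.
- move=> x xn; apply/eqP; have := xn x; apply: contra_eqT => x0.
  have ip (y : int) : 0 < y -> 0 < y%:~R :> rat by rewrite ltr0z.
  have [_ p] := @posdef_form_zsub int intr _ (@A_pred 2) (erefl _) ip.
  by rewrite gt_eqF // p.
Qed.

Lemma free_osum (L M : zform) :
  free_of_finite_rank L -> free_of_finite_rank M ->
  free_of_finite_rank (osum L M).
Proof.
move=> [r [e [e' eK Ke]]] [s [f [f' fK Kf]]].
exists (r + s)%N, (fun i => match fintype.split i with
  | inl a => (e a, 0) | inr b => (0, f b) end).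
pose F (c : {ffun 'I_(r + s) -> int}) : osum L M :=
  (\sum_a e a *~ c (lshift s a), \sum_b f b *~ c (rshift r b)).
have FE (c : {ffun 'I_(r + s) -> int}) : \sum_i (match fintype.split i with
    | inl a => (e a, 0) | inr b => (0, f b) end : osum L M) *~ c i = F c.
  have in1 (x : L) k : ((x, 0) : osum L M) *~ k = (x *~ k, 0).
    have H n : ((x, 0) : osum L M) *+ n = (x *+ n, 0).
      by elim: n => // n IH; rewrite !mulrS IH; congr pair; rewrite /= addr0.
    case: k => n; first by rewrite -!pmulrn H.
    by rewrite NegzE !mulrNz -!pmulrn H; congr pair; rewrite /= oppr0.
  have in2 (x : M) k : ((0, x) : osum L M) *~ k = (0, x *~ k).
    have H n : ((0, x) : osum L M) *+ n = (0, x *+ n).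
      by elim: n => // n IH; rewrite !mulrS IH; congr pair; rewrite /= addr0.
    case: k => n; first by rewrite -!pmulrn H.
    by rewrite NegzE !mulrNz -!pmulrn H; congr pair; rewrite /= oppr0.
  rewrite big_split_ord /=.
  under eq_bigr => a _ do rewrite (unsplitK (inl a)) in1.
  under [X in _ + X]eq_bigr => b _ do rewrite (unsplitK (inr b)) in2.
  have p1 (I : finType) (h : I -> L) :
      \sum_i ((h i, 0) : osum L M) = (\sum_i h i, 0).
    by elim/big_rec2: _ => // i x y _ ->; congr pair; rewrite /= addr0.
  have p2 (I : finType) (h : I -> M) :
      \sum_i ((0, h i) : osum L M) = (0, \sum_i h i).
    by elim/big_rec2: _ => // i x y _ ->; congr pair; rewrite /= addr0.
  by rewrite p1 p2; congr pair; rewrite /= ?addr0 ?add0r.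
apply: (@eq_bij _ _ F); last by move=> c; rewrite FE.
exists (fun x => [ffun i => match fintype.split i with
  | inl a => e' x.1 a | inr b => f' x.2 b end]) => [c|[x y]].
  apply/ffunP => i; rewrite ffunE /=; case: fintype.split_ordP => j ->.
    have := eK [ffun a => c (lshift s a)] => /ffunP/(_ j); rewrite ffunE => <-.
    by congr (e' _ _); apply: eq_bigr => a _; rewrite ffunE.
  have := fK [ffun a => c (rshift r a)] => /ffunP/(_ j); rewrite ffunE => <-.
  by congr (f' _ _); apply: eq_bigr => a _; rewrite ffunE.
rewrite /F; congr pair.
  rewrite -[RHS]Ke; apply: eq_bigr => a _.
  by rewrite ffunE (unsplitK (inl a)).
rewrite -[RHS]Kf; apply: eq_bigr => b _.
by rewrite ffunE (unsplitK (inr b)).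
Qed.

Lemma is_lattice_osum L M : posdef_form L -> posdef_form M ->
  is_lattice L -> is_lattice M -> is_lattice (osum L M).
Proof.
move=> Lp Mp [Lf Li Ls La _] [Mf Mi Ms Ma _]; split.
- exact: free_osum.
- by move=> x y; rewrite rpredD ?Li ?Mi.
- by move=> x y /=; rewrite Ls Ms.
- by move=> x y z /=; rewrite La Ma addrACA.
- move=> x xn; apply/eqP; have := xn x; apply: contra_eqT => x0.
  by have [_ p] := posdef_form_osum Lp Mp; rewrite gt_eqF // p.
Qed.

Lemma A2_posdef : posdef_form (A_lattice 2).
Proof. by apply: (@posdef_form_zsub int intr) => // x; rewrite ltr0z. Qed.

Lemma A2_power_posdef s : posdef_form (A2_power s).
Proof.
rewrite /A2_power; have := @orthogonal_sum_root (nseq s (RA 2)).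
by rewrite map_nseq all_nseq orbT => /(_ isT)[].
Qed.

Lemma A2_power_even_primitive_root s : (0 < s)%N ->
  even_primitive_root_lattice (A2_power s).
Proof.
have ev t : even_lattice (A2_power t).
  elim: t => [|t IH] x; first by exists 0.
  case: x => x y; have [k yk] := IH y.
  rewrite /= in yk *.
  have [j xj] : exists j : int, lform x x = (2 * j)%:~R.
    rewrite A2_form; move: (A2_fst x) (A2_snd x) => a b.
    by exists (a * a + b * b - a * b); congr (_%:~R); ring.
  by exists (j + k); rewrite mulrDr intrD -xj -yk.
have latt t : is_lattice (A2_power t).
  elim: t => [|t IH]; last first.
    apply: is_lattice_osum => //; [exact: A2_posdef | exact: A2_power_posdef |].
    exact: A2_is_lattice.
  split=> //=; last by move=> x _; rewrite (zero_lattice_eq0 x).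
  exists 0, (fun=> 0); exists (fun=> [ffun=> 0]) => [c|x].
    by apply/ffunP => -[].
  by rewrite (zero_lattice_eq0 x); exact: zero_lattice_eq0.
case: s => // s _; split; first exact: ev.
  move=> d /(_ (A2_elt 1 0, 0) (A2_elt 0 1, 0))[k].
  have [z _] := A2_power_posdef s; rewrite /= z addr0.
  (* Two simple roots of one copy pair to -1, which forces primitivity. *)
  have -> : dot (val (A2_elt 1 0)) (val (A2_elt 0 1)) = -1.
    by rewrite /dot !big_ord_recl big_ord0 !mxE.
  move/intr_inj => dk; have : (d%:Z %| -1)%Z.
    by apply/dvdzP; exists k; rewrite mulrC -dk.
  by rewrite dvdzE dvdn1 => /eqP.
split; first exact: latt.
  exists (A2_elt 1 0, 0); apply/eqP.
  move/(congr1 (fun p : A2_power s.+1 => A2_fst p.1)); rewrite A2_fst_elt.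
  by rewrite /A2_fst raddf0 mxE.
exists (nseq s.+1 (RA 2)); split; first by rewrite all_nseq orbT.
by rewrite map_nseq; exists (idfun : {additive _ -> _}); split=> //; exists idfun.
Qed.

(* Simple roots u i, v i of s mutually orthogonal copies of A_2. *)
Definition A2_frame (L : zform) s (u v : nat -> L) :=
  forall i j, (i < s)%N -> (j < s)%N ->
    [/\ lform (u i) (u j) = (2 * (i == j))%:R,
        lform (v i) (v j) = (2 * (i == j))%:R,
        lform (u i) (v j) = - (i == j)%:R
      & lform (v i) (u j) = - (i == j)%:R].

Definition bilinear_form (L : zform) :=
  (forall x y z : L, lform (x + y) z = lform x z + lform y z) /\
  (forall x y z : L, lform z (x + y) = lform z x + lform z y).

Section Bilinear.
Variable L : zform.
Hypothesis bL : bilinear_form L.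

Lemma lformDl (x y z : L) : lform (x + y) z = lform x z + lform y z.
Proof. exact: bL.1. Qed.
Lemma lformDr (x y z : L) : lform z (x + y) = lform z x + lform z y.
Proof. exact: bL.2. Qed.
Lemma lform0l (z : L) : lform 0 z = 0.
Proof. by apply: (addrI (lform 0 z)); rewrite -lformDl !addr0. Qed.
Lemma lform0r (z : L) : lform z 0 = 0.
Proof. by apply: (addrI (lform z 0)); rewrite -lformDr !addr0. Qed.
Lemma lformNl (x z : L) : lform (- x) z = - lform x z.
Proof. by apply/eqP; rewrite -addr_eq0 -lformDl addNr lform0l. Qed.
Lemma lformNr (x z : L) : lform z (- x) = - lform z x.
Proof. by apply/eqP; rewrite -addr_eq0 -lformDr addNr lform0r. Qed.
Lemma lformMzl (x z : L) k : lform (x *~ k) z = k%:~R * lform x z.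
Proof.
have H n : lform (x *+ n) z = n%:R * lform x z.
  elim: n => [|n IH]; first by rewrite mulr0n lform0l mul0r.
  by rewrite mulrS lformDl IH -[n.+1]add1n natrD mulrDl mul1r.
case: k => n; first by rewrite -!pmulrn.
by rewrite NegzE !mulrNz lformNl -!pmulrn H mulNr.
Qed.
Lemma lformMzr (x z : L) k : lform z (x *~ k) = k%:~R * lform z x.
Proof.
have H n : lform z (x *+ n) = n%:R * lform z x.
  elim: n => [|n IH]; first by rewrite mulr0n lform0r mul0r.
  by rewrite mulrS lformDr IH -[n.+1]add1n natrD mulrDl mul1r.
case: k => n; first by rewrite -!pmulrn.
by rewrite NegzE !mulrNz lformNr -!pmulrn H mulNr.
Qed.
Lemma lform_suml (I : Type) (r : seq I) (P : pred I) (F : I -> L) z :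
  lform (\sum_(i <- r | P i) F i) z = \sum_(i <- r | P i) lform (F i) z.
Proof.
by elim/big_rec2: _ => [|i x y _ <-]; rewrite ?lform0l ?lformDl.
Qed.
Lemma lform_sumr (I : Type) (r : seq I) (P : pred I) (F : I -> L) z :
  lform z (\sum_(i <- r | P i) F i) = \sum_(i <- r | P i) lform z (F i).
Proof.
by elim/big_rec2: _ => [|i x y _ <-]; rewrite ?lform0r ?lformDr.
Qed.

(** Frames are indexed by all natural numbers so that the recursion on the number of copies can
    shift them by [succn]. *)
Fixpoint A2_map s (u v : nat -> L) : A2_power s -> L :=
  match s return A2_power s -> L with
  | 0 => fun=> 0
  | s'.+1 => fun p => u 0 *~ A2_fst p.1 + v 0 *~ A2_snd p.1
                      + @A2_map s' (u \o succn) (v \o succn) p.2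
  end.

Lemma A2_mapB s u v : zmod_morphism (@A2_map s u v).
Proof.
elim: s u v => [|s IH] u v x y /=; first by rewrite subr0.
rewrite A2_fstB A2_sndB !mulrzBr IH; set a := u 0 *~ _; set b := u 0 *~ _.
by rewrite !opprD [RHS]addrACA; congr (_ + _); rewrite [RHS]addrACA.
Qed.

Lemma A2_frameS s (u v : nat -> L) : A2_frame s.+1 u v ->
  A2_frame s (u \o succn) (v \o succn).
Proof. by move=> uv i j /= i1 j1; apply: uv. Qed.

Lemma A2_map_orth s (u v : nat -> L) (w : L) p :
  (forall i, (i < s)%N -> lform w (u i) = 0 /\ lform w (v i) = 0) ->
  (forall i, (i < s)%N -> lform (u i) w = 0 /\ lform (v i) w = 0) ->
  lform w (@A2_map s u v p) = 0 /\ lform (@A2_map s u v p) w = 0.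
Proof.
elim: s u v p => [|s IH] u v p wr wl; first by rewrite /= lform0l lform0r.
rewrite /= !(lformDr, lformDl, lformMzr, lformMzl).
have [-> ->] := wr 0%N isT; have [-> ->] := wl 0%N isT.
have [-> ->] := IH (u \o succn) (v \o succn) p.2
  (fun i (h : (i < s)%N) => wr i.+1 h) (fun i (h : (i < s)%N) => wl i.+1 h).
by rewrite !mulr0 !addr0.
Qed.

Lemma A2_map_isometry s (u v : nat -> L) : A2_frame s u v ->
  forall x y, lform (@A2_map s u v x) (@A2_map s u v y) = lform x y.
Proof.
elim: s u v => [|s IH] u v uv x y; first by rewrite /= lform0l.
have o w : w = u 0%N \/ w = v 0%N -> forall p,
    lform w (@A2_map s (u \o succn) (v \o succn) p) = 0 /\
    lform (@A2_map s (u \o succn) (v \o succn) p) w = 0.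
  move=> wE p; apply: A2_map_orth => i si /=;
  have [a b c d] := uv 0%N i.+1 isT si; have [a' b' c' d'] := uv i.+1 0%N si isT;
  by case: wE => ->; rewrite ?a ?b ?c ?d ?a' ?b' ?c' ?d' ?oppr0.
have [o1 o2] := (fun p => o _ (or_introl erefl) p, fun p => o _ (or_intror erefl) p).
have IHs := IH _ _ (A2_frameS uv).
case: x y => [x1 x2] [y1 y2] /=.
rewrite !(lformDr, lformDl, lformMzr, lformMzl) IHs.
rewrite !(fun p => (o1 p).1, fun p => (o1 p).2, fun p => (o2 p).1, fun p => (o2 p).2).
have [-> -> -> ->] := uv 0%N 0%N isT isT; rewrite eqxx /=.
rewrite -[(dot _ _)%:~R]/(lform x1 y1) A2_form.
move: (A2_fst x1) (A2_snd x1) (A2_fst y1) (A2_snd y1) => a b c d.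
by rewrite !(intrD, intrM, mulrNz); ring.
Qed.

(** Injectivity costs nothing: the map preserves the form, and a nonzero vector of the source has
    positive norm. Surjectivity is the spanning hypothesis. *)
Lemma A2_frame_isometric s (u v : nat -> L) : A2_frame s u v ->
    (forall y, exists k l : nat -> int, y = \sum_(i < s) (u i *~ k i + v i *~ l i)) ->
  isometric_lattices L (A2_power s).
Proof.
move=> uv sp; apply: isometric_sym.
pose f : {additive A2_power s -> L} :=
  HB.pack (@A2_map s u v) (GRing.isZmodMorphism.Build _ _ _ (@A2_mapB s u v)).
exists f; split; last exact: A2_map_isometry.
have finj : injective f.
  move=> x y /eqP; rewrite -subr_eq0 -raddfB => /eqP fxy; apply/eqP.
  rewrite -subr_eq0; apply: contraT => xy.
  have [_ /(_ _ xy)] := A2_power_posdef s.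
  have fz : A2_map u v (x - y) = 0 by [].
  by rewrite -(A2_map_isometry uv) fz lform0l ltxx.
have fsurj y : exists x, f x = y.
  have [k [l ->]] := sp y; clear sp uv finj; rewrite /f /= {f y}.
  elim: s u v k l => [|s IH] u v k l; first by exists 0; rewrite big_ord0.
  have [x xE] := IH (u \o succn) (v \o succn) (k \o succn) (l \o succn).
  exists (A2_elt (k 0%N) (l 0%N), x); rewrite big_ord_recl /= A2_fst_elt A2_snd_elt xE.
  by [].
exists (fun y => projT1 (cid (fsurj y))) => [x|y]; case: cid => //= z.
exact: finj.
Qed.

End Bilinear.

End A2.

(** * Positive trace forms *)

Section PositiveTraceForm.
Variables (K : fieldExtType rat) (theta : {rmorphism K -> K}).
Hypothesis thetaK : forall x, theta (theta x) = x.
Local Notation n := (\dim {:K}).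
Local Notation O := (@ring_of_integers K).
Hypothesis tr_pos : forall x, x != 0 -> 0 < tr_form theta x x.

Lemma tr_form_sym x y : tr_form theta x y = tr_form theta y x.
Proof. by rewrite /tr_form -(Trace_rmorph theta) rmorphM thetaK mulrC. Qed.

Lemma Gram_posdef (f : n.-tuple K) : basis_of {:K} f ->
  posdef (\matrix_(i < n, j < n) tr_form theta f`_i f`_j).
Proof.
move=> fb; split.
  by apply/matrixP => i j; rewrite !mxE tr_form_sym.
move=> v v0; pose y := \sum_i v 0 i *: f`_i.
have -> : (v *m (\matrix_(i, j) tr_form theta f`_i f`_j) *m v^T) 0 0
    = tr_form theta y y.
  rewrite mxE /tr_form {2}/y rmorph_sum mulr_sumr Trace_sum.
  apply: eq_bigr => j _; rewrite !mxE fmorph_numZ -scalerAr TraceZ mulrC.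
  congr (_ * _); rewrite /y mulr_suml Trace_sum; apply: eq_bigr => i _.
  by rewrite mxE -scalerAl TraceZ.
apply: tr_pos; apply: contra_neq v0 => y0; apply/rowP => i; rewrite mxE.
by have /freeP/(_ (v 0) y0 i) := basis_free fb.
Qed.

Lemma basis_scale (g : n.-tuple K) v : v != 0 -> basis_of {:K} g ->
  basis_of {:K} [tuple of map ( *%R v) g].
Proof.
move=> v0 gb; rewrite basisEfree; apply/and3P; split; last by rewrite size_tuple.
  apply/freeP => k; under eq_bigr => i _ do
    rewrite (nth_map 0) ?size_tuple // scalerAr.
  rewrite -mulr_sumr => /eqP; rewrite mulf_eq0 (negPf v0) /= => /eqP.
  by move/freeP: (basis_free gb); apply.
exact: subvf.
Qed.

(** Multiplying the basis by [x] changes the Gram matrix [B] in two ways: as a congruence by [X x],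
    which gives the ratio of determinants, and, moving [theta x] to the first argument, as a left
    product by [X (x * theta x)]. The latter matrix is therefore [B' B^-1], and its trace is the
    norm of [x]. The index [i0] stands for the first basis vector. *)
Lemma amgm_basis (f : n.-tuple K) x (i0 : 'I_n) : basis_of {:K} f -> i0 = 0%N :> nat ->
    1 <= \det (mulmat x) ^+ 2 ->
  n%:R <= tr_form theta x x /\
  (tr_form theta x x = n%:R ->
   tr_form theta (x * f`_0) (x * f`_0) = tr_form theta f`_0 f`_0).
Proof.
move=> fb i00 dx.
pose B := \matrix_(i < n, j < n) tr_form theta f`_i f`_j.
pose B' := \matrix_(i < n, j < n) tr_form theta (x * f`_i) (x * f`_j).
have x0 : x != 0.
  apply: contraTneq dx => ->; have -> : mulmat (0 : K) = 0.
    by rewrite -(subrr 1) mulmatB subrr.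
  case: n (dimK_gt0 K) => // k _.
  by rewrite det0 expr0n.
have pB : posdef B := Gram_posdef fb.
have pB' : posdef B'.
  have := Gram_posdef (basis_scale x0 fb); congr posdef.
  by apply/matrixP => i j; rewrite !mxE !(nth_map 0) ?size_tuple.
pose X (y : K) := passmx.mxof f f (amull y).
have XE y (i : 'I_n) : y * f`_i = \sum_(j < n) X y i j *: f`_j.
  rewrite [LHS](coord_basis fb) ?memvf //; apply: eq_bigr => j _.
  by rewrite !mxE /= passmx.vecof_delta lfunE.
have XB y z (i : 'I_n) : tr_form theta (y * f`_i) z = \sum_(j < n) X y i j * tr_form theta f`_j z.
  rewrite XE /tr_form mulr_suml Trace_sum; apply: eq_bigr => j _.
  by rewrite -scalerAl TraceZ.
have B'E : B' = X x *m B *m (X x)^T.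
  apply/matrixP => i j; rewrite !mxE tr_form_sym XB; apply: eq_bigr => k _.
  rewrite !mxE mulrC; congr (_ * _); rewrite tr_form_sym XB.
  by apply: eq_bigr => l _; rewrite !mxE.
have B'M : B' = X (x * theta x) *m B.
  apply/matrixP => i j; rewrite !mxE.
  rewrite -(_ : tr_form theta (x * theta x * f`_i) f`_j = \sum_k _).
    by rewrite /tr_form rmorphM; congr Trace; ring.
  by rewrite XB; apply: eq_bigr => k _; rewrite !mxE.
have id1 : passmx.mxof f (vbasis {:K}) \1 *m passmx.mxof (vbasis {:K}) f \1 = 1%:M.
  rewrite -(passmx.mxof_comp _ _ (vbasisP _)) comp_lfun1l.
  by rewrite passmx.mxof1 // (basis_free fb).
have detX : \det (X x) = \det (mulmat x).
  rewrite /X -{1}[amull x]comp_lfun1l -{1}[amull x]comp_lfun1r.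
  rewrite !(passmx.mxof_comp _ _ (vbasisP _)) !det_mulmx.
  by rewrite mulrAC -!det_mulmx id1 mul1mx.
have trM : \tr (X (x * theta x)) = tr_form theta x x.
  by rewrite /tr_form (Trace_basis fb (XE _)).
have {}dx : 1 <= \det (X x) ^+ 2 by rewrite detX.
have nn : n = n.-1.+1 by rewrite prednK // dimK_gt0.
have f0 (k : 'I_n) : k = 0%N :> nat -> f`_k = f`_0 by move=> ->.
have B0 : B i0 i0 = tr_form theta f`_0 f`_0 by rewrite mxE f0.
have B0' : B' i0 i0 = tr_form theta (x * f`_0) (x * f`_0) by rewrite mxE f0.
rewrite -B0 -B0' -trM; move: (X x) (X (x * theta x)) pB pB' B'E B'M dx.
clear B0 B0'; clearbody B B'; move: B B' i0 i00; clear X XE XB detX trM id1.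
rewrite nn => B B' i0 i00 X M pB pB' B'E B'M dx.
have -> : i0 = 0 by apply: val_inj.
have -> : M = B' *m invmx B.
  by rewrite B'M mulmxK // unitmxE unitfE gt_eqF ?posdef_det_gt0.
apply: trace_ge_of_det => //; rewrite B'E !det_mulmx det_tr mulrAC -expr2.
by apply: ler_peMl => //; apply/ltW/posdef_det_gt0.
Qed.

(* In the equality case x preserves tr_form theta v v for the first vector v of a
   basis; any nonzero v occurs, so polarization gives x theta(x) = 1. *)
Lemma amgm x : 1 <= \det (mulmat x) ^+ 2 ->
  n%:R <= tr_form theta x x /\
  (tr_form theta x x = n%:R -> x * theta x = 1).
Proof.
move=> dx; have n0 := dimK_gt0 K; pose i0 : 'I_n := Ordinal n0.
pose g := vbasis {:K}; have gb : basis_of {:K} g := vbasisP _.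
split; first by have [] := amgm_basis gb (erefl (i0 : nat)) dx.
move=> trx.
have inv v : tr_form theta (x * v) (x * v) = tr_form theta v v.
  have [->|v0] := eqVneq v 0; first by rewrite mulr0.
  have g0 : g`_0 != 0.
    apply: contraTneq (basis_free gb) => g0.
    apply/negP => /free_not0/(_ (mem_nth 0 (_ : 0 < size g)%N)).
    by rewrite size_tuple g0 eqxx => /(_ n0).
  have v1 : v / g`_0 != 0 by rewrite mulf_neq0 ?invr_eq0.
  have [_ /(_ trx)] := amgm_basis (basis_scale v1 gb) (erefl (i0 : nat)) dx.
  by rewrite (nth_map 0) ?size_tuple // divfK.
pose be := x * theta x - 1.
have thb : theta be = be by rewrite rmorphB rmorphM thetaK rmorph1 mulrC.
have bev v : Trace (be * (v * theta v)) = 0.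
  have := inv v; rewrite /tr_form => /eqP; rewrite -subr_eq0 -TraceN -TraceD.
  by move=> /eqP <-; congr Trace; rewrite rmorphM /be; ring.
(* Polarization at [1 + w]: the two cross terms have equal traces because [theta] fixes [be]. Taking
   [w] to be [be] then contradicts positivity unless [be] is 0. *)
have bew w : Trace (be * theta w) = 0.
  have th : Trace (be * theta w) = Trace (be * w).
    by rewrite -(Trace_rmorph theta) rmorphM thetaK thb.
  have := bev (1 + w).
  rewrite rmorphD rmorph1 (_ : be * _ = be * (1 * theta 1) + be * w + be * theta w
     + be * (w * theta w)); last by rewrite rmorph1; ring.
  by rewrite !TraceD !bev th => ?; lra.
apply/eqP; rewrite -subr_eq0; apply: contraT => /tr_pos.
by rewrite -/be /tr_form bew ltxx.
Qed.

End PositiveTraceForm.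

(** * Integral bases and norms of integers *)

Section IntegralBasis.
Variables (K : fieldExtType rat).
Local Notation n := (\dim {:K}).
Local Notation O := (@ring_of_integers K).

(** A Z-basis of O spans the field because every element has an integral multiple, and a rational
    relation becomes an integral one after clearing denominators. In particular the rank of O is
    n. *)
Lemma integral_basis : free_of_finite_rank (zsub (@ring_of_integers K)) ->
  exists2 e : n.-tuple K, basis_of {:K} e &
    (forall i : 'I_n, e`_i \in O) /\
    forall x, x \in O -> exists c : 'I_n -> int, x = \sum_(i < n) e`_i *~ c i.
Proof.
move=> [r [e [h hK Kh]]].
pose b : r.-tuple K := [tuple val (e i) | i < r].
have bE (i : 'I_r) : b`_i = val (e i).
  by rewrite -tnth_nth tnth_mktuple.
have bO x : x \in O -> exists c : 'I_r -> int, x = \sum_(i < r) b`_i *~ c i.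
  move=> xO; exists (h (Zsub xO)); rewrite -{1}[x]/(val (Zsub xO)) -{1}(Kh (Zsub xO)).
  by rewrite raddf_sum; apply: eq_bigr => i _; rewrite raddfMz bE.
have bb : basis_of {:K} b.
  apply/andP; split.
    rewrite eqEsubv subvf /=; apply/subvP => y _.
    have [N N0 /bO[c yc]] := O_fraction y.
    have -> : y = N%:R^-1 *: (y *+ N).
      by rewrite -scaler_nat scalerA mulVf ?scale1r // pnatr_eq0 -lt0n.
    rewrite yc; apply/memvZ/memv_suml => i _; rewrite -scaler_int.
    by apply/memvZ/memv_span/mem_nth; rewrite size_tuple.
  apply/freeP => q q0 i.
  pose D := (\prod_(i < r) `|denq (q i)|)%N.
  have D0 : (0 < D)%N by apply: prodn_gt0 => j; rewrite absz_gt0 denq_neq0.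
  have ex j : exists k : int, D%:R * q j = k%:~R.
    have [d Dd] : exists d, D = (d * `|denq (q j)|)%N.
      by apply/dvdnP; rewrite /D (bigD1 j) //= dvdn_mulr.
    exists (d%:Z * numq (q j)); rewrite intrM Dd natrM -mulrA; congr (_ * _).
    have dn : (`|denq (q j)|%N)%:R = (denq (q j))%:~R :> rat.
      by rewrite -[in RHS]absz_denq.
    by rewrite dn -{2}[q j]divq_num_den mulrCA divff ?mulr1 // intr_eq0 denq_neq0.
  pose c : {ffun 'I_r -> int} := [ffun j => projT1 (cid (ex j))].
  have cE j : D%:R * q j = (c j)%:~R by rewrite ffunE; case: cid.
  have : \sum_j e j *~ c j = 0.
    apply: val_inj.
    transitivity (D%:R *: \sum_(j < r) q j *: b`_j); last first.
      by rewrite q0 scaler0 raddf0.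
    rewrite raddf_sum scaler_sumr.
    apply: eq_bigr => j _.
    by rewrite raddfMz scalerA cE scaler_int bE.
  move=> c0; have : c = [ffun=> 0].
    rewrite -(hK c) c0 -(hK [ffun=> 0]); congr h.
    by rewrite big1 // => j _; rewrite ffunE mulr0z.
  move=> /ffunP/(_ i); rewrite [RHS]ffunE => ci.
  have /eqP := cE i; rewrite ci mulf_eq0 pnatr_eq0 (gtn_eqF D0) /=.
  by move/eqP.
have rn : r = n by rewrite (size_basis bb).
move: b bE bO bb {h hK Kh}; rewrite rn in e * => b bE bO bb.
by exists b => //; split=> // i; rewrite bE; exact: valP.
Qed.

(** On an integral basis, multiplication by [x] has an integer matrix, whose determinant is a
    nonzero integer. *)
Lemma O_det_ge1 x : free_of_finite_rank (zsub (@ring_of_integers K)) ->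
  x \in O -> x != 0 -> 1 <= \det (mulmat x) ^+ 2.
Proof.
move=> /integral_basis[e eb [eO Oe]] xO x0.
have ex (i : 'I_n) : exists c : 'I_n -> int, x * e`_i = \sum_(j < n) e`_j *~ c j.
  by apply: Oe; apply: O_mul => //; exact: eO.
pose M : 'M[int]_n := \matrix_(i, j) projT1 (cid (ex i)) j.
have ME (i : 'I_n) : x * e`_i = \sum_(j < n) ((M i j)%:~R : rat) *: e`_j.
  rewrite {1}(projT2 (cid (ex i))); apply: eq_bigr => j _.
  by rewrite mxE scaler_int.
move: M ME => M ME.
have detM : \det (mulmat x) = (\det M)%:~R.
  rewrite -det_map_mx.
  have -> : map_mx intr M = passmx.mxof e e (amull x).
    apply/matrixP=> i j; rewrite !mxE /= passmx.vecof_delta lfunE /= ME.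
    by rewrite coord_sum_free ?(basis_free eb) // mxE.
  have id1 : passmx.mxof (vbasis {:K}) e \1 *m passmx.mxof e (vbasis {:K}) \1 = 1%:M.
    rewrite -(passmx.mxof_comp _ _ eb) comp_lfun1l.
    by rewrite passmx.mxof1 // (basis_free (vbasisP _)).
  rewrite /mulmat -{1}[amull x]comp_lfun1l -{1}[amull x]comp_lfun1r.
  rewrite !(passmx.mxof_comp _ _ eb) !det_mulmx.
  by rewrite mulrAC -!det_mulmx id1 mul1mx.
rewrite {1}detM; have : \det (mulmat x) != 0 by have := mulmat_unit x0; rewrite unitmxE unitfE.
rewrite detM intr_eq0; move: (\det M) => d d0.
by rewrite -rmorphXn /= -[1]/(1%:~R) ler_int -gtz0_ge1 exprn_even_gt0.
Qed.

End IntegralBasis.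

(** * From root lattices to cyclotomic fields *)

Section RootLatticeToCyclotomic.
Variables (K : fieldExtType rat) (theta : {rmorphism K -> K}).
Hypothesis thetaK : forall x, theta (theta x) = x.
Local Notation n := (\dim {:K}).
Local Notation O := (@ring_of_integers K).
Variable m : nat.
Hypothesis m_gt0 : (0 < m)%N.
Hypothesis traceO : [set Trace x | x in [set x : K | x \in O]] =
  [set m%:R * k%:~R | k in [set: int]].
Let Lm := scale_lattice m%:R^-1 (trace_lattice theta).

Lemma O_trace x : x \in O -> exists k : int, Trace x = m%:R * k%:~R.
Proof.
move=> xO; have : [set Trace x | x in [set x : K | x \in O]] (Trace x) by exists x.
by rewrite traceO => -[k _ <-]; exists k.
Qed.

Lemma O_trace_m : exists2 x, x \in O & Trace x = m%:R.
Proof.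
have : [set m%:R * k%:~R | k in [set: int]] (m%:R : rat).
  by exists 1 => //; rewrite mulr1.
by rewrite -traceO => -[x xO <-]; exists x.
Qed.

Lemma m_neq0 : m%:R != 0 :> rat.
Proof. by rewrite pnatr_eq0 -lt0n. Qed.

Hypothesis rootL : even_primitive_root_lattice Lm.

(** Positivity on O extends to the field by scaling an element into O, which multiplies its norm by
    a positive square. *)
Lemma root_tr_pos x : x != 0 -> 0 < tr_form theta x x.
Proof.
move=> x0; have [N N0 NO] := O_fraction x.
have [_ p] : posdef_form Lm by apply: root_lattice_posdef; case: rootL.
have N0' : N%:R != 0 :> rat by rewrite pnatr_eq0 -lt0n.
have := p (Zsub NO); rewrite /= /tr_form.
have -> : x *+ N * theta (x *+ N) = (N%:R * N%:R) *: (x * theta x).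
  by rewrite rmorphMn -!scaler_nat -scalerAl -scalerAr scalerA.
rewrite TraceZ !pmulr_rgt0 ?invr_gt0 ?mulr_gt0 ?ltr0n //; apply.
apply/eqP => /(congr1 val) /= /eqP; rewrite -scaler_nat scaler_eq0 (negPf x0).
by rewrite (negPf N0').
Qed.

Lemma Lm_even (x : Lm) : exists k : int, lform x x = (2 * k)%:~R.
Proof. by case: rootL => + _ _; apply. Qed.

Lemma Lm_ge2 (x : Lm) : x != 0 -> 2 <= lform x x.
Proof.
move=> x0; have [_ /(_ x x0)] : posdef_form Lm.
  by apply: root_lattice_posdef; case: rootL.
have [k ->] := Lm_even x; rewrite ltr0z => k0.
by rewrite -[2]/(2%:~R) ler_int; move: k0; rewrite pmulr_rgt0 // => ?; lia.
Qed.

Lemma Lm_neq1 (x : Lm) : lform x x <> 1.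
Proof.
have [k ->] := Lm_even x; rewrite -[1]/(1%:~R) => /intr_inj h.
by move: k h => k; lia.
Qed.

Lemma Lm_free : free_of_finite_rank (zsub O).
Proof. by case: rootL => _ _ [[]]. Qed.

Lemma O_amgm x : x \in O -> x != 0 ->
  n%:R <= tr_form theta x x /\
  (tr_form theta x x = n%:R -> x * theta x = 1).
Proof.
move=> xO x0; apply: (amgm thetaK root_tr_pos).
exact: O_det_ge1 Lm_free xO x0.
Qed.

(** In this form the roots are visibly closed under multiplication, which a condition on norms would
    not show. *)
Definition unimodular_integer x := x \in O /\ x * theta x = 1.
Local Notation U := unimodular_integer.

(** A vector of norm 2 exists, since otherwise the generators of norm 1 or 2 would be absent and the
    lattice would be 0, although it contains 1. *)
Lemma n_eq_2m : n = m.*2 /\ forall x : Lm, lform x x = 2 -> U (val x).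
Proof.
pose one : Lm := Zsub (O1 K).
have one0 : one != 0 by apply/eqP => /(congr1 val) /eqP; rewrite /= oner_eq0.
have n2 : (m.*2 <= n)%N.
  have := Lm_ge2 one0; rewrite /= /tr_form rmorph1 mulr1 Trace1.
  by rewrite ler_pdivlMl ?ltr0n // -natrM ler_nat muln2.
have [x x2] : exists x : Lm, lform x x = 2.
  apply: contrapT => nx; have := root_lattice_short_generated (_ : root_lattice Lm).
  have rL : root_lattice Lm by case: rootL.
  move=> /(_ rL [set 0])/(_ _ _ one) H.
  have /eqP : one = 0; last by rewrite (negPf one0).
  apply: H => [|x [/Lm_neq1 //|x2]]; last by case: nx; exists x.
  by split=> [//|x y -> ->]; rewrite subr0.
have n2' (y : Lm) : lform y y = 2 -> tr_form theta (val y) (val y) = m.*2%:R.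
  move=> y2; rewrite -muln2 natrM -y2 /= mulrA divff ?mul1r //.
  by rewrite pnatr_eq0 -lt0n.
have nz (y : Lm) : lform y y = 2 -> val y != 0.
  move=> y2; apply: contra_eq_neq y2 => y0.
  by rewrite /= y0 /tr_form mul0r Trace0 mulr0.
have nE : n = m.*2.
  apply/eqP; rewrite eqn_leq n2 andbT.
  have [] := O_amgm (valP x) (nz x x2).
  by rewrite n2' // ler_nat.
split=> // y y2; split; first exact: valP.
have [_] := O_amgm (valP y) (nz y y2); apply.
by rewrite n2' // nE.
Qed.

Lemma U_generates (S : set (zsub O)) : is_subgroup S ->
  (forall x, U (val x) -> S x) -> forall x, S x.
Proof.
move=> sgS SU; have rL : root_lattice Lm by case: rootL.
apply: (root_lattice_short_generated rL) => // x [/Lm_neq1 //|x2].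
by apply: SU; have [_] := n_eq_2m; apply.
Qed.

Lemma tr_formDD x y : tr_form theta (x + y) (x + y) =
  tr_form theta x x + 2 * tr_form theta x y + tr_form theta y y.
Proof.
rewrite {1}/tr_form rmorphD mulrDl !mulrDr !TraceD.
rewrite -/(tr_form theta x x) -/(tr_form theta x y) -/(tr_form theta y y).
by rewrite -/(tr_form theta y x) (tr_form_sym thetaK y x); ring.
Qed.

Lemma tr_form_ge0 x : 0 <= tr_form theta x x.
Proof.
have [->|x0] := eqVneq x 0; last exact/ltW/root_tr_pos.
by rewrite /tr_form mul0r Trace0.
Qed.

(** An element is determined by its pairings with an integral basis, since the form is definite.
    These pairings are integers after division by m, and they are bounded: for [x] of norm 2,
    nonnegativity of the norms of [x + e_i] and [x - e_i] gives 2 |k_i| <= 2 + N_i. This replaces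
    the Cauchy-Schwarz inequality. *)
Lemma U_finite : exists s : seq K, uniq s /\ forall x, x \in s <-> U x.
Proof.
have [e eb [eO Oe]] := integral_basis Lm_free.
have m0 := m_neq0; have mp : 0 < m%:R :> rat by rewrite ltr0n.
have ee (i : 'I_n) : exists k : int, tr_form theta e`_i e`_i = m%:R * k%:~R.
  by apply: O_trace; apply: O_mul; [exact: eO | exact/O_rmorph/eO].
pose N i := projT1 (cid (ee i)).
have NE (i : 'I_n) : tr_form theta e`_i e`_i = m%:R * (N i)%:~R by rewrite /N; case: cid.
pose B := (\sum_(i < n) (2 + `|N i|))%N.
have BN (i : 'I_n) : (2 + `|N i| <= B)%N by rewrite /B (bigD1 i) //= leq_addr.
pose k x (i : 'I_n) : int := numq (tr_form theta x e`_i / m%:R).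
have kE x (i : 'I_n) : U x -> tr_form theta x e`_i = m%:R * (k x i)%:~R.
  move=> [xO _]; have [j jE] : exists j : int, tr_form theta x e`_i = m%:R * j%:~R.
    by apply: O_trace; apply: O_mul => //; apply/O_rmorph/eO.
  by rewrite /k jE [X in numq (X / _)]mulrC mulfK // numq_int.
have kB x (i : 'I_n) : U x -> (`|k x i| <= B)%N.
  move=> xU; have xx : tr_form theta x x = m%:R * 2%:~R.
    by case: (xU) => _; rewrite /tr_form => ->; rewrite Trace1 n_eq_2m.1 -muln2 natrM.
  have h1 := tr_form_ge0 (x + e`_i); have h2 := tr_form_ge0 (x + - e`_i).
  have tN y : tr_form theta x (- y) = - tr_form theta x y.
    by rewrite /tr_form rmorphN mulrN TraceN.
  have tNN y : tr_form theta (- y) (- y) = tr_form theta y y.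
    by rewrite /tr_form rmorphN mulrNN.
  rewrite tr_formDD xx kE // NE in h1.
  rewrite tr_formDD xx tN tNN kE // NE in h2.
  have {}h1 : 0 <= (2 + 2 * k x i + N i)%:~R :> rat.
    rewrite -(pmulr_rge0 _ mp); apply: le_trans h1 _.
    by rewrite !intrD intrM le_eqVlt; apply/orP; left; apply/eqP; ring.
  have {}h2 : 0 <= (2 - 2 * k x i + N i)%:~R :> rat.
    rewrite -(pmulr_rge0 _ mp); apply: le_trans h2 _.
    by rewrite !intrD mulrNz intrM le_eqVlt; apply/orP; left; apply/eqP; ring.
  rewrite ler0z in h1; rewrite ler0z in h2.
  by have := BN i; move: (k x i) (N i) h1 h2 => a b; lia.
(* Adding [B] moves the interval from -B to B onto the indices 0 to 2B, so [g] records all the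
   pairings faithfully. *)
pose g x : {ffun 'I_n -> 'I_(B.*2).+1} :=
  [ffun i => inord (absz (k x i + B%:Z))].
have ginj x y : U x -> U y -> g x = g y -> x = y.
  move=> xU yU gxy.
  have kk (i : 'I_n) : k x i = k y i.
    move/ffunP/(_ i): gxy; rewrite !ffunE => /(congr1 val) /=.
    have := kB x i xU; have := kB y i yU.
    move: (k x i) (k y i) => a b bB aB.
    by rewrite !inordK; lia.
  have td (i : 'I_n) : tr_form theta (x - y) e`_i = 0.
    by rewrite /tr_form mulrBl TraceD TraceN -!/(tr_form _ _ _) !kE // kk subrr.
  have [c cE] : exists c : 'I_n -> int, x - y = \sum_(i < n) e`_i *~ c i.
    by apply: Oe; rewrite rpredB //; [case: xU | case: yU].
  apply/eqP; rewrite -subr_eq0; apply: contraT => /root_tr_pos.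
  rewrite {2}cE /tr_form rmorph_sum mulr_sumr Trace_sum big1 ?ltxx // => i _.
  by rewrite rmorphMz mulrzAr TraceMz -/(tr_form _ _ _) td mulr0.
pose pk c : K := if pselect (exists x, U x /\ g x = c) is left h
  then projT1 (cid h) else 1.
have pkP x : U x -> pk (g x) = x.
  move=> xU; rewrite /pk; case: pselect => [h|[]]; last by exists x.
  by case: cid => y [yU gy] /=; exact: ginj.
exists (undup [seq x <- [seq pk c | c <- enum {: {ffun 'I_n -> 'I_(B.*2).+1}}] | `[< U x >]]).
split=> [|x]; first exact: undup_uniq.
rewrite mem_undup mem_filter; split=> [/andP[/asboolP]//|xU].
apply/andP; split; first exact/asboolP.
by apply/mapP; exists (g x); rewrite ?mem_enum ?pkP.
Qed.

Lemma U_mul x y : U x -> U y -> U (x * y).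
Proof.
move=> [xO x1] [yO y1]; split; first exact: O_mul.
by rewrite rmorphM mulrACA x1 y1 mulr1.
Qed.

Lemma U_neq0 x : U x -> x != 0.
Proof. by move=> [_ x1]; apply: contra_eq_neq x1 => ->; rewrite mul0r eq_sym oner_eq0. Qed.

(** Multiplication by [x] permutes the finite set of roots; comparing the products of all its
    elements shows that the power of [x] by its cardinal is 1. A field with that many roots of unity
    of this exponent has a primitive one among them. *)
Lemma U_prim_root : exists w z,
  [/\ w.-primitive_root z, U z & forall x, U x -> exists i, x = z ^+ i].
Proof.
have [s [us sU]] := U_finite.
have U1 : U 1 by split; [exact: O1 | rewrite rmorph1 mulr1].
have s0 : (0 < size s)%N by case: (s) (sU 1) => // -[_ /(_ U1)].
have xs x : x \in s -> x ^+ size s = 1.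
  move=> /sU xU; have xinj : injective ( *%R x) by apply: mulfI; exact: U_neq0.
  have ps : perm_eq (map ( *%R x) s) s.
    apply: uniq_perm => //; first by rewrite map_inj_uniq.
    have umap : uniq (map ( *%R x) s) by rewrite map_inj_uniq.
    apply: (uniq_min_size umap _ _).2; rewrite ?size_map //.
    by move=> _ /mapP[y /sU yU ->]; apply/sU/U_mul.
  have pr : \prod_(y <- s) (x * y) = \prod_(y <- s) y.
    by rewrite -[RHS](perm_big _ ps) big_map.
  have p0 : \prod_(y <- s) y != 0.
    by rewrite prodf_seq_neq0; apply/allP => y /sU /U_neq0.
  apply: (mulIf p0); rewrite mul1r -[RHS]pr big_split /= big_const_seq count_predT.
  by rewrite iter_mulr_1.
have : has (size s).-primitive_root s.
  apply: has_prim_root => //; apply/allP => x xS.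
  by rewrite unity_rootE xs.
move=> /hasP[z zs pz]; exists (size s), z; split=> //; first exact/sU.
move=> x /sU xS; have [i ->] := prim_rootP pz (xs x xS); by exists i.
Qed.

Lemma root_cyclotomic_conj : exists a b, cyclotomic_with_conjugation theta a b.
Proof.
have [w [z [pz zU Uz]]] := U_prim_root.
have w0 := prim_order_gt0 pz.
have [n2m _] := n_eq_2m.
have m0 := m_neq0.
have OKz x : x \in O -> x \in <<1; z>>%VS.
  move=> xO; pose S := [set y : zsub O | val y \in <<1; z>>%VS].
  suff : S (Zsub xO) by [].
  apply: U_generates => [|y /Uz[i yE]].
    split; first exact: mem0v.
    by move=> a b; exact: memvB.
  by rewrite /S /= [val y]yE; apply: rpredX; exact: memv_adjoin.
have Kz : <<1; z>>%VS = {:K}%VS.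
  apply/eqP; rewrite eqEsubv subvf /=; apply/subvP => y _.
  have [N N0 /OKz yN] := O_fraction y.
  rewrite -[y]scale1r -(@mulVf _ (N%:R : rat)) ?pnatr_eq0 -?lt0n //.
  by rewrite -scalerA scaler_nat memvZ.
have theta_z : theta z = z^-1.
  by apply: (mulfI (U_neq0 zU)); rewrite zU.2 divff // U_neq0.
have UN1 : U (-1).
  split; first by rewrite rpredN O1.
  by rewrite rmorphN rmorph1 mulrNN mulr1.
have w2 : (2 %| w)%N.
  have [i zi] := Uz _ UN1.
  have zi2 : z ^+ (i * 2) = 1 by rewrite exprM -zi sqrrN expr1n.
  move/eqP: zi2; rewrite -(prim_order_dvd pz) => wi.
  have nwi : ~~ (w %| i)%N.
    rewrite (prim_order_dvd pz) -zi eq_sym -subr_eq0 opprK.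
    by rewrite -mulr2n natr_ext_eq0.
  rewrite -[(2 %| w)%N]negbK -prime_coprime //; apply: contra nwi.
  by rewrite coprime_sym => c; rewrite -(Gauss_dvdl _ c).
have pw p : prime p -> (p %| w)%N -> (p == 2)%N || (p == 3)%N.
  move=> pp pdw; have pu := dvdn_prim_root pz pdw; set u := z ^+ _ in pu.
  have uO : u \in O by apply: O_exp; case: zU.
  have [k uk] := O_trace uO.
  have := Trace_prime_root pp pu; rewrite uk n2m -muln2 natrM => h.
  have {}h : k * p.-1%:Z = - 2.
    apply: (@intr_inj rat); rewrite intrM mulrNz; apply: (mulfI m0).
    by rewrite mulrA h mulrN.
  have /dvdn_leq : (p.-1 %| 2)%N.
    have : (p.-1%:Z %| -2)%Z by apply/dvdzP; exists k.
    by rewrite dvdzE.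
  by move=> /(_ isT); case: p pp {pdw pu u uO uk h} => [|[|[|[|p]]]].
have w3 : (3 %| w)%N.
  apply: contraT => n3.
  (* Without the prime 3 the order of a root is a power of 2. If 4 divides it the trace is 0;
     otherwise the root is 1 or -1, with trace 2m or -2m. An integer of trace m is then out of reach
     of sums of roots. *)
  have Us x : U x -> exists k : int, Trace x = (m.*2)%:R * k%:~R.
    move=> /Uz[i ->]; have [d zd dw] : {d | d.-primitive_root (z ^+ i) & (d %| w)%N}.
      by apply: prim_order_exists => //; rewrite exprAC (prim_expr_order pz) expr1n.
    have [/Trace_root4/(_ zd) ->|n4] := boolP (4 %| d)%N; first by exists 0; rewrite mulr0.
    have d0 := prim_order_gt0 zd.
    have d2 : (d %| 2)%N.
      have [c cc dE] := pfactor_coprime (isT : prime 2) d0.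
      have c1 : c = 1%N.
        apply/eqP; apply: contraT => c1; have pc := pdiv_prime (_ : 1 < c)%N.
        have {}pc : prime (pdiv c).
          by apply: pc; move: d0 c1; rewrite dE muln_gt0 => /andP[]; lia.
        have pcd : (pdiv c %| d)%N by rewrite dE dvdn_mulr // pdiv_dvd.
        case/orP: (pw _ pc (dvdn_trans pcd dw)) => /eqP pE.
          have := pdiv_dvd c; rewrite pE => h2.
          by move: cc; rewrite prime_coprime // h2.
        by move: n3; rewrite -pE (dvdn_trans pcd dw).
      rewrite dE c1 mul1n in n4 *; case: (logn 2 d) n4 => [|[|l]] //.
      by rewrite !expnS mulnA dvdn_mulr.
    have z1 : z ^+ i = 1 \/ z ^+ i = -1.
      have : (z ^+ i) ^+ 2 == 1 by rewrite -(prim_order_dvd zd).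
      by rewrite sqrf_eq1 => /orP[]/eqP; auto.
    rewrite -n2m; case: z1 => ->.
      by exists 1; rewrite Trace1 mulr1.
    by exists (-1); rewrite TraceN Trace1 mulrNz mulrN mulr1.
  have [x xO xm] := O_trace_m.
  pose S := [set y : zsub O | exists k : int, Trace (val y) = (m.*2)%:R * k%:~R].
  have : S (Zsub xO).
    apply: U_generates => [|y /Us //].
    split; first by exists 0; exact: etrans (Trace0 K) (esym (mulr0 _)).
    move=> a b [k ak] [l bl]; exists (k - l).
    have e : Trace (val (a - b)) = Trace (val a + - val b) by [].
    by rewrite e TraceD TraceN ak bl intrB mulrBr.
  move=> [k]; rewrite /= xm -muln2 natrM -mulrA -{1}[m%:R]mulr1 => /(mulfI m0).
  move=> h; have : 1 = 2 * k :> int by apply: (@intr_inj rat); rewrite intrM -h.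
  by lia.
have wE : w = (2 ^ logn 2 w * 3 ^ logn 3 w)%N.
  have [c cc cE] := pfactor_coprime (isT : prime 2) w0.
  have c0 : (0 < c)%N by move: w0; rewrite cE muln_gt0 => /andP[].
  have cw : (c %| w)%N by rewrite cE dvdn_mulr.
  have [d dd dE] := pfactor_coprime (isT : prime 3) c0.
  have l3 : logn 3 w = logn 3 c.
    by rewrite cE lognM ?expn_gt0 // lognX (_ : logn 3 2 = 0)%N ?muln0 ?addn0.
  suff d1 : d = 1%N by rewrite {1}cE dE d1 mul1n -l3 mulnC.
  have dc : (d %| c)%N by rewrite dE dvdn_mulr.
  apply/eqP; apply: contraT => d1.
  have pd : prime (pdiv d).
    by apply: pdiv_prime; move: c0 d1; rewrite dE muln_gt0 => /andP[]; lia.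
  have pdc := dvdn_trans (pdiv_dvd d) dc.
  case/orP: (pw _ pd (dvdn_trans pdc cw)) => /eqP pE.
    by move: cc; rewrite prime_coprime // -pE pdc.
  by move: dd; rewrite prime_coprime // -pE pdiv_dvd.
exists (logn 2 w), (logn 3 w); split.
- by rewrite logn_gt0 mem_primes w0 w2.
- by rewrite logn_gt0 mem_primes w0 w3.
- by exists z; rewrite -?wE.
move=> phi; pose f : {rmorphism K -> algC} := (phi \o theta).
pose g : {rmorphism K -> algC} := (Num.conj \o phi).
(* It suffices to compare at the generator: the image of [z] is a complex root of unity, whose
   inverse is its conjugate. *)
apply: (@rmorph_eq_generator _ _ f g z Kz); rewrite /f /g /= theta_z fmorphV.
have phiw : `|phi z| = 1.
  apply/eqP; rewrite -(@pexpr_eq1 _ _ w) // -normrX -rmorphXn.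
  by rewrite (prim_expr_order pz) rmorph1 normr1.
by rewrite invC_norm phiw expr1n invr1 mul1r.
Qed.

End RootLatticeToCyclotomic.

(** * Integers of cyclotomic fields *)

Section Embedding.
Variable K : fieldExtType rat.

(** Writing x = q(z), the embedding sends x to q(l) for a complex root l of the minimal polynomial
    of [z]. The choice of q is irrelevant, since the minimal polynomial divides every polynomial
    vanishing at [z]. An embedding is needed to draw anything from [is_complex_conjugation], which
    only speaks of embeddings. *)
Lemma embedding_exists (z : K) :
  <<1; z>>%VS = {:K}%VS -> inhabited {rmorphism K -> algC}.
Proof.
move=> Kz; have /polyOver1P[p pE] := minPolyOver 1 z.
have p1 : size (map_poly ratr p : {poly algC}) != 1%N.
  rewrite size_map_poly -(size_map_poly (in_alg K)) -pE size_minPoly eqSS.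
  have := adim_gt0 <<1; z>>%AS; rewrite dim_Fadjoin dimv1 muln1.
  by rewrite lt0n.
have /closed_rootP[l lp] := p1.
have ex (x : K) : exists q : {poly rat}, x = (map_poly (in_alg K) q).[z].
  by apply/Fadjoin1_polyP; rewrite Kz memvf.
pose q x := projT1 (cid (ex x)).
have qE x : (map_poly (in_alg K) (q x)).[z] = x by rewrite /q; case: cid.
have kill (r : {poly rat}) :
    (map_poly (in_alg K) r).[z] = 0 -> (map_poly ratr r : {poly algC}).[l] = 0.
  move=> rz; have : minPoly 1 z %| map_poly (in_alg K) r.
    by apply: minPoly_dvdp; [apply/polyOver1P; exists r | apply/eqP].
  rewrite pE dvdp_map => /dvdpP[t ->].
  by rewrite rmorphM hornerM (rootP lp) mulr0.
pose phi x : algC := (map_poly ratr (q x)).[l].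
have phiP x (r : {poly rat}) : (map_poly (in_alg K) r).[z] = x ->
    phi x = (map_poly ratr r).[l].
  move=> rx; apply/eqP; rewrite -subr_eq0 /phi -hornerN -hornerD -rmorphB.
  by apply/eqP/kill; rewrite rmorphB hornerD hornerN qE rx subrr.
have phiB : zmod_morphism phi.
  move=> x y; rewrite (phiP _ (q x - q y)) rmorphB hornerD hornerN //.
  by rewrite !qE.
have phiM : monoid_morphism phi.
  split; first by rewrite (phiP _ 1) rmorph1 hornerC.
  by move=> x y; rewrite (phiP _ (q x * q y)) rmorphM hornerM // !qE.
by constructor; exact: (HB.pack phi (GRing.isZmodMorphism.Build _ _ _ phiB)
  (GRing.isMonoidMorphism.Build _ _ _ phiM)).
Qed.

(** An embedding preserves the vanishing of rational polynomials, so [z] and its image have the same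
    minimal polynomial, and that of the image is cyclotomic. *)
Lemma dim_cyclotomic w (z : K) : w.-primitive_root z ->
  <<1; z>>%VS = {:K}%VS -> \dim {:K} = totient w.
Proof.
move=> zw Kz; have [phi] := embedding_exists Kz.
have /polyOver1P[p pE] := minPolyOver 1 z.
have lw : w.-primitive_root (phi z) by rewrite fmorph_primitive_root.
have [f [fl fm] fdv] := minCpolyP (phi z).
have phip (r : {poly rat}) : phi (map_poly (in_alg K) r).[z] = (map_poly ratr r).[phi z].
  rewrite -horner_map -map_poly_comp; congr (_.[_]); apply: eq_map_poly => c /=.
  by rewrite rmorphZ_num rmorph1 mulr1.
have fp : f %| p.
  by rewrite -fdv rootE -phip -pE minPolyxx rmorph0.
have pf : p %| f.
  rewrite -(dvdp_map (in_alg K)) -pE; apply: minPoly_dvdp.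
    by apply/polyOver1P; exists f.
  by rewrite rootE -(fmorph_eq0 phi) phip -rootE fdv.
have s : size p = size f by apply/eqp_size; rewrite /eqp pf fp.
have := congr1 (fun q : {poly algC} => size q) fl.
rewrite (minCpoly_cyclotomic lw) size_cyclotomic size_map_poly -s.
rewrite -(size_map_poly (in_alg K)) -pE size_minPoly => -[->].
by rewrite -Kz dim_Fadjoin dimv1 muln1.
Qed.

End Embedding.

Lemma exprD_prime (R : comNzRingType) p (c d : R) : prime p ->
  (c + d) ^+ p = c ^+ p + d ^+ p
    + p%:R * \sum_(i < p.-1) (c ^+ (p.-1 - i) * d ^+ i.+1) *+ ('C(p, i.+1) %/ p).
Proof.
case: p => // p pp; rewrite exprDn big_ord_recl big_ord_recr /= /bump /= !add1n.
rewrite subn0 subnn !expr0 mulr1 mul1r bin0 binn !mulr1n addrCA addrA addrAC addrC.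
rewrite -[RHS]addrA; congr (_ + _); rewrite addrC; congr (_ + _).
rewrite mulr_sumr; apply: eq_bigr => i _.
rewrite add1n subSS mulr_natl -mulrnA divnK // prime_dvd_bin //.
by apply/andP; split=> //; rewrite ltnS; exact: ltn_ord.
Qed.

(** * Saturation of rings generated by two roots of unity *)

Section MonomialRing.
Variable K : fieldExtType rat.

(* Z[x, y], as the smallest subgroup containing the monomials. *)
Definition mono_ring (x y : K) : set K := [set z | forall S : set K,
  is_subgroup S -> (forall i j, S (x ^+ i * y ^+ j)) -> S z].

Lemma mono_ringC x y : mono_ring x y = mono_ring y x.
Proof.
by apply/seteqP; split=> z zL S sgS Sm; apply: zL => // i j; rewrite mulrC.
Qed.

Variables x y : K.
Local Notation La := (mono_ring x y).

Lemma mono_ring_subgroup : is_subgroup La.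
Proof.
split=> [S [S0 _]//|a b aL bL S sgS Sm].
by apply: sgS.2; [exact: aL | exact: bL].
Qed.

Lemma mono_ring_mono i j : La (x ^+ i * y ^+ j).
Proof. by move=> S _; apply. Qed.

Lemma mono_ringM a b : La a -> La b -> La (a * b).
Proof.
move=> aL bL; have mL i j : La (a * (x ^+ i * y ^+ j)).
  apply: (aL [set c | La (c * (x ^+ i * y ^+ j))]) => [|k l].
    split; first by rewrite /= mul0r; case: mono_ring_subgroup.
    by move=> c d; rewrite /= mulrBl; case: mono_ring_subgroup => _; apply.
  by rewrite /= mulrACA -!exprD; exact: mono_ring_mono.
apply: (bL [set c | La (a * c)]) => //.
split; first by rewrite /= mulr0; case: mono_ring_subgroup.
by move=> c d; rewrite /= mulrBr; case: mono_ring_subgroup => _; apply.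
Qed.

Lemma mono_ring1 : La 1.
Proof. by rewrite -[1]mulr1 -{1}(expr0 x) -(expr0 y); exact: mono_ring_mono. Qed.

Lemma mono_ringX a k : La a -> La (a ^+ k).
Proof.
move=> aL; elim: k => [|k IH]; first by rewrite expr0; exact: mono_ring1.
by rewrite exprS; exact: mono_ringM.
Qed.

Lemma mono_ringB a b : La a -> La b -> La (a - b).
Proof. exact: mono_ring_subgroup.2. Qed.

Lemma mono_ring0 : La 0.
Proof. exact: mono_ring_subgroup.1. Qed.

Lemma mono_ringN a : La a -> La (- a).
Proof. by move=> aL; rewrite -sub0r; apply: mono_ringB => //; exact: mono_ring0. Qed.

Lemma mono_ringD a b : La a -> La b -> La (a + b).
Proof. by move=> aL bL; rewrite -[b]opprK; apply: mono_ringB => //; exact: mono_ringN. Qed.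

Lemma mono_ring_sum (I : Type) (r : seq I) (P : pred I) (F : I -> K) :
  (forall i, P i -> La (F i)) -> La (\sum_(i <- r | P i) F i).
Proof. by move=> FL; apply: big_ind => //; [exact: mono_ring0|exact: mono_ringD]. Qed.

Lemma mono_ringMn a k : La a -> La (a *+ k).
Proof.
move=> aL; elim: k => [|k IH]; first by rewrite mulr0n; exact: mono_ring0.
by rewrite mulrS; exact: mono_ringD.
Qed.

Lemma mono_ring_nat k : La k%:R.
Proof. apply: mono_ringMn; exact: mono_ring1. Qed.

Lemma mono_ring_x : La x.
Proof. by have := mono_ring_mono 1 0; rewrite expr1 expr0 mulr1. Qed.

Variable p : nat.
Hypothesis pp : prime p.

(** Freshman's congruence modulo p, with the quotient kept inside the ring. In the induction the old
    error term p t contributes (p t)^p and further multiples of p. *)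
Lemma mono_frobenius f a b : La a -> La b ->
  exists2 t, La t & (a + b) ^+ (p ^ f) = a ^+ (p ^ f) + b ^+ (p ^ f) + p%:R * t.
Proof.
have frob1 c d : La c -> La d ->
    exists2 t, La t & (c + d) ^+ p = c ^+ p + d ^+ p + p%:R * t.
  move=> cL dL; rewrite exprD_prime //.
  exists (\sum_(i < p.-1) (c ^+ (p.-1 - i) * d ^+ i.+1) *+ ('C(p, i.+1) %/ p)) => //.
  apply: mono_ring_sum => i _; apply: mono_ringMn.
  by apply: mono_ringM; exact: mono_ringX.
elim: f a b => [|f IH] a b aL bL.
  by exists 0; [exact: mono_ring0 | rewrite !expr1 mulr0 addr0].
have [t tL abE] := IH a b aL bL.
rewrite expnSr !exprM abE.
set a' := a ^+ _; set b' := b ^+ _.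
have a'L : La a' by exact: mono_ringX.
have b'L : La b' by exact: mono_ringX.
have [t1 t1L ->] := frob1 (a' + b') (p%:R * t) (mono_ringD a'L b'L)
  (mono_ringM (mono_ring_nat p) tL).
have [t2 t2L ->] := frob1 a' b' a'L b'L.
exists (t2 + t1 + p%:R ^+ p.-1 * t ^+ p).
  apply: mono_ringD; first exact: mono_ringD.
  by apply: mono_ringM; [by apply: mono_ringX; exact: mono_ring_nat | exact: mono_ringX].
have pX : p%:R ^+ p = p%:R * p%:R ^+ p.-1 :> K by rewrite -exprS prednK ?prime_gt0.
rewrite exprMn pX; move: (t ^+ p) (p%:R ^+ p.-1) (a' ^+ p) (b' ^+ p) => e1 e2 e3 e4.
ring.
Qed.

(** The sign that appears when Frobenius is applied to a difference: it is exactly -1 for odd p, and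
    congruent to -1 modulo 2 otherwise. *)
Lemma signp_dvd f : exists2 t, La t & 1 + (-1) ^+ (p ^ f) = p%:R * t.
Proof.
have [p2|p2] := even_prime pp; last first.
  exists 0; first exact: mono_ring0.
  by rewrite -signr_odd oddX p2 orbT expr1 subrr mulr0.
case: f => [|f]; first by exists 0; [exact: mono_ring0|rewrite expr1 subrr mulr0].
exists 1; first exact: mono_ring1.
by rewrite -signr_odd oddX p2 /= expr0 mulr1.
Qed.

Variable c : nat.
Hypothesis c_gt0 : (0 < c)%N.
Hypothesis xp : (p ^ c).-primitive_root x.
Variable q : nat.
Hypothesis q_gt0 : (0 < q)%N.
Hypothesis pq : coprime p q.
Hypothesis yq : y ^+ q = 1.
Local Notation pi := (1 - x).

Lemma mono_ring_pi : La pi.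
Proof. by apply: mono_ringB; [exact: mono_ring1 | exact: mono_ring_x]. Qed.

Lemma pi_dvd_1Bx k : exists2 t, La t & 1 - x ^+ k = pi * t.
Proof.
exists (\sum_(i < k) x ^+ i).
  by apply: mono_ring_sum => i _; apply: mono_ringX; apply: mono_ring_x.
by rewrite -opprB subrX1 -mulNr opprB.
Qed.

(** For a power [w] of [x] of order p, p is the sum of the p terms 1 - w^i, because the powers of
    [w] sum to 0; each term is divisible by 1 - x. *)
Lemma pi_dvd_p : exists2 t, La t & p%:R = pi * t.
Proof.
pose w := x ^+ (p ^ c.-1).
have wp : p.-primitive_root w.
  have := dvdn_prim_root xp (_ : (p %| p ^ c)%N).
  rewrite -{1 2}(prednK c_gt0) expnSr mulnK ?prime_gt0 //; apply.
  by rewrite dvdn_mull.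
have ex (i : 'I_p) : exists t, La t /\ 1 - w ^+ i = pi * t.
  by have [t] := pi_dvd_1Bx (p ^ c.-1 * i); rewrite exprM; exists t.
exists (\sum_(i < p) projT1 (cid (ex i))).
  by apply: mono_ring_sum => i _; case: cid => t [].
have -> : p%:R = \sum_(i < p) 1 - \sum_(i < p) w ^+ i.
  by rewrite (prim_root_sum0 (prime_gt1 pp) wp) subr0 sumr_const card_ord.
rewrite mulr_sumr -sumrB; apply: eq_bigr => i _.
by case: cid => t [].
Qed.

(** Frobenius modulo p sends 1 - x to 1 - x^(p^c), up to the sign correction, and this is 0. *)
Lemma p_dvd_piX : exists2 t, La t & pi ^+ (p ^ c) = p%:R * t.
Proof.
have [t tL ->] := mono_frobenius c mono_ring1 (mono_ringN mono_ring_x).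
have [t' t'L sE] := signp_dvd c.
exists (t' + t); first exact: mono_ringD.
by rewrite expr1n exprNn (prim_expr_order xp) mulr1 sE mulrDr.
Qed.

(** The exponent Q = p^f, with f a multiple of [totient q], is 1 modulo q, so it fixes the powers of
    [y]; it fixes those of [x] modulo pi because [x] is 1 modulo pi. Frobenius extends this from
    monomials to sums, and the factor [N] in f makes Q as large as desired. *)
Lemma frobenius_mod_pi N : exists2 Q, (N <= Q)%N &
  forall z, La z -> exists2 t, La t & z ^+ Q - z = pi * t.
Proof.
pose f := (totient q * N)%N; exists (p ^ f)%N.
  apply: leq_trans (ltnW (ltn_expl N (prime_gt1 pp))) _.
  by rewrite leq_exp2l ?prime_gt1 // leq_pmull // totient_gt0.
have qQ : (q %| p ^ f - 1)%N.
  rewrite -eqn_mod_dvd ?expn_gt0 ?prime_gt0 // /f expnM -modnXm.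
  by rewrite Euler_exp_totient // modnXm exp1n.
have Q1 : (p ^ f = (p ^ f - 1).+1)%N by rewrite subn1 prednK // expn_gt0 prime_gt0.
have [tp tpL tpE] := pi_dvd_p.
move=> z zL; suff [] : [set z | La z /\ exists2 t, La t & z ^+ (p ^ f) - z = pi * t] z.
  by [].
apply: zL => [|i j].
  split.
    split; first exact: mono_ring0.
    exists 0; first exact: mono_ring0.
    by rewrite mulr0 subr0 expr0n expn_eq0 -leqn0 leqNgt prime_gt0.
  move=> a b [aL [ta taL taE]] [bL [tb tbL tbE]]; split; first exact: mono_ringB.
  have [t tL ->] := mono_frobenius f aL (mono_ringN bL).
  have [s sL sE] := signp_dvd f.
  exists (ta - tb + tp * s * b ^+ (p ^ f) + tp * t).
    apply: mono_ringD; last exact: mono_ringM.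
    apply: mono_ringD; first exact: mono_ringB.
    by apply: mono_ringM; [exact: mono_ringM | exact: mono_ringX].
  rewrite tpE in sE; rewrite exprNn tpE.
  have -> : (-1) ^+ (p ^ f) = pi * tp * s - 1 by rewrite -sE addrC addKr.
  rewrite mulrDr mulrDr mulrBr -taE -tbE; ring.
split; first exact: mono_ring_mono.
have [t tL tE] := pi_dvd_1Bx (i * (p ^ f - 1)).
exists (- (x ^+ i * y ^+ j * t)).
  by apply: mono_ringN; apply: mono_ringM => //; exact: mono_ring_mono.
have yQ : y ^+ (j * p ^ f) = y ^+ j.
  have /dvdnP[k kE] := qQ.
  rewrite Q1 kE mulnS exprD (_ : j * (k * q) = q * (j * k))%N; last by lia.
  by rewrite exprM yq expr1n mulr1.
rewrite exprMn -!exprM yQ {1}Q1 mulnS exprD.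
by rewrite mulrN mulrCA -tE; ring.
Qed.

(** One denominator for all powers of [a]. Integers have this property, and saturation uses their
    integrality only in this form. *)
Definition bounded_powers a := exists2 N, (0 < N)%N & forall k, La (a ^+ k *+ N).

Lemma pi_neq0 : pi != 0.
Proof.
have [t _ tE] := pi_dvd_p; apply: contra_eq_neq tE => ->.
by rewrite mul0r natr_ext_eq0 -lt0n prime_gt0.
Qed.

(* With z = pi a, the power z^Q is a multiple of pi up to a factor N' prime to p:
   high powers of pi absorb the p-part of the denominator N.  Since z = z^Q mod pi,
   so is z N', and hence z. *)
Lemma pi_saturated a : bounded_powers a -> La (pi * a) -> La a.
Proof.
move=> [N N0 aN] zL; set z := pi * a in zL.
have [S [N' [NE pN']]] : exists S N', N = (p ^ S * N')%N /\ coprime N' p.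
  have [N' cN' NE] := pfactor_coprime pp N0.
  by exists (logn p N), N'; rewrite mulnC coprime_sym.
have [tp tpL tpE] := pi_dvd_p; have [te teL teE] := p_dvd_piX.
have [Q QN Qz] := frobenius_mod_pi (p ^ c * S).+1.
have [t tL tE] := Qz z zL.
(* In [z ^+ Q *+ N], which is pi^Q times [a ^+ Q *+ N], the first p^c S factors pi provide p^S. It
   cancels the p-part of N, and at least one factor pi is left over. *)
have [mu muL muE] : exists2 mu, La mu & z ^+ Q *+ N' = pi * mu.
  exists (te ^+ S * pi ^+ (Q - (p ^ c * S).+1) * (a ^+ Q *+ N)).
    apply: mono_ringM => //; apply: mono_ringM; first exact: mono_ringX.
    apply: mono_ringX; exact: mono_ring_pi.
  have p0 : (p%:R : K) ^+ S != 0 by rewrite expf_neq0 // natr_ext_eq0 -lt0n prime_gt0.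
  apply: (mulfI p0); rewrite -[z ^+ Q *+ N']mulr_natr mulrCA.
  have <- : N%:R = p%:R ^+ S * N'%:R :> K by rewrite NE natrM natrX.
  rewrite /z exprMn -{1}(subnKC QN) exprD exprS exprM teE exprMn.
  by rewrite -[a ^+ Q *+ N]mulr_natr; ring.
have [m2 m2L m2E] : exists2 mu', La mu' & z *+ N' = pi * mu'.
  exists (mu - t *+ N'); first by apply: mono_ringB => //; exact: mono_ringMn.
  by rewrite mulrBr -muE mulrnAr -tE mulrnBl subKr.
have N'0 : (0 < N')%N by move: N0; rewrite NE muln_gt0 => /andP[].
(* Bezout: pi divides both [z *+ N'] and [z *+ p] in the ring, and [N'] is prime to p. *)
have [u v uv _] := egcdnP p N'0; rewrite (eqP pN') in uv.
have zE : z = pi * (m2 *+ u - tp * z *+ v).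
  rewrite mulrBr !mulrnAr -m2E mulrA -tpE mulr_natl -!mulrnA.
  rewrite [(N' * u)%N]mulnC uv mulrnDr mulr1n [(p * v)%N]mulnC.
  by rewrite addrAC subrr add0r.
have -> : a = m2 *+ u - tp * z *+ v by apply: (mulfI pi_neq0); exact: zE.
apply: mono_ringB; first exact: mono_ringMn.
by apply: mono_ringMn; apply: mono_ringM.
Qed.

(** Since p divides pi^(p^c), the product of the latter with [a] lies in the ring. The factors pi
    are then removed one at a time; every intermediate product still has bounded powers. *)
Lemma p_saturated a : bounded_powers a -> La (a *+ p) -> La a.
Proof.
move=> ab paL; have [te teL teE] := p_dvd_piX.
have : La (pi ^+ (p ^ c) * a).
  by rewrite teE mulrAC mulr_natl mulrC; exact: mono_ringM.
elim: (p ^ c)%N => [|k IH]; first by rewrite mul1r.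
rewrite exprS -mulrA => h; apply: IH; apply: pi_saturated => //.
have [N N0 aN] := ab; exists N => // l.
rewrite exprMn -mulrnAr; apply: mono_ringM => //.
by apply: mono_ringX; apply: mono_ringX; apply: mono_ring_pi.
Qed.

End MonomialRing.

(** For a root of unity of order p^c, this says that its k-th power has order divisible by p^2
    unless p^(c-1) divides k, which is what the vanishing of traces requires. *)
Lemma prime_expn_dvd_mul p c k d : prime p -> (0 < c)%N -> (0 < k)%N -> (0 < d)%N ->
  (p ^ c %| k * d)%N -> ~~ (p ^ c.-1 %| k)%N -> (p ^ 2 %| d)%N.
Proof.
move=> pp c0 k0 d0; rewrite !pfactor_dvdn ?muln_gt0 ?k0 ?d0 // lognM //.
by rewrite -ltnNge; lia.
Qed.

(** * The integral frame of a cyclotomic field *)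

Section Cyclotomic.
Variables (K : fieldExtType rat) (theta : {rmorphism K -> K}).
Local Notation n := (\dim {:K}).
Local Notation O := (@ring_of_integers K).
Hypothesis traceO : forall x, x \in O -> exists k : int, Trace x = k%:~R.
Variables (a b : nat) (z2 z3 : K).
Hypothesis a_gt0 : (0 < a)%N.
Hypothesis b_gt0 : (0 < b)%N.
Hypothesis z2P : (2 ^ a).-primitive_root z2.
Hypothesis z3P : (3 ^ b).-primitive_root z3.
Hypothesis theta_z2 : theta z2 = z2^-1.
Hypothesis theta_z3 : theta z3 = z3^-1.
Hypothesis K_gen : <<1; z2 * z3>>%VS = {:K}%VS.
Hypothesis K_dim : n = (2 ^ a * 3 ^ b.-1)%N.

Local Notation A := (2 ^ a.-1)%N.
Local Notation B := (3 ^ b.-1)%N.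
Local Notation x i j := (z2 ^+ i * z3 ^+ j).

Lemma A_gt0 : (0 < A)%N. Proof. by rewrite expn_gt0. Qed.
Lemma B_gt0 : (0 < B)%N. Proof. by rewrite expn_gt0. Qed.
Lemma A2E : (2 ^ a = A * 2)%N. Proof. by rewrite -expnSr prednK. Qed.
Lemma B3E : (3 ^ b = B * 3)%N. Proof. by rewrite -expnSr prednK. Qed.
Lemma nE : n = (A * B * 2)%N. Proof. by rewrite K_dim A2E mulnAC. Qed.

Lemma z2A : z2 ^+ A = -1.
Proof. by apply: prim_root_half; rewrite -muln2 -A2E. Qed.

Lemma z3B : 3.-primitive_root (z3 ^+ B).
Proof.
have := dvdn_prim_root z3P (_ : (3 %| 3 ^ b)%N).
by rewrite B3E mulnK // dvdn_mull //; apply.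
Qed.

Lemma z3B2 : z3 ^+ (B + B) = - 1 - z3 ^+ B.
Proof.
have := prim_root_sum0 (isT : 1 < 3)%N z3B.
rewrite !big_ord_recl big_ord0 expr0 expr1 addr0 -exprM muln2 -addnn /= => h.
by apply/eqP; rewrite -subr_eq0 -h; apply/eqP; rewrite /bump /=; ring.
Qed.

(** Raising to the power 3^b removes [z3], so 2^a divides k times the order of the product; as
    2^(a-1) does not divide k, that order is a multiple of 4. *)
Lemma Trace_x0 k l : ~~ (A %| k)%N -> Trace (x k l) = 0.
Proof.
move=> Ak; have k0 : (0 < k)%N by case: k Ak => //; rewrite dvdn0.
have x1 : x k l ^+ (2 ^ a * 3 ^ b) = 1.
  rewrite exprMn -!exprM [(k * _)%N]mulnC [(l * _)%N]mulnC -!mulnA exprM.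
  rewrite (prim_expr_order z2P) expr1n mul1r mulnCA exprM.
  by rewrite (prim_expr_order z3P) expr1n.
have [d dP _] : {d | d.-primitive_root (x k l) & (d %| 2 ^ a * 3 ^ b)%N}.
  by apply: prim_order_exists => //; rewrite muln_gt0 !expn_gt0.
have d0 := prim_order_gt0 dP.
apply: (Trace_root4 _ dP); apply: (@prime_expn_dvd_mul 2 a k d) => //.
have : z2 ^+ (k * d * 3 ^ b) == 1.
  have := prim_expr_order dP; rewrite exprMn -!exprM => h.
  rewrite -[X in _ == X](expr1n _ (3 ^ b)) -h exprMn -!exprM.
  have z3e : z3 ^+ (l * d * 3 ^ b) = 1.
    by rewrite mulnC exprM (prim_expr_order z3P) expr1n.
  by rewrite z3e mulr1.
by rewrite -(prim_order_dvd z2P) Gauss_dvdl // coprimeXl // coprimeXr.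
Qed.

Lemma Trace_z30 l : ~~ (B %| l)%N -> Trace (z3 ^+ l) = 0.
Proof.
move=> Bl; have l0 : (0 < l)%N by case: l Bl => //; rewrite dvdn0.
have [d dP _] : {d | d.-primitive_root (z3 ^+ l) & (d %| 3 ^ b)%N}.
  apply: prim_order_exists; first by rewrite expn_gt0.
  by rewrite exprAC (prim_expr_order z3P) expr1n.
have d0 := prim_order_gt0 dP.
apply: (Trace_root9 _ dP); apply: (@prime_expn_dvd_mul 3 b l d) => //.
by rewrite (prim_order_dvd z3P) exprM (prim_expr_order dP).
Qed.

Lemma Trace_z3 l : Trace (z3 ^+ (B * l)) =
  if (3 %| l)%N then n%:R else - (A * B)%:R.
Proof.
rewrite exprM; case: ifP => l3.
  have /eqP -> : z3 ^+ B ^+ l == 1 by rewrite -(prim_order_dvd z3B).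
  exact: Trace1.
have zl : 3.-primitive_root (z3 ^+ B ^+ l).
  by rewrite (prim_root_exp_coprime _ z3B) coprime_sym prime_coprime // l3.
have := Trace_prime_root (isT : prime 3) zl.
by rewrite nE natrM /= => h; lra.
Qed.

(** Inverses are written as powers of exponent order minus 1, so that all exponents stay natural
    numbers. *)
Lemma Trace_xx i j i' j' :
  tr_form theta (x i j) (x i' j') = Trace (x (i + i' * (2 ^ a).-1) (j + j' * (3 ^ b).-1)).
Proof.
have inv z N k : (0 < N)%N -> z ^+ N = 1 -> z^-1 ^+ k = z ^+ (k * N.-1) :> K.
  move=> N0 zN; rewrite mulnC exprM; congr (_ ^+ _).
  have z0 : z != 0.
    by apply: contra_eq_neq zN => ->; rewrite expr0n gtn_eqF // eq_sym oner_eq0.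
  by apply: (mulfI z0); rewrite divff // -exprS prednK.
rewrite /tr_form rmorphM !rmorphXn theta_z2 theta_z3.
rewrite (inv z2 (2 ^ a)%N) ?expn_gt0 ?(prim_expr_order z2P) //.
rewrite (inv z3 (3 ^ b)%N) ?expn_gt0 ?(prim_expr_order z3P) //.
by rewrite mulrACA -!exprD.
Qed.

Lemma Gram_neq_i i j i' j' : (i < A)%N -> (i' < A)%N -> i != i' ->
  tr_form theta (x i j) (x i' j') = 0.
Proof.
move=> iA i'A ii; rewrite Trace_xx Trace_x0 //; apply: contra ii => /dvdnP[k kE].
have {}kE : (i + i' * A * 2 = k * A + i')%N.
  rewrite -kE A2E; have := A_gt0; nia.
rewrite -(modn_small iA) -(modn_small i'A); apply/eqP.
have := congr1 (modn^~ A) kE.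
rewrite (_ : i + i' * A * 2 = i' * 2 * A + i)%N; last by lia.
by rewrite !modnMDl.
Qed.

Lemma Gram_eq_i i j j' : (i < A)%N ->
  tr_form theta (x i j) (x i j') = Trace (z3 ^+ (j + j' * (3 ^ b).-1)).
Proof.
move=> iA; rewrite Trace_xx; congr Trace.
rewrite -{1}[i]muln1 -mulnDr add1n prednK ?expn_gt0 // mulnC exprM.
by rewrite (prim_expr_order z2P) expr1n mul1r.
Qed.

Lemma Gram_neq_j i j j' : (i < A)%N -> (j != j' %[mod B])%N ->
  tr_form theta (x i j) (x i j') = 0.
Proof.
move=> iA jj; rewrite Gram_eq_i // Trace_z30 //; apply: contra jj => /dvdnP[k kE].
have {}kE : (j + j' * 3 * B = k * B + j')%N.
  rewrite -kE B3E; have := B_gt0; nia.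
have := congr1 (modn^~ B) kE.
by rewrite modnMDl addnC modnMDl => ->.
Qed.

Lemma Gram_eq_j i j l l' : (i < A)%N -> (l <= l' + 2)%N ->
  tr_form theta (x i (j + B * l)) (x i (j + B * l')) =
  if (l == l' %[mod 3])%N then n%:R else - (A * B)%:R.
Proof.
move=> iA ll; rewrite Gram_eq_i //.
(* The difference l - l' is written as l + 2 l' - 3 l'; the truncated subtraction is exact because
   [B] is at least 1. *)
have -> : (j + B * l + (j + B * l') * (3 ^ b).-1 = 
   B * (l + 2 * l' + 3 * (j + B * l' - l')))%N.
  have := B_gt0; rewrite B3E; nia.
rewrite Trace_z3; congr (if _ then _ else _).
have -> : (l + 2 * l' + 3 * (j + B * l' - l'))%N = (l + 2 * l' + (j + B * l' - l') * 3)%N.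
  by rewrite [(3 * _)%N]mulnC.
by rewrite dvdn_addl ?dvdn_mull //; apply/idP/eqP; lia.
Qed.

(** The pairs (i, j) with i < A and j < B are enumerated by the single index t = i B + j, the form
    that [A2_frame] takes. *)
Definition cyc_u t : K := x (t %/ B) (t %% B).
Definition cyc_v t : K := x (t %/ B) (t %% B + B).
Local Notation s := (A * B)%N.

Lemma divB_lt t : (t < s)%N -> (t %/ B < A)%N.
Proof. by move=> ts; rewrite ltn_divLR // B_gt0. Qed.

Lemma cyc_Gram t t' : (t < s)%N -> (t' < s)%N ->
  [/\ tr_form theta (cyc_u t) (cyc_u t') = s%:R * (2 * (t == t'))%:R,
      tr_form theta (cyc_v t) (cyc_v t') = s%:R * (2 * (t == t'))%:R,
      tr_form theta (cyc_u t) (cyc_v t') = s%:R * - (t == t')%:R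
    & tr_form theta (cyc_v t) (cyc_u t') = s%:R * - (t == t')%:R].
Proof.
move=> ts t's; have tA := divB_lt ts; have t'A := divB_lt t's.
rewrite /cyc_u /cyc_v.
have [<-|tt] := eqVneq t t'.
  have G l l' := @Gram_eq_j (t %/ B) (t %% B) l l' tA.
  have := G 0%N 0%N isT; have := G 1%N 1%N isT.
  have := G 0%N 1%N isT; have := G 1%N 0%N isT.
  rewrite !muln1 !muln0 !addn0 /= => -> -> -> ->.
  by rewrite nE natrM mulrN1.
have z : forall j j', (j = t %% B \/ j = t %% B + B)%N ->
    (j' = t' %% B \/ j' = t' %% B + B)%N ->
    tr_form theta (x (t %/ B) j) (x (t' %/ B) j') = 0.
  move=> j j' jE j'E; have [e|ne] := eqVneq (t %/ B)%N (t' %/ B)%N; last exact: Gram_neq_i.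
  rewrite -e; apply: Gram_neq_j => //; apply: contra_neq tt => jj.
  rewrite (divn_eq t B) (divn_eq t' B) -e; congr (_ + _)%N.
  by case: jE => jE; case: j'E => j'E; move: jj; rewrite jE j'E ?modnDr ?modn_mod.
by rewrite !z; auto; rewrite ?muln0 ?mulr0 ?oppr0 ?mulr0.
Qed.

Definition frame_span : set K := [set y | exists k l : nat -> int,
  y = \sum_(t < s) (cyc_u t *~ k t + cyc_v t *~ l t)].

Lemma frame_span_subgroup : is_subgroup frame_span.
Proof.
split=> [|_ _ [k [l ->]] [k' [l' ->]]].
  by exists (fun=> 0), (fun=> 0); rewrite big1 // => t _; rewrite !mulr0z addr0.
exists (fun t => k t - k' t), (fun t => l t - l' t).
rewrite -sumrB; apply: eq_bigr => t _.
by rewrite !mulrzBr opprD addrACA.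
Qed.

(** Exponents are lowered by the relations [z2 ^+ A = -1] and [1 + z3 ^+ B + z3 ^+ (B + B) = 0]. The
    second is a recursion of order two, whose initial values are the two frame vectors. *)
Lemma frame_span_x i j : frame_span (x i j).
Proof.
have sg := frame_span_subgroup.
have u i' j' : (i' < A)%N -> (j' < B)%N ->
    frame_span (x i' j') /\ frame_span (x i' (j' + B)).
  move=> iA jB; have ts : (i' * B + j' < s)%N by nia.
  have tE : ((i' * B + j') %/ B = i' /\ (i' * B + j') %% B = j')%N.
    by rewrite divnMDl ?B_gt0 // divn_small // addn0 modnMDl modn_small.
  have one (F : nat -> K) : \sum_(t < s) F t *~ (t == i' * B + j' :> nat)%N = F (i' * B + j')%N.
    rewrite (bigD1 (Ordinal ts)) //= eqxx mulr1z big1 ?addr0 // => t tt.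
    by rewrite -(inj_eq val_inj) /= in tt; rewrite (negPf tt) mulr0z.
  split.
    exists (fun t => (t == i' * B + j')%N : int), (fun=> 0).
    under eq_bigr => t _ do rewrite mulr0z addr0.
    by rewrite one /cyc_u tE.1 tE.2.
  exists (fun=> 0), (fun t => (t == i' * B + j')%N : int).
  under eq_bigr => t _ do rewrite mulr0z add0r.
  by rewrite one /cyc_v tE.1 tE.2.
have v i' j' : (i' < A)%N -> frame_span (x i' j').
  move=> iA; rewrite (divn_eq j' B) addnC.
  elim/ltn_ind: (j' %/ B)%N => -[|[|l]] IH.
  - by rewrite mul0n addn0; case: (u i' (j' %% B)%N iA (ltn_pmod _ B_gt0)).
  - by rewrite mul1n; case: (u i' (j' %% B)%N iA (ltn_pmod _ B_gt0)).
  have -> : x i' (j' %% B + l.+2 * B) = - x i' (j' %% B + l * B) - x i' (j' %% B + l.+1 * B).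
    rewrite (_ : j' %% B + l.+2 * B = (j' %% B + l * B) + (B + B))%N; last by lia.
    rewrite (_ : j' %% B + l.+1 * B = (j' %% B + l * B) + B)%N; last by lia.
    move: (j' %% B + l * B)%N => r.
    by rewrite (exprD z3 r (B + B)) z3B2 (exprD z3 r B); ring.
  by apply: sg.2; [apply: subgroupN => //; exact: IH | exact: IH].
rewrite (divn_eq i A) addnC.
elim: (i %/ A)%N => [|k IH]; first by rewrite mul0n addn0; apply: v; rewrite ltn_pmod ?A_gt0.
rewrite (_ : i %% A + k.+1 * A = (i %% A + k * A) + A)%N; last by lia.
by rewrite exprD z2A mulrN1 mulNr; exact: subgroupN.
Qed.

Lemma mono_frame y : mono_ring z2 z3 y -> frame_span y.
Proof. by apply; [exact: frame_span_subgroup | exact: frame_span_x]. Qed.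

Lemma frame_mono k l : mono_ring z2 z3 (\sum_(t < s) (cyc_u t *~ k t + cyc_v t *~ l t)).
Proof.
have sg := mono_ring_subgroup z2 z3.
by apply: (subgroup_sum sg) => t _; apply: (subgroupD sg);
   apply: (subgroupMz sg); exact: mono_ring_mono.
Qed.

(** [y] is a rational polynomial in [z2 * z3], and [c] clears its denominators. *)
Lemma K_fraction_mono (y : K) : exists2 c : int, c != 0 & mono_ring z2 z3 (y *~ c).
Proof.
have sg := mono_ring_subgroup z2 z3.
have : y \in <<1; z2 * z3>>%VS by rewrite K_gen memvf.
move=> /Fadjoin1_polyP[p ->].
have [q [c c0 pE]] := rat_poly_scale p; exists c => //.
have -> : (map_poly (in_alg K) p).[z2 * z3] *~ c = (map_poly intr q).[z2 * z3].
  rewrite pE map_polyZ hornerZ mulr_algl -scaler_int scalerA mulfV ?intr_eq0 //.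
  rewrite scale1r -map_poly_comp; congr (_.[_]); apply: eq_map_poly => k /=.
  by rewrite -in_algE rmorph_int.
rewrite horner_coef; apply: (subgroup_sum sg) => i _.
rewrite coef_map_id0 // mulrzl exprMn; apply: (subgroupMz sg).
exact: mono_ring_mono.
Qed.

Lemma x_O i j : x i j \in O.
Proof.
apply: O_mul; apply: O_exp.
  by apply: O_unity_root (prim_expr_order z2P); rewrite expn_gt0.
by apply: O_unity_root (prim_expr_order z3P); rewrite expn_gt0.
Qed.

Lemma tr_form_sum (k l : nat -> int) z :
  tr_form theta (\sum_(t < s) (cyc_u t *~ k t + cyc_v t *~ l t)) z =
  \sum_(t < s) ((k t)%:~R * tr_form theta (cyc_u t) z
                 + (l t)%:~R * tr_form theta (cyc_v t) z).
Proof.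
rewrite /tr_form mulr_suml Trace_sum; apply: eq_bigr => t _.
by rewrite mulrDl [in LHS]mulrzAl [in LHS]mulrzAl TraceD !TraceMz.
Qed.

Lemma tr_form_frame (k l : nat -> int) t : (t < s)%N ->
  let y := \sum_(t < s) (cyc_u t *~ k t + cyc_v t *~ l t) in
  tr_form theta y (cyc_u t) = s%:R * (2 * k t - l t)%:~R /\
  tr_form theta y (cyc_v t) = s%:R * (2 * l t - k t)%:~R.
Proof.
move=> ts /=; rewrite !tr_form_sum; split; rewrite (bigD1 (Ordinal ts)) //= big1 ?addr0.
- have [-> _ _ ->] := cyc_Gram ts ts.
  by rewrite eqxx /= muln1 intrB intrM; ring.
- move=> i it; have [-> _ _ ->] := cyc_Gram (ltn_ord i) ts.
  by rewrite -(inj_eq val_inj) /= in it; rewrite (negPf it) muln0 oppr0 !mulr0 addr0.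
- have [_ -> -> _] := cyc_Gram ts ts.
  by rewrite eqxx /= muln1 intrB intrM; ring.
- move=> i it; have [_ -> -> _] := cyc_Gram (ltn_ord i) ts.
  by rewrite -(inj_eq val_inj) /= in it; rewrite (negPf it) muln0 oppr0 !mulr0 addr0.
Qed.

(* The coordinates of y on the frame are integral combinations of the traces of y
   against the frame, divided by 3 s. *)
Lemma O_mul_mono y : y \in O -> mono_ring z2 z3 (y *+ (3 * s)).
Proof.
move=> yO; have [c c0 /mono_frame[k [l yE]]] := K_fraction_mono y.
have exu t : exists p : int, tr_form theta y (cyc_u t) = p%:~R.
  by apply: traceO; apply: O_mul => //; apply/O_rmorph/x_O.
have exv t : exists p : int, tr_form theta y (cyc_v t) = p%:~R.
  by apply: traceO; apply: O_mul => //; apply/O_rmorph/x_O.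
pose p t := projT1 (cid (exu t)); pose q t := projT1 (cid (exv t)).
have pE t : tr_form theta y (cyc_u t) = (p t)%:~R by rewrite /p; case: cid.
have qE t : tr_form theta y (cyc_v t) = (q t)%:~R by rewrite /q; case: cid.
have cform z : tr_form theta (y *~ c) z = c%:~R * tr_form theta y z.
  by rewrite /tr_form mulrzAl TraceMz.
(* The coefficients 2, 1 and 1, 2 form three times the inverse of the Gram matrix of A_2. *)
have kl t : (t < s)%N -> c * (2 * p t + q t) = 3 * s%:Z * k t /\
    c * (p t + 2 * q t) = 3 * s%:Z * l t.
  move=> ts; have [h1 h2] := tr_form_frame k l ts.
  rewrite -yE cform pE in h1; rewrite -yE cform qE in h2.
  have {}h1 : c * p t = s%:Z * (2 * k t - l t).
    by apply: (@intr_inj rat); rewrite !intrM h1.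
  have {}h2 : c * q t = s%:Z * (2 * l t - k t).
    by apply: (@intr_inj rat); rewrite !intrM h2.
  split.
    by rewrite mulrDr mulrCA h1 h2; ring.
  by rewrite mulrDr [c * (2 * _)]mulrCA h1 h2; ring.
have -> : y *+ (3 * s) = \sum_(t < s)
    (cyc_u t *~ (2 * p t + q t) + cyc_v t *~ (p t + 2 * q t)).
  have cK : injective (fun w : K => w *~ c).
    move=> w w' /= /eqP; rewrite -subr_eq0 -mulrzBl -scaler_int scaler_eq0 intr_eq0.
    by rewrite (negPf c0) /= subr_eq0 => /eqP.
  apply: cK => /=; rewrite pmulrn -mulrzA mulrC mulrzA yE mulrz_suml mulrz_suml.
  apply: eq_bigr => t _; have [h1 h2] := kl t (ltn_ord t).
  rewrite !mulrzDl -!mulrzA [(2 * _ + _) * c]mulrC [(_ + 2 * _) * c]mulrC h1 h2.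
  by rewrite [k t * _]mulrC [l t * _]mulrC PoszM.
exact: frame_mono.
Qed.

(** All powers of an integer share the denominator 3 s = 2^(a-1) 3^b. It is removed one prime factor
    at a time, with the roles of the two generators exchanged between the primes 2 and 3. *)
Lemma O_frame y : y \in O -> frame_span y.
Proof.
move=> yO; apply: mono_frame.
have bd k : bounded_powers z2 z3 (y *+ k).
  exists (3 * s)%N; first by rewrite !muln_gt0 A_gt0 B_gt0.
  by move=> l; apply: O_mul_mono; apply: O_exp; rewrite rpredMn.
have sat2 k : mono_ring z2 z3 (y *+ k *+ 2) -> mono_ring z2 z3 (y *+ k).
  apply: (@p_saturated K z2 z3 2 isT a a_gt0 z2P (3 ^ b)%N) => //.
  - by rewrite expn_gt0.
  - by rewrite coprimeXr.
  - exact: prim_expr_order z3P.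
have sat3 k : mono_ring z2 z3 (y *+ k *+ 3) -> mono_ring z2 z3 (y *+ k).
  rewrite mono_ringC.
  apply: (@p_saturated K z3 z2 3 isT b b_gt0 z3P (2 ^ a)%N) => //.
  - by rewrite expn_gt0.
  - by rewrite coprimeXr.
  - exact: prim_expr_order z2P.
  - have [N N0 h] := bd k; exists N => // l; rewrite mono_ringC; exact: h.
have red2 e N : mono_ring z2 z3 (y *+ (2 ^ e * N)) -> mono_ring z2 z3 (y *+ N).
  elim: e => [|e IH]; first by rewrite mul1n.
  by rewrite expnS -mulnA mulnC mulrnA => h; apply: IH; exact: sat2.
have red3 e : mono_ring z2 z3 (y *+ (3 ^ e)) -> mono_ring z2 z3 (y *+ 1).
  elim: e => [//|e IH]; rewrite expnS mulnC mulrnA => h; apply: IH; exact: sat3.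
have := O_mul_mono yO; rewrite (_ : 3 * s = A * 3 ^ b)%N; last first.
  by rewrite B3E mulnCA [(3 * _)%N]mulnC.
by move=> /red2 /red3.
Qed.

End Cyclotomic.

(** * Indecomposable components *)

Section Components.
Variable L : zform.
Hypothesis bL : bilinear_form L.
Hypothesis symL : forall x y : L, lform x y = lform y x.
Hypothesis pdL : posdef_form L.
Hypothesis evL : even_lattice L.

Lemma lform_eq0 (x : L) : lform x x = 0 -> x = 0.
Proof.
move=> xx; apply/eqP; apply: contraT => /pdL.2.
by rewrite xx ltxx.
Qed.

Lemma even_lform_ge2 (x : L) : x != 0 -> 2 <= lform x x.
Proof.
move=> x0; have := pdL.2 _ x0; have [k ->] := evL x.
rewrite ltr0z => k0; suff : (2%:~R : rat) <= (2 * k)%:~R by [].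
by rewrite ler_int; lia.
Qed.

(** If two families have the same sum, pairing the vanishing sum of their differences with one of
    these differences leaves just its norm. *)
Lemma orthogonal_sum_inj (I : finType) (S : I -> set L) :
    (forall i, is_subgroup (S i)) ->
    (forall i j, i != j -> forall x y, S i x -> S j y -> lform x y = 0) ->
  set_inj [set y : {ffun I -> L} | forall i, S i (y i)] (fun y => \sum_i y i).
Proof.
move=> sg orth y z; rewrite !inE /= => yS zS yz; apply/ffunP => i.
apply/eqP; rewrite -subr_eq0; apply/eqP/lform_eq0.
have d0 : \sum_j (y j - z j) = 0 by rewrite sumrB yz subrr.
have dS j : S j (y j - z j) by apply: (sg j).2.
rewrite -[RHS](lform0l bL (y i - z i)) -d0 (lform_suml bL) (bigD1 i) //=.
by rewrite big1 ?addr0 // => j ji; apply: orth ji _ _ (dS j) (dS i).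
Qed.

(** The norm is the sum of the norms of the components, and each nonzero one contributes at least
    2. *)
Lemma root_in_component (I : finType) (S : I -> set L) T x :
    orthogonal_decomposition T S -> T x -> lform x x = 2 ->
  exists i, S i x.
Proof.
move=> [sg orth [_ _ surj]] Tx xx; have [y /= yS yx] := surj x Tx.
have xE : lform x x = \sum_i lform (y i) (y i).
  rewrite -yx (lform_suml bL); apply: eq_bigr => i _.
  rewrite (lform_sumr bL) (bigD1 i) //= big1 ?addr0 // => j ji.
  by apply: orth (yS i) (yS j); rewrite eq_sym.
have [[i yi]|y0] := pselect (exists i, y i != 0); last first.
  move: xx; rewrite xE big1 // => i _; have [->|yi] := eqVneq (y i) 0.
    exact: lform0l.
  by case: y0; exists i.
have yj j : j != i -> y j = 0.
  move=> ji; apply/eqP; apply: contraT => yj.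
  have := even_lform_ge2 yi; have := even_lform_ge2 yj.
  have : 0 <= \sum_(l | (l != i) && (l != j)) lform (y l) (y l).
    apply: sumr_ge0 => l _; have [->|yl] := eqVneq (y l) 0.
      by rewrite lform0l.
    exact/ltW/pdL.2.
  move: xx; rewrite xE (bigD1 i) //= (bigD1 j) //=.
  by move: (lform (y i) _) (lform (y j) _) (\sum_(l | _) _) => p q r; lra.
exists i; rewrite -yx (bigD1 i) //= big1 ?addr0 //.
Qed.

Variables (s : nat) (u v : nat -> L).
Hypothesis uv : A2_frame s u v.
Hypothesis uv_span : forall y, exists k l : nat -> int,
  y = \sum_(i < s) (u i *~ k i + v i *~ l i).

Definition Zspan_pair (x y : L) : set L := [set z | exists k l : int, z = x *~ k + y *~ l].
Local Notation Z := (fun t => Zspan_pair (u t) (v t)).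

Lemma Zspan_pair_subgroup x y : is_subgroup (Zspan_pair x y).
Proof.
split=> [|_ _ [k [l ->]] [k' [l' ->]]]; first by exists 0, 0; rewrite !mulr0z addr0.
by exists (k - k'), (l - l'); rewrite !mulrzBr opprD addrACA.
Qed.

Lemma u_in_Z t : Z t (u t).
Proof. by exists 1, 0; rewrite mulr1z mulr0z addr0. Qed.

Lemma v_in_Z t : Z t (v t).
Proof. by exists 0, 1; rewrite mulr1z mulr0z add0r. Qed.

Lemma Zspan_pair_sub (S : set L) x y : is_subgroup S -> S x -> S y ->
  Zspan_pair x y `<=` S.
Proof.
move=> sg Sx Sy _ [k [l ->]].
by apply: (subgroupD sg); exact: (subgroupMz sg).
Qed.

Lemma u_neq0 t : (t < s)%N -> u t != 0.
Proof.
move=> ts; have [uu _ _ _] := uv ts ts; apply: contra_eq_neq uu => ->.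
by rewrite lform0l // eqxx.
Qed.

Lemma Z_orth t t' : (t < s)%N -> (t' < s)%N -> t != t' ->
  forall x y, Z t x -> Z t' y -> lform x y = 0.
Proof.
move=> ts t's tt _ _ [k [l ->]] [k' [l' ->]].
rewrite !(lformDl bL, lformDr bL, lformMzl bL, lformMzr bL).
by have [-> -> -> ->] := uv ts t's; rewrite (negPf tt) muln0 oppr0 !mulr0 !addr0.
Qed.

(** Each of the two roots lies in some component, and in the same one because they pair to -1. *)
Lemma Z_in_component (I : finType) (S : I -> set L) T t : (t < s)%N ->
  Z t `<=` T -> orthogonal_decomposition T S -> exists i, Z t `<=` S i.
Proof.
move=> ts ZT dS; have [uu vv uvt _] := uv ts ts; rewrite eqxx muln1 in uu vv.
have [i Siu] := root_in_component dS (ZT _ (u_in_Z t)) uu.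
have [j Sjv] := root_in_component dS (ZT _ (v_in_Z t)) vv.
case: dS => sg orth _.
have ij : i = j.
  apply/eqP; apply: contraT => ij; have := orth i j ij _ _ Siu Sjv.
  by rewrite uvt eqxx => /eqP; rewrite oppr_eq0 oner_eq0.
by exists i; apply: Zspan_pair_sub => //; rewrite ij.
Qed.

(** One part of a decomposition contains the whole span, so the other part is orthogonal to
    itself. *)
Lemma Z_indecomposable t : (t < s)%N -> indecomposable (Z t).
Proof.
move=> ts; split; first by exists (u t); [exact: u_in_Z | exact: u_neq0].
move=> A B dS; have [c Zc] := Z_in_component ts (@subset_refl _ (Z t)) dS.
case: dS => sg orth [fT _ _].
have z : (if ~~ c then A else B) = [set 0].
  apply/seteqP; split=> [y yS|_ ->]; last by case: (sg (~~ c)).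
  suff Zy : Z t y.
    by apply: lform_eq0; apply: (orth (~~ c) c) => //; [case: (c) | exact: Zc].
  pose f : {ffun bool -> L} := [ffun d => if d == ~~ c then y else 0].
  have -> : y = \sum_d f d.
    rewrite (bigD1 (~~ c)) //= big1 ?addr0 ?ffunE ?eqxx // => d dc.
    by rewrite ffunE (negPf dc).
  apply: fT => d; rewrite ffunE; case: eqP => [->//|_]; exact: (sg d).1.
by case: c z {Zc} => /= z; [right | left].
Qed.

Lemma Z_decomposition :
  orthogonal_decomposition [set: L] (fun t : 'I_s => Z t).
Proof.
have sg (i : 'I_s) : is_subgroup (Z i) := Zspan_pair_subgroup _ _.
have orth (i j : 'I_s) : i != j -> forall x y, Z i x -> Z j y -> lform x y = 0.
  by move=> ij; apply: Z_orth.
split=> //; split=> //; first exact: (orthogonal_sum_inj sg orth).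
move=> y _; have [k [l yE]] := uv_span y.
exists [ffun i : 'I_s => u i *~ k i + v i *~ l i].
  by move=> i; rewrite ffunE; exists (k i), (l i).
by rewrite yE; apply: eq_bigr => i _; rewrite ffunE.
Qed.

(** [R] is the orthogonal complement of the span inside [S i]. Discarding the other frame
    coordinates projects [S i] onto the span and splits off [R], which indecomposability forces to
    be 0. *)
Lemma component_eq_Z (k : nat) (S : 'I_k -> set L) i t : (t < s)%N ->
    orthogonal_decomposition [set: L] S -> (forall i, indecomposable (S i)) ->
  Z t `<=` S i -> S i = Z t.
Proof.
move=> ts [sg _ _] indS ZS.
pose R : set L := [set y | [/\ S i y, lform y (u t) = 0 & lform y (v t) = 0]].
have RZ y z : Z t y -> R z -> lform z y = 0.
  move=> [p [q ->]] [_ zu zv].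
  by rewrite (lformDr bL) !(lformMzr bL) zu zv !mulr0 addr0.
have sgR : is_subgroup R.
  split; first by split; rewrite ?(lform0l bL) //; case: (sg i).
  move=> x y [Sx xu xv] [Sy yu yv]; split; first by apply: (sg i).2.
    by rewrite (lformDl bL) (lformNl bL) xu yu subrr.
  by rewrite (lformDl bL) (lformNl bL) xv yv subrr.
have sgb (c : bool) : is_subgroup (if c then Z t else R).
  by case: c => //; exact: Zspan_pair_subgroup.
have orthb (c d : bool) : c != d -> forall x y, (if c then Z t else R) x ->
    (if d then Z t else R) y -> lform x y = 0.
  case: c; case: d => // _ x y; first by move=> Zx Ry; rewrite symL; exact: RZ.
  by move=> Rx Zy; exact: RZ.
have dec : orthogonal_decomposition (S i) (fun c : bool => if c then Z t else R).
  split=> //; split=> [f fS||y Sy]; [|exact: (orthogonal_sum_inj sgb orthb)|].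
    rewrite big_bool; apply: (subgroupD (sg i)); first exact/ZS/(fS true).
    by case: (fS false).
  have [p [q yE]] := uv_span y.
  pose z := u t *~ p t + v t *~ q t.
  have Zz : Z t z by exists (p t), (q t).
  exists [ffun c : bool => if c then z else y - z]; last first.
    by rewrite big_bool !ffunE /= addrC subrK.
  case; rewrite ffunE //.
  have yz : y - z = \sum_(j < s | j != Ordinal ts) (u j *~ p j + v j *~ q j).
    by apply/eqP; rewrite subr_eq yE (bigD1 (Ordinal ts)) //= -/z addrC.
  have o w : Z t w -> lform (y - z) w = 0.
    move=> Zw; rewrite yz (lform_suml bL) big1 // => j jt.
    by apply: (Z_orth (ltn_ord j) ts jt _ Zw); exists (p j), (q j).
  split; first by apply: (sg i).2 => //; exact: ZS.
    exact/o/u_in_Z.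
  exact/o/v_in_Z.
have [_ /(_ (Z t) R dec)[Z0|R0]] := indS i.
  have : [set 0] (u t) by rewrite -Z0; exact: u_in_Z.
  by move=> /eqP; rewrite (negPf (u_neq0 ts)).
apply/seteqP; split=> // y Sy.
case: dec => _ _ [_ _ /(_ y Sy)[f fS <-]]; rewrite big_bool.
have -> : f false = 0 by have : R (f false) := fS false; rewrite R0.
by rewrite /= addr0; exact: (fS true).
Qed.

(** If no span lay in [S i], all would lie in other components, so [S i] would be orthogonal to the
    whole lattice and hence to itself. *)
Lemma component_has_Z (k : nat) (S : 'I_k -> set L) i :
    orthogonal_decomposition [set: L] S -> indecomposable (S i) ->
  exists2 t, (t < s)%N & Z t `<=` S i.
Proof.
move=> dS [[x Sx x0] _]; apply: contrapT => nt.
have [p [q xE]] := uv_span x.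
move/eqP: x0; apply; apply: lform_eq0; rewrite {2}xE (lform_sumr bL) big1 // => t _.
have [j Zj] := Z_in_component (ltn_ord t) (@subsetT _ _) dS.
have ij : i != j.
  by apply: contra_notN nt => /eqP ij; exists t; rewrite ?ltn_ord ?ij.
case: dS => _ orth _; apply: orth ij _ _ Sx _; apply: Zj.
by exists (p t), (q t).
Qed.

Lemma A2_components (D : set (set L)) :
  indecomposable_components D <-> D = [set Z t | t in [set t | (t < s)%N]].
Proof.
split=> [[k [S [dS indS ->]]]|->].
  apply/seteqP; split=> [_ [i _ <-]|_ [t ts <-]].
    have [t ts Zi] := component_has_Z dS (indS i).
    by exists t => //; rewrite (component_eq_Z ts dS indS Zi).
  have [i Zi] := Z_in_component ts (@subsetT _ _) dS.
  by exists i => //; rewrite (component_eq_Z ts dS indS Zi).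
exists s, (fun t : 'I_s => Z t); split; first exact: Z_decomposition.
  by move=> i; exact: Z_indecomposable.
apply/seteqP; split=> [_ [t ts <-]|_ [i _ <-]]; first by exists (Ordinal ts).
by exists i => //; exact: ltn_ord.
Qed.

End Components.

(** * The equivalences and the explicit lattice *)

Section TraceLattice.
Variables (K : fieldExtType rat) (theta : {rmorphism K -> K}).
Hypothesis thetaK : forall x, theta (theta x) = x.
Local Notation n := (\dim {:K}).
Local Notation O := (@ring_of_integers K).
Variable m : nat.
Hypothesis m_gt0 : (0 < m)%N.
Hypothesis traceO : [set Trace x | x in [set x : K | x \in O]] =
  [set m%:R * k%:~R | k in [set: int]].
Let L := trace_lattice theta.
Let Lm := scale_lattice m%:R^-1 L.

Lemma Lm_bilinear : bilinear_form Lm.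
Proof.
split=> x y z; rewrite /= -mulrDr; congr (_ * _).
  exact: etrans (congr1 _ (mulrDl _ _ _)) (TraceD _ _).
by rewrite /tr_form -TraceD -mulrDr; congr Trace; congr (_ * _); exact: rmorphD.
Qed.

Lemma Lm_sym (x y : Lm) : lform x y = lform y x.
Proof. by rewrite /= (tr_form_sym thetaK). Qed.

Lemma Lm_int (x y : Lm) : exists k : int, lform x y = k%:~R.
Proof.
have [k kE] := O_trace traceO (O_mul (valP x) (O_rmorph theta (valP y))).
by exists k; rewrite /= /tr_form kE mulKf // (m_neq0 m_gt0).
Qed.

(** Similarity means that the form of [M] is [c] times that of [Lm]. Since some integer has trace m,
    [c] is itself a value of the form of [M], hence an integer. It is positive by definiteness at 1,
    and it divides all values because [Lm] is integral, so primitivity of [M] gives c = 1. *)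
Lemma similar_to_root_lattice :
  (exists M : zform, even_primitive_root_lattice M /\ similar_lattices L M) ->
  even_primitive_root_lattice Lm.
Proof.
move=> [M [Mr [m1 [m2 [m10 m20 [f [fb fI]]]]]]].
have [_ Mp Mroot] := Mr; have [M0 Mpos] := root_lattice_posdef Mroot.
have m2r : m2%:~R != 0 :> rat by rewrite intr_eq0.
pose c : rat := m1%:~R * m%:R / m2%:~R.
have cE (x y : Lm) : lform (f x : M) (f y) = c * lform x y.
  have := fI x y; rewrite /= => h.
  apply: (mulfI m2r); rewrite h /c; field.
  by rewrite m2r (m_neq0 m_gt0).
have [x xO xm] := O_trace_m traceO.
have c1 : lform (f (Zsub xO) : M) (f (Zsub (O1 K))) = c.
  rewrite cE /= /tr_form rmorph1 mulr1 xm mulVf ?mulr1 //; exact: (m_neq0 m_gt0).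
have c0 : 0 < c.
  have := cE (Zsub (O1 K)) (Zsub (O1 K)); rewrite /= /tr_form rmorph1 mulr1 Trace1.
  have f1 : (f (Zsub (O1 K)) : M) != 0.
    apply/eqP => f10; have /(bij_inj fb) : f (Zsub (O1 K)) = f 0 by rewrite raddf0.
    by move=> /(congr1 val) /eqP; rewrite /= oner_eq0.
  have := Mpos _ f1 => /[swap] ->; rewrite pmulr_lgt0 //.
  by rewrite mulr_gt0 ?invr_gt0 ?ltr0n // dimK_gt0.
have [[_ Mi _ _ _] _ _] := Mroot.
have /intrP[d dE] : c \is a Num.int by rewrite -c1; exact: Mi.
have d1 : `|d|%N = 1%N.
  apply: Mp => y z; have [h hK kK] := fb; rewrite -(kK y) -(kK z).
  have [k kE] := Lm_int (h y) (h z); exists k.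
  rewrite cE kE dE -intrM; congr (_ * _)%:~R.
  by rewrite gez0_abs // -(ler_int rat) -dE ltW.
have c_1 : c = 1.
  have d0 : 0 <= d by rewrite -(ler_int rat) -dE ltW.
  by rewrite dE -(gez0_abs d0) d1.
apply: even_primitive_root_isometric Mr; exists f; split=> // y z.
by rewrite cE c_1 mul1r.
Qed.

Lemma root_to_similar : even_primitive_root_lattice Lm ->
  exists M : zform, even_primitive_root_lattice M /\ similar_lattices L M.
Proof.
move=> LmR; exists Lm; split=> //; exists 1, m%:Z; split=> //.
  by rewrite -lt0n.
exists (idfun : {additive _ -> _}); split; first by exists idfun.
by move=> x y; exact: (etrans (mulVKf (m_neq0 m_gt0) _) (esym (mul1r _))).
Qed.

Lemma A2_to_root : ~~ odd n /\ isometric_lattices Lm (A2_power (n %/ 2)) ->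
  even_primitive_root_lattice Lm.
Proof.
move=> [no iA]; apply: even_primitive_root_isometric iA _.
apply: A2_power_even_primitive_root; have := dimK_gt0 K; move: n no => k; lia.
Qed.

Section CyclotomicLattice.
Variables a b : nat.
Hypothesis cycK : cyclotomic_with_conjugation theta a b.

(** Under an embedding [theta] becomes complex conjugation, which inverts numbers of absolute value
    1. *)
Lemma theta_unity_root x k : (0 < k)%N -> x ^+ k = 1 -> theta x = x^-1.
Proof.
case: cycK => _ _ [z zP Kz] conjK k0 xk; have [phi] := embedding_exists Kz.
apply: (fmorph_inj phi); rewrite conjK fmorphV.
have phik : `|phi x| = 1.
  apply/eqP; rewrite -(@pexpr_eq1 _ _ k) // -normrX -rmorphXn.
  by rewrite xk rmorph1 normr1.
by rewrite invC_norm phik expr1n invr1 mul1r.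
Qed.

Lemma cyclotomic_dim : n = (2 ^ a * 3 ^ b.-1)%N.
Proof.
case: cycK => a0 b0 [z zP Kz] _; rewrite (dim_cyclotomic zP Kz).
rewrite totient_coprime; last by rewrite coprimeXl // coprimeXr.
by rewrite !totient_pfactor //= mul1n mulnA -[in RHS](prednK a0) expnSr.
Qed.

Variables z2 z3 : K.
Hypothesis z2P : (2 ^ a).-primitive_root z2.
Hypothesis z3P : (3 ^ b).-primitive_root z3.

Lemma prod_prim_root : (2 ^ a * 3 ^ b).-primitive_root (z2 * z3).
Proof.
have w0 : (0 < 2 ^ a * 3 ^ b)%N by rewrite muln_gt0 !expn_gt0.
have cop : coprime (2 ^ a) (3 ^ b) by rewrite coprimeXl // coprimeXr.
have x1 : (z2 * z3) ^+ (2 ^ a * 3 ^ b) = 1.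
  rewrite exprMn exprM (prim_expr_order z2P) expr1n mul1r.
  by rewrite mulnC exprM (prim_expr_order z3P) expr1n.
have [d dP dw] := prim_order_exists w0 x1.
suff -> : (2 ^ a * 3 ^ b = d)%N by [].
apply/eqP; rewrite eqn_dvd dw andbT Gauss_dvd //; apply/andP; split.
  rewrite -(Gauss_dvdl _ cop) (prim_order_dvd z2P).
  have : (z2 * z3) ^+ (d * 3 ^ b) == 1 by rewrite exprM (prim_expr_order dP) expr1n.
  by rewrite exprMn [X in z3 ^+ X]mulnC [z3 ^+ _]exprM (prim_expr_order z3P) expr1n mulr1.
rewrite coprime_sym in cop; rewrite -(Gauss_dvdl _ cop) (prim_order_dvd z3P).
have : (z2 * z3) ^+ (d * 2 ^ a) == 1 by rewrite exprM (prim_expr_order dP) expr1n.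
by rewrite exprMn [X in z2 ^+ X]mulnC exprM (prim_expr_order z2P) expr1n mul1r.
Qed.

Lemma prod_generates : <<1; z2 * z3>>%VS = {:K}%VS.
Proof.
case: cycK => _ _ [z zP Kz] _.
have [i zE] := prim_rootP prod_prim_root (prim_expr_order zP).
apply/eqP; rewrite eqEsubv subvf -Kz /=; apply/FadjoinP; split; first exact: sub1v.
by rewrite zE; apply: rpredX; exact: memv_adjoin.
Qed.

Local Notation s := (2 ^ a.-1 * 3 ^ b.-1)%N.
Local Notation cu := (cyc_u b z2 z3).
Local Notation cv := (cyc_v b z2 z3).

Lemma O_traceZ x : x \in O -> exists k : int, Trace x = k%:~R.
Proof.
by move=> /(O_trace traceO)[k ->]; exists (m%:Z * k); rewrite intrM.
Qed.

Let a0 : (0 < a)%N. Proof. by case: cycK. Qed.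
Let b0 : (0 < b)%N. Proof. by case: cycK. Qed.
Let th2 : theta z2 = z2^-1.
Proof. by apply: theta_unity_root (prim_expr_order z2P); rewrite expn_gt0. Qed.
Let th3 : theta z3 = z3^-1.
Proof. by apply: theta_unity_root (prim_expr_order z3P); rewrite expn_gt0. Qed.

Lemma cyc_O_frame y : y \in O -> exists k l : nat -> int,
  y = \sum_(t < s) (cu t *~ k t + cv t *~ l t).
Proof.
exact: (O_frame O_traceZ a0 b0 z2P z3P th2 th3 prod_generates cyclotomic_dim).
Qed.

Lemma cyc_Gram_s t t' : (t < s)%N -> (t' < s)%N ->
  [/\ tr_form theta (cu t) (cu t') = s%:R * (2 * (t == t'))%:R,
      tr_form theta (cv t) (cv t') = s%:R * (2 * (t == t'))%:R,
      tr_form theta (cu t) (cv t') = s%:R * - (t == t')%:R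
    & tr_form theta (cv t) (cu t') = s%:R * - (t == t')%:R].
Proof. exact: (cyc_Gram a0 b0 z2P z3P th2 th3 cyclotomic_dim). Qed.

Lemma s_gt0 : (0 < s)%N. Proof. by rewrite muln_gt0 !expn_gt0. Qed.

(** The root [cv 0] has trace -s, so m divides s. Conversely, the trace is the pairing with the
    frame vector 1, and all pairings between frame vectors are multiples of s, so s divides every
    trace and in particular m. *)
Lemma mE : m = s.
Proof.
have u0 : cu 0 = 1 by rewrite /cyc_u div0n mod0n !expr0 mulr1.
have [_ _ _ vu] := cyc_Gram_s s_gt0 s_gt0.
rewrite u0 /tr_form rmorph1 mulr1 eqxx mulrN1 in vu.
have [k] : exists k : int, Trace (cv 0) = m%:R * k%:~R.
  by apply: (O_trace traceO); exact: (x_O z2P z3P).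
rewrite vu => mk.
have [x xO xm] := O_trace_m traceO.
have [p [q xE]] := cyc_O_frame xO.
have [] := tr_form_frame a0 b0 z2P z3P th2 th3 cyclotomic_dim p q s_gt0.
rewrite -xE u0 /tr_form rmorph1 mulr1 xm => ms _.
have {}ms : m%:Z = s%:Z * (2 * p 0%N - q 0%N).
  by apply: (@intr_inj rat); rewrite intrM.
have {}mk : - s%:Z = m%:Z * k.
  by apply: (@intr_inj rat); rewrite intrM mulrNz.
apply/eqP; rewrite eqn_dvd; apply/andP; split.
  have : (m%:Z %| - s%:Z)%Z by apply/dvdzP; exists k; rewrite mulrC.
  by rewrite dvdzE abszN.
have : (s%:Z %| m%:Z)%Z by apply/dvdzP; eexists; rewrite mulrC; exact: ms.
by rewrite dvdzE.
Qed.

Lemma n_2s : n = (s * 2)%N.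
Proof. by rewrite cyclotomic_dim -[in LHS](prednK a0) expnSr mulnAC. Qed.

Definition frame_u t : Lm := Zsub (x_O z2P z3P (t %/ 3 ^ b.-1) (t %% 3 ^ b.-1)).
Definition frame_v t : Lm :=
  Zsub (x_O z2P z3P (t %/ 3 ^ b.-1) (t %% 3 ^ b.-1 + 3 ^ b.-1)).

Lemma Lm_frame : A2_frame s frame_u frame_v.
Proof.
have s0 : s%:R != 0 :> rat by rewrite pnatr_eq0 -lt0n s_gt0.
move=> t t' ts t's; have [h1 h2 h3 h4] := cyc_Gram_s ts t's.
rewrite /Lm /= mE; split.
- by apply: (canLR (mulKf s0)); exact: h1.
- by apply: (canLR (mulKf s0)); exact: h2.
- by apply: (canLR (mulKf s0)); exact: h3.
- by apply: (canLR (mulKf s0)); exact: h4.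
Qed.

Lemma Lm_span (y : Lm) : exists k l : nat -> int,
  y = \sum_(t < s) (frame_u t *~ k t + frame_v t *~ l t).
Proof.
have [k [l yE]] := cyc_O_frame (valP y); exists k, l; apply: val_inj.
rewrite yE raddf_sum; apply: eq_bigr => t _.
by rewrite raddfD !raddfMz.
Qed.

Lemma Lm_isometric_A2 : isometric_lattices Lm (A2_power s).
Proof. exact: (A2_frame_isometric Lm_bilinear Lm_frame Lm_span). Qed.

Lemma Lm_components (D : set (set Lm)) : indecomposable_components D <->
  D = [set Zspan2 (z2 ^+ ij.1 * z3 ^+ ij.2) (z2 ^+ ij.1 * z3 ^+ (ij.2 + 3 ^ b.-1)%N)
      | ij in [set ij : nat * nat | (ij.1 < 2 ^ a.-1)%N /\ (ij.2 < 3 ^ b.-1)%N]].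
Proof.
have pd : posdef_form Lm.
  exact: posdef_form_isometric Lm_isometric_A2 (A2_power_posdef s).
have ev : even_lattice Lm.
  by have [] := even_primitive_root_isometric Lm_isometric_A2
    (A2_power_even_primitive_root s_gt0).
have H := A2_components Lm_bilinear Lm_sym pd ev Lm_frame Lm_span D.
apply: (iff_trans H); suff -> : [set Zspan_pair (frame_u t) (frame_v t) | t in [set t | (t < s)%N]]
  = [set Zspan2 (z2 ^+ ij.1 * z3 ^+ ij.2) (z2 ^+ ij.1 * z3 ^+ (ij.2 + 3 ^ b.-1)%N)
      | ij in [set ij : nat * nat | (ij.1 < 2 ^ a.-1)%N /\ (ij.2 < 3 ^ b.-1)%N]] by [].
have B0 : (0 < 3 ^ b.-1)%N by rewrite expn_gt0.
have ZE t : Zspan_pair (frame_u t) (frame_v t) = Zspan2 (cu t) (cv t).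
  apply/seteqP; split=> y [k [l yE]]; exists k, l.
    by rewrite yE raddfD !raddfMz.
  by apply: val_inj; rewrite raddfD !raddfMz.
apply/seteqP; split=> [_ [t ts <-]|_ [[i j] [/= iA jB] <-]].
  exists (t %/ 3 ^ b.-1, t %% 3 ^ b.-1)%N; last by rewrite ZE.
  by split=> /=; [rewrite ltn_divLR | rewrite ltn_pmod].
exists (i * 3 ^ b.-1 + j)%N; first by rewrite /=; nia.
by rewrite ZE /cyc_u /cyc_v divnMDl // divn_small // addn0 modnMDl modn_small.
Qed.

Lemma Lm_values i j : (i < 2 ^ a.-1)%N -> (j < 3 ^ b.-1)%N ->
  let x (i j : nat) := z2 ^+ i * z3 ^+ j in
  [/\ tr_form theta (x i j) (x i j) / m%:R = 2,
      tr_form theta (x i (j + 3 ^ b.-1)%N) (x i (j + 3 ^ b.-1)%N) / m%:R = 2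
    & tr_form theta (x i j) (x i (j + 3 ^ b.-1)%N) / m%:R = -1].
Proof.
move=> iA jB /=; have ts : (i * 3 ^ b.-1 + j < s)%N by nia.
have B0 : (0 < 3 ^ b.-1)%N by rewrite expn_gt0.
have := cyc_Gram_s ts ts.
rewrite /cyc_u /cyc_v divnMDl // divn_small // addn0 modnMDl modn_small //.
rewrite eqxx muln1 => -[-> -> -> _]; have := (m_neq0 m_gt0); rewrite mE => s0.
by split; rewrite mulrAC divff // mul1r.
Qed.

End CyclotomicLattice.

Lemma cyclotomic_to_A2 :
  (exists a b : nat, cyclotomic_with_conjugation theta a b) ->
  ~~ odd n /\ isometric_lattices Lm (A2_power (n %/ 2)).
Proof.
move=> [a [b cyc]]; have [_ _ [z zP _] _] := cyc.
have d2 : (2 ^ a %| 2 ^ a * 3 ^ b)%N by rewrite dvdn_mulr.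
have d3 : (3 ^ b %| 2 ^ a * 3 ^ b)%N by rewrite dvdn_mull.
have z2P := dvdn_prim_root zP d2; have z3P := dvdn_prim_root zP d3.
rewrite (n_2s cyc) muln2 odd_double -muln2 mulnK //; split=> //.
exact: (Lm_isometric_A2 cyc z2P z3P).
Qed.

End TraceLattice.

Theorem theorem3 (K : fieldExtType rat) (n : nat) (hn : n = \dim {:K})
    (theta : {rmorphism K -> K}) (htheta : forall x, theta (theta x) = x)
    (m : nat) (hm : (0 < m)%N)
    (htr : [set Trace x | x in [set x : K | x \in @ring_of_integers K]] =
           [set m%:R * k%:~R | k in [set: int]]) :
  let L := trace_lattice theta in
  let Lm := scale_lattice m%:R^-1 L in
  [<-> exists M : zform, even_primitive_root_lattice M /\ similar_lattices L M;
       even_primitive_root_lattice Lm;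
       ~~ odd n /\ isometric_lattices Lm (A2_power (n %/ 2));
       exists a b : nat, cyclotomic_with_conjugation theta a b]
  /\
  forall a b : nat, cyclotomic_with_conjugation theta a b ->
    [/\ n = (2 ^ a * 3 ^ b.-1)%N,
        m%:R = n%:R / 2 :> rat
      & forall z2 z3 : K,
          (2 ^ a).-primitive_root z2 -> (3 ^ b).-primitive_root z3 ->
          let x (i j : nat) := z2 ^+ i * z3 ^+ j in
          (forall D : set (set Lm),
             indecomposable_components D <->
             D = [set Zspan2 (x ij.1 ij.2) (x ij.1 (ij.2 + 3 ^ b.-1)%N)
                   | ij in [set ij : nat * nat |
                       (ij.1 < 2 ^ a.-1)%N /\ (ij.2 < 3 ^ b.-1)%N]])
          /\
          forall i j : nat, (i < 2 ^ a.-1)%N -> (j < 3 ^ b.-1)%N ->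
            [/\ tr_form theta (x i j) (x i j) / m%:R = 2,
                tr_form theta (x i (j + 3 ^ b.-1)%N) (x i (j + 3 ^ b.-1)%N)
                  / m%:R = 2
              & tr_form theta (x i j) (x i (j + 3 ^ b.-1)%N) / m%:R = -1]].
Proof.
subst n => L Lm.
(* The substantial implications go from (b) to (d), from (d) to (c) and from (c) to (b), while (a)
   is tied to (b) by rescaling; the stated cycle is composed of these. *)
have AB := similar_to_root_lattice hm htr.
have BD := root_cyclotomic_conj htheta hm htr.
have CB := @A2_to_root K theta m hm.
have DC := @cyclotomic_to_A2 K theta m htr.
split.
  by tfae=> [|r|c|d]; [exact: AB | exact/DC/BD | exact/BD/CB | exact: (root_to_similar hm (CB (DC d)))].
move=> a b cyc; split; first exact: cyclotomic_dim cyc.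
  have [_ _ [z zP _] _] := cyc.
  have d2 : (2 ^ a %| 2 ^ a * 3 ^ b)%N by rewrite dvdn_mulr.
  have d3 : (3 ^ b %| 2 ^ a * 3 ^ b)%N by rewrite dvdn_mull.
  have z2P := dvdn_prim_root zP d2; have z3P := dvdn_prim_root zP d3.
  by rewrite (n_2s cyc) (mE htr cyc z2P z3P) [(_ * 2)%:R]natrM mulfK.
move=> z2 z3 z2P z3P x; split.
  exact: (Lm_components htheta hm htr cyc z2P z3P).
by move=> i j iA jB; exact: (Lm_values hm htr cyc z2P z3P).
Qed.
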